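(* Let $f: H_1\times (V_{\varphi^{2}}(H_1),\rho)\to H_1$ and $g: H_1\times (V_{\varphi^{2}}(H_1),\rho)\to \mathcal{L}(H_2,H_1)$ satisfy, for all $x,y\in H_1$ and $\mu,\nu\in V_{\varphi^2}(H_1)$ and for $p\ge 2$, $$|f(x,\mu)-f(y,\nu)| \le K_{1}(|x-y|+\rho(\mu,\nu)),\qquad |g(x,\mu)-g(y,\nu)| \le K_{2}(|x-y|+\rho(\mu,\nu)),$$ $$|f(x,\mu)|^{p} \le K_{3}(1+|x|^{p}+\|\mu\|_{\varphi}^{p}),\qquad |g(x,\mu)|^{p} \le K_{4}(1+|x|^{p}+\|\mu\|_{\varphi}^{p}),$$ where $K_1,K_2,K_3,K_4$ are positive numbers independent of time ($K_3,K_4$ may depend on $p$). Let $A$ and $A_\varepsilon$ ($\varepsilon>0$) be infinitesimal generators of $C_0$-semigroups $\{S(t)\}_{t\ge0}$ and $\{S_\varepsilon(t)\}_{t\ge0}$ on $H_1$ with $A,A_\varepsilon\in G(M,\alpha)$ for all $\varepsilon>0$ and common constants $M\ge1$, $\alpha\ge0$, with $D(A_\varepsilon)=D(A)$, and with $\lim_{\varepsilon\to0}S_\varepsilon(t)=S(t)$ (strongly on $H_1$) uniformly in $t\in[0,T]$ for each $T\in(0,\infty)$. Fix $T\in(0,\infty)$ and let $x_0\in L_2(\Omega;H_1)$ be $\mathcal F_0$-measurable with values in $D(A)$. Let $x_\varepsilon$ and $x'$ satisfy, for $t\in[0,T]$, $P$-a.s., $$x_\varepsilon(t)=S_\varepsilon(t)x_0+\int_0^tS_\varepsilon(t-s)f(x_\varepsilon(s),\mu_\varepsilon(s))\,ds+\varepsilon\int_0^tS_\varepsilon(t-s)g(x_\varepsilon(s),\mu_\varepsilon(s))\,d\omega(s),$$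 $$x'(t)=S(t)x_0+\int_0^tS(t-s)f(x'(s),\mu'(s))\,ds,$$ where $\mu_\varepsilon(t)$ and $\mu'(t)$ are the probability distributions of $x_\varepsilon(t)$ and $x'(t)$. Then there exist a positive function $\tau(\varepsilon)$, decreasing monotonically to zero as $\varepsilon\downarrow0$, and a positive exponentially increasing function $\eta(t)$ (that is, $\eta(t)=e^{ct}$ with a constant $c>0$) such that $$E|x_\varepsilon(t)-x'(t)|^2\le\tau(\varepsilon)\,\eta(t),\qquad t\in[0,T],\ \varepsilon>0.$$
   Context: $H_1,H_2$ are real separable Hilbert spaces, $\mathcal L(H_2,H_1)$ is the space of bounded linear operators from $H_2$ to $H_1$; norms (including the operator norm) are written $|\cdot|$ or $\|\cdot\|$. $D(A)$ is the domain of $A$. $A\in G(M,\alpha)$ means that $A$ generates a $C_0$-semigroup $S(t)$ with $\|S(t)\|\le Me^{\alpha t}$ for all $t$. $(\Omega,\mathcal F,\{\mathcal F_t\},P)$ is a complete filtered probability space, $E$ is expectation, and $\{\omega(t)\}$ is an $H_2$-valued $Q$-Wiener process with respect to $\{\mathcal F_t\}$, where $Q$ is a nonnegative self-adjoint trace class operator on $H_2$: $\omega$ has continuous paths, is adapted, has mean zero, has increments $\omega(t)-\omega(u)$ ($u\le t$) independent of $\mathcal F_u$ with covariance operator $(t-u)Q$, and $\omega(t)=\sum_n \eta_n(t)e_n$ with $\{e_n\}$ orthonormal eigenvectors of $Q$, $Qe_n=\kappa_n e_n$, and $\eta_n$ mutually independent real Wiener processes with incremental variance $\kappa_n$. Stochastic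 integrals are Itô integrals. Put $\varphi(x)=1+|x|$ for $x\in H_1$. $V_{\varphi^2}(H_1)$ is the set of Borel probability measures $\mu$ on $H_1$ with $\int_{H_1}\varphi^2(x)\,\mu(dx)<\infty$, and $\|\mu\|_\varphi=\int_{H_1}\varphi(x)\,\mu(dx)$. It carries the metric $$\rho(\mu,\nu)=\sup\Big\{\int_{H_1}\psi\,d(\mu-\nu)\ :\ \psi:H_1\to\mathbb R \text{ continuous},\ \sup_{x\in H_1}\frac{|\psi(x)|}{\varphi^2(x)}+\sup_{x\ne h}\frac{|\psi(x)-\psi(h)|}{|x-h|}\le 1\Big\}.$$ The two integral equations define the mild solutions of $dx_\varepsilon=[A_\varepsilon x_\varepsilon+f(x_\varepsilon,\mu_\varepsilon)]dt+\varepsilon g(x_\varepsilon,\mu_\varepsilon)d\omega$ and of $dx'=[Ax'+f(x',\mu')]dt$ with $x_\varepsilon(0)=x'(0)=x_0$. Under the stated hypotheses each has a unique solution among $\mathcal F_t$-adapted processes that are continuous from $[0,T]$ to $L_2(\Omega;H_1)$; $x_\varepsilon$ and $x'$ denote these solutions. *)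

(* Defs.v *)
From Stdlib Require List.
From mathcomp Require Import all_boot all_order all_algebra.
From mathcomp Require Import all_classical all_reals all_analysis
  measurable_realfun.

Set Implicit Arguments.
Unset Strict Implicit.
Unset Printing Implicit Defensive.

Import Order.TTheory GRing.Theory Num.Theory.
Import numFieldNormedType.Exports.

Local Open Scope classical_set_scope.
Local Open Scope ring_scope.

(* The inner product is that of the norm carried by [H]; completeness is
   part of the type of [H]. *)
Record separable_hilbert (R : realType) (H : completeNormedModType R)
    (dot : {dot H for idfun}) : Prop := SeparableHilbert {
  hilbert_norm : forall x : H, dot x x = `|x| ^+ 2 ;
  hilbert_separable : exists2 D : set H, countable D & dense D }.

Record bounded_op (R : realType) (U V : normedModType R) := BoundedOp {
  bop_fun :> {linear U -> V} ;
  bop_continuous : continuous bop_fun }.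

Definition opnorm (R : realType) (U V : normedModType R) (L : U -> V) : R :=
  sup [set `|L x| | x in [set x : U | `|x| <= 1]].

(* Sequences indexed by a subset [N] of nat, so that finite and infinite
   orthonormal families are treated alike. *)
Definition orthonormal_family (R : realType) (H : normedModType R)
    (dot : {dot H for idfun}) (N : set nat) (b : nat -> H) : Prop :=
  forall m n, N m -> N n -> dot (b m) (b n) = (m == n)%:R.

Definition orthonormal_basis (R : realType) (H : normedModType R)
    (dot : {dot H for idfun}) (N : set nat) (b : nat -> H) : Prop :=
  orthonormal_family dot N b /\
  forall x : H,
    (\sum_(0 <= n < m | n \in N) dot x (b n) *: b n) @[m --> \oo] --> x.

(* For a nonnegative self-adjoint operator, being trace class means that the
   trace is finite; the sum does not depend on the orthonormal basis. *)
Record covariance_operator (R : realType) (H : normedModType R)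
    (dot : {dot H for idfun}) (Q : bounded_op H H) : Prop :=
  CovarianceOperator {
  cov_selfadjoint : forall h k : H, dot (Q h) k = dot h (Q k) ;
  cov_nonneg : forall h : H, 0 <= dot (Q h) h ;
  cov_trace_class : exists (N : set nat) (b : nat -> H),
    orthonormal_basis dot N b /\
    (\sum_(n <oo | n \in N) (dot (Q (b n)) (b n))%:E < +oo)%E }.

Record C0_semigroup (R : realType) (H : normedModType R)
    (S : R -> bounded_op H H) : Prop := C0Semigroup {
  semigroup0 : forall x : H, S 0 x = x ;
  semigroupD : forall s t x, 0 <= s -> 0 <= t -> S (s + t) x = S s (S t x) ;
  semigroup_continuous : forall x : H, S t x @[t --> 0^'+] --> x }.

(* The unbounded operator [A] has domain [D]; its values outside [D] are
   irrelevant. *)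
Definition generator (R : realType) (H : normedModType R)
    (S : R -> bounded_op H H) (D : set H) (A : H -> H) : Prop :=
  forall x y : H,
    (D x /\ A x = y) <-> h^-1 *: (S h x - x) @[h --> 0^'+] --> y.

(* [A] is in G(M, alpha), and [S] is the semigroup it generates. *)
Definition generates_in_G (R : realType) (H : normedModType R) (M alpha : R)
    (D : set H) (A : H -> H) (S : R -> bounded_op H H) : Prop :=
  [/\ C0_semigroup S, generator S D A &
      forall t, 0 <= t -> opnorm (S t) <= M * expR (alpha * t)].

Definition borel (T : ptopologicalType) := g_sigma_algebraType (@open T).

Definition phi (R : realType) (H : normedModType R) (x : H) : R := 1 + `|x|.

Record Vphi2 (R : realType) (H : normedModType R) := MkVphi2 {
  Vphi2_prob :> probability (borel H) R ;
  Vphi2_finite : (\int[Vphi2_prob]_x ((phi (x : H)) ^+ 2)%:E < +oo)%E }.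

Definition norm_phi (R : realType) (H : normedModType R) (mu : Vphi2 H) : R :=
  \int[mu]_x phi (x : H).

(* The quotient at [x = h] is [0 / 0 = 0], so that the second supremum is the
   Lipschitz seminorm. *)
Definition rho_test (R : realType) (H : normedModType R) : set (H -> R) :=
  [set psi | continuous psi /\
  (ereal_sup [set (`|psi x| / phi x ^+ 2)%:E | x in [set: H]] +
   ereal_sup [set (`|psi xh.1 - psi xh.2| / `|xh.1 - xh.2|)%:E
             | xh in [set: H * H]] <= 1)%E].

Definition rho (R : realType) (H : normedModType R) (mu nu : Vphi2 H) : R :=
  sup [set \int[mu]_x psi x - \int[nu]_x psi x | psi in @rho_test R H].

Definition measurable_wrt (Omega : Type) (d : measure_display)
    (E : measurableType d) (G : set (set Omega)) (X : Omega -> E) : Prop :=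
  forall B : set E, measurable B -> G (X @^-1` B).

Section Probability.
Context (R : realType) (d : measure_display) (Omega : measurableType d)
  (P : probability Omega R).

Definition mean_square (V : normedModType R) (X : Omega -> V) : \bar R :=
  (\int[P]_w (`|X w| ^+ 2)%:E)%E.

Definition L2_vector (V : normedModType R) (X : Omega -> V) : Prop :=
  measurable_fun setT (X : Omega -> borel V) /\ (mean_square X < +oo)%E.

Definition has_law (V : normedModType R) (X : Omega -> V)
    (mu : probability (borel V) R) : Prop :=
  forall B : set (borel V), measurable B -> P (X @^-1` B) = mu B.

(* Time runs over [0, +oo[; the values of [F] at negative times are
   irrelevant. *)
Record complete_filtration (F : R -> set (set Omega)) : Prop :=
  CompleteFiltration {
  filtration_sigma : forall t, 0 <= t -> sigma_algebra setT (F t) ;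
  filtration_sub : forall t, 0 <= t -> F t `<=` measurable ;
  filtration_mono : forall s t, 0 <= s -> s <= t -> F s `<=` F t ;
  filtration_null : P.-negligible `<=` F 0 }.

Definition process_sigma (E : R -> Prop) (X : R -> Omega -> R) :
    set (set Omega) :=
  <<s [set A | exists t B, [/\ E t, measurable B & A = X t @^-1` B]] >>.

Definition independent2 (G1 G2 : set (set Omega)) : Prop :=
  forall A B, G1 A -> G2 B -> P (A `&` B) = (P A * P B)%E.

Definition mutually_independent (N : set nat) (G : nat -> set (set Omega)) :
    Prop :=
  forall (s : seq nat) (A : nat -> set Omega), uniq s ->
    (forall n, n \in s -> N n /\ G n (A n)) ->
    P (\bigcap_(n in [set` s]) A n) = (\prod_(n <- s) P (A n))%E.

(* [normal_prob m s] takes the standard deviation [s], and is not a point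
   mass when [s = 0]. *)
Definition centered_gaussian (v : R) (X : Omega -> R) : Prop :=
  forall B : set R, measurable B ->
    P (X @^-1` B) =
      if v == 0 then \d_(0 : R) B else normal_prob 0 (Num.sqrt v) B.

Record real_wiener (kappa : R) (beta : R -> Omega -> R) : Prop := RealWiener {
  rw_measurable : forall t, 0 <= t -> measurable_fun setT (beta t) ;
  rw_zero : {ae P, forall w, beta 0 w = 0} ;
  rw_continuous : {ae P, forall w, {within `[0, +oo[, continuous (beta^~ w)}} ;
  rw_indep : forall s t, 0 <= s -> s <= t ->
    independent2 (process_sigma (fun r => 0 <= r <= s) beta)
      [set (fun w => beta t w - beta s w) @^-1` B | B in measurable] ;
  rw_gaussian : forall s t, 0 <= s -> s <= t ->
    centered_gaussian (kappa * (t - s)) (fun w => beta t w - beta s w) }.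

Record Q_wiener (H : normedModType R) (dot : {dot H for idfun})
    (F : R -> set (set Omega)) (Q : bounded_op H H)
    (N : set nat) (e : nat -> H) (kappa : nat -> R)
    (eta : nat -> R -> Omega -> R) (W : R -> Omega -> H) : Prop := QWiener {
  qw_orthonormal : orthonormal_family dot N e ;
  qw_eigen : forall n, N n -> Q (e n) = kappa n *: e n ;
  qw_continuous : {ae P, forall w, {within `[0, +oo[, continuous (W^~ w)}} ;
  qw_adapted : forall t, 0 <= t ->
    measurable_wrt (F t) (W t : Omega -> borel H) ;
  qw_L2 : forall t, 0 <= t -> L2_vector (W t) ;
  qw_mean : forall t (h : H), 0 <= t -> (\int[P]_w (dot (W t w) h)%:E = 0)%E ;
  qw_indep : forall u t, 0 <= u -> u <= t ->
    independent2 (F u)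
      [set (fun w => W t w - W u w) @^-1` B
      | B in (measurable : set (set (borel H)))] ;
  qw_covariance : forall u t (h k : H), 0 <= u -> u <= t ->
    (\int[P]_w (dot (W t w - W u w) h * dot (W t w - W u w) k)%:E
     = ((t - u) * dot (Q h) k)%:E)%E ;
  qw_expansion : forall t, 0 <= t -> {ae P, forall w,
    (\sum_(0 <= n < m | n \in N) eta n t w *: e n) @[m --> \oo] --> W t w} ;
  qw_components : forall n, N n -> real_wiener (kappa n) (eta n) ;
  qw_components_indep :
    mutually_independent N (fun n => process_sigma (fun r => 0 <= r) (eta n)) }.

(* Bochner integral over [0, t] of a function with values in L_2(Omega; V).
   A simple function is a finite sum of terms [1_B(s) xi], with [B] Borel and
   [xi] in L_2(Omega; V).  The explicit measurability clause is needed because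
   [\int] is defined, as a supremum, for nonmeasurable functions as well. *)
Definition simple_L2 (V : normedModType R) (t : R)
    (s : seq (set R * (Omega -> V))) : Prop :=
  List.Forall (fun a => [/\ measurable a.1, a.1 `<=` `[0, t] & L2_vector a.2])
    s.

Definition simple_value (V : normedModType R)
    (s : seq (set R * (Omega -> V))) (r : R) (w : Omega) : V :=
  \sum_(a <- s) (\1_(a.1) r : R) *: a.2 w.

Definition simple_integral (V : normedModType R)
    (s : seq (set R * (Omega -> V))) (w : Omega) : V :=
  \sum_(a <- s) fine (lebesgue_measure a.1) *: a.2 w.

Definition bochner_integral (V : normedModType R) (t : R)
    (f : R -> Omega -> V) (Y : Omega -> V) : Prop :=
  [/\ forall r, 0 <= r <= t -> L2_vector (f r), L2_vector Y &
  exists s : nat -> seq (set R * (Omega -> V)),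
    let err (n : nat) (r : R) : \bar R :=
      (mean_square (fun w => simple_value (s n) r w - f r w)%R `^ 2^-1)%E in
    [/\ forall n, simple_L2 t (s n),
        forall n, measurable_fun `[0, t] (err n),
        (\int[lebesgue_measure]_(r in `[0%R, t]) err n r)%E @[n --> \oo] --> 0%E &
        mean_square (fun w => simple_integral (s n) w - Y w)
          @[n --> \oo] --> 0%E ]].

(* The elementary term [1_]l, r](s) 1_G L], with [G] in [F l]. *)
Record elementary_term (U V : normedModType R) := ElementaryTerm {
  et_left : R ;
  et_right : R ;
  et_event : set Omega ;
  et_op : bounded_op U V }.

Definition elementary (U V : normedModType R) (F : R -> set (set Omega))
    (s : seq (elementary_term U V)) : Prop :=
  List.Forall (fun a => [/\ 0 <= et_left a, et_left a <= et_right a &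
    F (et_left a) (et_event a)]) s.

Definition elementary_value (U V : normedModType R)
    (s : seq (elementary_term U V)) (r : R) (w : Omega) (h : U) : V :=
  \sum_(a <- s)
    ((\1_(`]et_left a, et_right a]) r : R) * (\1_(et_event a) w : R))
      *: et_op a h.

Definition elementary_integral (U V : normedModType R) (W : R -> Omega -> U)
    (t : R) (s : seq (elementary_term U V)) (w : Omega) : V :=
  \sum_(a <- s) (\1_(et_event a) w : R) *:
    et_op a (W (Num.min (et_right a) t) w - W (Num.min (et_left a) t) w).

(* The trace of [L Q L^*], i.e. the squared Hilbert-Schmidt norm of
   [L Q^(1/2)]. *)
Definition trace_norm2 (U V : normedModType R) (N : set nat) (e : nat -> U)
    (kappa : nat -> R) (L : U -> V) : \bar R :=
  (\sum_(n <oo | n \in N) (kappa n * `|L (e n)| ^+ 2)%:E)%E.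

(* Ito integral over [0, t] of the operator-valued process [Phi]: [Y] is the
   mean-square limit of integrals of elementary processes which converge to
   [Phi] in the norm of the Ito isometry. *)
Definition ito_integral (U V : normedModType R) (F : R -> set (set Omega))
    (N : set nat) (e : nat -> U) (kappa : nat -> R) (W : R -> Omega -> U)
    (t : R) (Phi : R -> Omega -> U -> V) (Y : Omega -> V) : Prop :=
  [/\ forall r (h : U), 0 <= r <= t ->
        measurable_wrt (F r) ((fun w => Phi r w h) : Omega -> borel V),
      L2_vector Y &
  exists s : nat -> seq (elementary_term U V),
    let err (n : nat) (r : R) : \bar R :=
      (\int[P]_w trace_norm2 N e kappa
         (fun h => (elementary_value (s n) r w h - Phi r w h)%R))%E in
    [/\ forall n, elementary F (s n),
        forall n, measurable_fun `[0, t] (err n),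
        (\int[lebesgue_measure]_(r in `[0%R, t]) err n r)%E @[n --> \oo] --> 0%E &
        mean_square (fun w => elementary_integral W t (s n) w - Y w)
          @[n --> \oo] --> 0%E ]].

Record adapted_L2_continuous (V : normedModType R) (F : R -> set (set Omega))
    (T : R) (x : R -> Omega -> V) : Prop := AdaptedL2Continuous {
  alc_adapted : forall t, 0 <= t <= T ->
    measurable_wrt (F t) (x t : Omega -> borel V) ;
  alc_L2 : forall t, 0 <= t <= T -> L2_vector (x t) ;
  alc_continuous : forall t, 0 <= t <= T ->
    mean_square (fun w => x s w - x t w)
      @[s --> within `[0, T] (nbhs t)] --> 0%E }.

(* dx = [A x + f(x, mu)] dt, where [S] is the semigroup generated by [A] and
   [mu t] is the distribution of [x t]. *)
Record mild_solution (V : normedModType R) (F : R -> set (set Omega)) (T : R)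
    (S : R -> bounded_op V V) (f : V -> Vphi2 V -> V) (x0 : Omega -> V)
    (x : R -> Omega -> V) (mu : R -> Vphi2 V) : Prop := MildSolution {
  ms_class : adapted_L2_continuous F T x ;
  ms_law : forall t, 0 <= t <= T -> has_law (x t) (mu t) ;
  ms_equation : forall t, 0 <= t <= T -> exists I : Omega -> V,
    bochner_integral t (fun s w => S (t - s) (f (x s w) (mu s))) I /\
    {ae P, forall w, x t w = S t (x0 w) + I w} }.

(* dx = [A x + f(x, mu)] dt + eps g(x, mu) dW. *)
Record mild_solution_noise (U V : normedModType R)
    (F : R -> set (set Omega)) (N : set nat) (e : nat -> U) (kappa : nat -> R)
    (W : R -> Omega -> U) (T : R)
    (S : R -> bounded_op V V) (f : V -> Vphi2 V -> V)
    (g : V -> Vphi2 V -> bounded_op U V) (eps : R) (x0 : Omega -> V)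
    (x : R -> Omega -> V) (mu : R -> Vphi2 V) : Prop := MildSolutionNoise {
  msn_class : adapted_L2_continuous F T x ;
  msn_law : forall t, 0 <= t <= T -> has_law (x t) (mu t) ;
  msn_equation : forall t, 0 <= t <= T -> exists I J : Omega -> V,
    [/\ bochner_integral t (fun s w => S (t - s) (f (x s w) (mu s))) I,
        ito_integral F N e kappa W t
          (fun s w h => S (t - s) (g (x s w) (mu s) h)) J &
        {ae P, forall w, x t w = S t (x0 w) + I w + eps *: J w}] }.

End Probability.

(* Main.v *)
Require Import Defs.
From mathcomp Require Import all_boot all_order all_algebra.
From mathcomp Require Import all_classical all_reals all_analysis
  measurable_realfun.
From mathcomp Require Import ring lra.

Set Implicit Arguments.
Unset Strict Implicit.
Unset Printing Implicit Defensive.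

Import Order.TTheory GRing.Theory Num.Theory.
Import numFieldNormedType.Exports.

Local Open Scope classical_set_scope.
Local Open Scope ring_scope.

(** The difference of the two mild solutions is small in mean square because
    the equations differ in two small ways, the semigroup and the noise, and
    because everything else is Lipschitz.

    Write |.| for the norm of [L_2(Omega)] and subtract the two mild equations.
    Four terms appear. The initial values contribute the difference of the
    semigroups at [x0]. In the drift, the difference of the values of [f] is at
    most [2 K1 |x_eps - x'|]: the test functions of the metric on laws are
    1-Lipschitz, so that the distance of the laws is at most the [L_2] distance
    of the processes ([rho_le_coupling], [drift_lipschitz]). There remains the
    difference of the semigroups applied to the drift of the limit equation.
    Finally there is [eps] times a stochastic integral, which linear growth of
    [g] bounds in terms of [1 + |x_eps|], hence of [1 + |x'| + |x_eps - x'|].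

    Suppose that [|x_eps(t) - x'(t)| <= m e^(l t)] on [0, T]. Integrating the
    exponential gains a factor [1 / l] in the drift and [1 / sqrt l] in the
    noise, so the same bound holds with [m] replaced by [A + m / 2], for
    [l = l0 (1 + eps^2)] with [l0] a fixed large number ([difference_bound]).
    Here [A] gathers the terms that do not involve the unknown difference: the
    semigroup gaps and [eps] times a constant. The least [m] is therefore at
    most [2 A] ([weighted_gronwall], [mild_solution_distance]).

    It remains that [A] tends to zero with [eps]. For a random vector in [L_2]
    the semigroup gap tends to zero by dominated convergence ([l2_gap_cvg]).
    The drift of the limit equation is a continuous curve in [L_2], and the
    gaps are equicontinuous, so that the convergence is uniform along it
    ([l2_gap_uniform]). A monotone majorant of the square of the estimate is
    the required [tau] ([modulus_exists]).

    Both integrals are limits of integrals of step processes, and only upper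
    bounds on their norms are needed. For the Bochner integral the bound of the
    norm by the integral of the norm is obtained by testing against the integral
    itself ([simple_integral_le], [bochner_integral_sub_le]). For the stochastic
    integral, independence of increments gives the correlation of two weighted
    increments over arbitrary intervals ([increment_pair]). Summing over pairs
    gives the isometry for a Wiener process reduced to finitely many
    coordinates, and Fatou's lemma removes the reduction
    ([elementary_integral_le], [ito_integral_le]). *)

(** * Borel measurability in separable normed spaces *)

Lemma continuous_borel (T U : ptopologicalType) (f : T -> U) :
  continuous f -> measurable_fun setT (f : borel T -> borel U).
Proof.
move=> cf; apply: (@measurability _ _ (borel T) (borel U) setT f open erefl).
move=> _ [B oB <-].
rewrite setTI; apply: sub_sigma_algebra.
by move/continuousP : cf; exact.
Qed.

Lemma continuous_borel_real (R : realType) (T : ptopologicalType)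
  (f : T -> R) : continuous f -> measurable_fun setT (f : borel T -> R).
Proof.
move=> cf; apply: (measurability _ (RGenOInfty.measurableE R)).
move=> _ [_ [a ->] <-]; rewrite setTI; apply: sub_sigma_algebra.
by move/continuousP : cf; apply; exact: interval_open.
Qed.

Definition separable (T : topologicalType) : Prop :=
  exists2 D : set T, countable D & dense D.

Lemma dense_sequence (T : ptopologicalType) : separable T ->
  exists u : nat -> T, dense (range u).
Proof.
move=> [D /pcard_surjP[u uD] dD]; exists u => A A0 oA.
have [x [Ax Dx]] := dD A A0 oA.
by exists x; split=> //; have [n _ <-] := uD x Dx; exists n.
Qed.

(** Addition of random vectors is measurable only because the Borel sets of a
    product of separable spaces are generated by rectangles: an open set is
    here a countable union of products of balls with centres in dense
    sequences and radii [1 / (n + 1)]. *)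
Lemma measurable_continuous2 (R : realType) (V1 V2 : normedModType R)
  (W : ptopologicalType) (d : measure_display) (T : measurableType d)
  (X : T -> borel V1) (Y : T -> borel V2) (h : V1 * V2 -> W) :
  separable V1 -> separable V2 -> continuous h ->
  measurable_fun setT X -> measurable_fun setT Y ->
  measurable_fun setT ((fun w => h (X w, Y w)) : T -> borel W).
Proof.
move=> /dense_sequence[u du] /dense_sequence[v dv] ch mX mY.
apply: (@measurability _ _ T (borel W) setT (fun w => h (X w, Y w)) open erefl).
move=> _ [U oU <-]; rewrite setTI.
have oO : open (h @^-1` U) by move/continuousP : ch; exact.
pose r n : R := n.+1%:R^-1.
have r0 n : 0 < r n by rewrite invr_gt0.
pose rect (i : nat * nat * nat) : set (V1 * V2) :=
  ball (u i.1.1) (r i.2) `*` ball (v i.1.2) (r i.2).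
have -> : (fun w => h (X w, Y w)) @^-1` U =
    \bigcup_(i in [set i | rect i `<=` h @^-1` U])
      (X @^-1` ball (u i.1.1) (r i.2) `&` Y @^-1` ball (v i.1.2) (r i.2)).
  apply/seteqP; split => [w Uw|w [i /= ri [Xw Yw]]]; last first.
    by apply: (ri (X w, Y w)).
  have : nbhs (X w, Y w) (h @^-1` U) by exact: open_nbhs_nbhs.
  move=> [[A B] /= [/nbhs_ballP[a /= a0 Aa] /nbhs_ballP[b /= b0 Bb]] AB].
  pose e := Num.min a b.
  have e0 : 0 < e by rewrite /e lt_min a0.
  have [n ne] : exists n, r n < e / 2.
    have [n _ /(_ n (leqnn n)) /= hn] := near_infty_natSinv_lt (PosNum (divr_gt0 e0 (ltr0Sn R 1))).
    by exists n.
  have near1 (V : normedModType R) (z : nat -> V) (x : V) : dense (range z) ->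
      exists i, ball (z i) (r n) x /\ ball (z i) (r n) `<=` ball x e.
    move=> dz; have [||y [/= xz [i _ iz]]] := dz (ball x (r n)).
    - by exists x; exact: ballxx.
    - exact: ball_open.
    exists i; split; first by rewrite iz; exact: ball_sym.
    move=> y' /=; rewrite iz => zy; apply: le_ball (ball_triangle xz zy).
    by rewrite ltW// [e]splitr ltrD.
  have [i [Xi iX]] := near1 _ _ (X w) du.
  have [j [Yj jY]] := near1 _ _ (Y w) dv.
  exists (i, j, n) => //= -[x y] [/= /iX xe /jY ye]; apply: AB; split => /=.
    by apply: Aa; apply: le_ball xe; rewrite ge_min lexx.
  by apply: Bb; apply: le_ball ye; rewrite ge_min lexx orbT.
rewrite bigcup_mkcond.
apply: countable_bigcupT_measurable => // i.
case: ifP => // _.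
by apply: measurableI; rewrite -[X in measurable X]setTI; [apply: mX|apply: mY] => //;
 apply: sub_sigma_algebra; exact: ball_open.
Qed.

Section measurable_algebra.
Context (R : realType) (V : normedModType R) (sV : separable V).
Context (d : measure_display) (T : measurableType d).
Implicit Types X Y : T -> borel V.

Lemma measurable_borel_norm X : measurable_fun setT X ->
  measurable_fun setT (fun w => `|(X w : V)|).
Proof.
move=> mX.
by apply: (measurableT_comp (continuous_borel_real (@norm_continuous _ V))).
Qed.

Lemma measurable_borelD X Y : measurable_fun setT X -> measurable_fun setT Y ->
  measurable_fun setT ((fun w => (X w : V) + (Y w : V)) : T -> borel V).
Proof.
move=> mX mY; apply: (measurable_continuous2 (h := fun x => x.1 + x.2) sV sV) => //.
exact: add_continuous.
Qed.

Lemma measurable_borel_comp (W : ptopologicalType) (f : V -> W) X :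
  continuous f -> measurable_fun setT X ->
  measurable_fun setT ((fun w => f (X w)) : T -> borel W).
Proof. by move=> cf; apply: measurableT_comp; exact: continuous_borel. Qed.

Lemma measurable_borelN X : measurable_fun setT X ->
  measurable_fun setT ((fun w => - (X w : V)) : T -> borel V).
Proof. by apply: measurable_borel_comp; exact: opp_continuous. Qed.

Lemma measurable_borelZ (a : R) X : measurable_fun setT X ->
  measurable_fun setT ((fun w => a *: (X w : V)) : T -> borel V).
Proof. by apply: measurable_borel_comp; exact: scaler_continuous. Qed.

Lemma measurable_borelB X Y : measurable_fun setT X -> measurable_fun setT Y ->
  measurable_fun setT ((fun w => (X w : V) - (Y w : V)) : T -> borel V).
Proof. by move=> mX mY; apply: measurable_borelD => //; exact: measurable_borelN. Qed.

Lemma measurable_borel_scaler (a : T -> R) (v : V) : measurable_fun setT a ->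
  measurable_fun setT ((fun w => a w *: v) : T -> borel V).
Proof.
move=> ma; apply: (@measurable_comp _ _ _ T R (borel V) setT (fun b : R => b *: v)) => //.
apply: (@measurability _ _ _ (borel V) setT _ open erefl) => _ [B oB <-].
rewrite setTI; apply: open_measurable.
by move: (@scalel_continuous R V v) => /continuousP; apply.
Qed.

End measurable_algebra.

(** * Square integrable random variables *)

Lemma weighted_amgm (R : realType) (a b x y : R) : 0 < a -> 0 < b ->
  x * y <= b / a / 2 * x ^+ 2 + a / b / 2 * y ^+ 2.
Proof.
move=> a0 b0; rewrite -subr_ge0 (_ : _ - _ = (b * x - a * y) ^+ 2 / (2 * a * b)).
  by rewrite divr_ge0 ?sqr_ge0// !mulr_ge0// ltW.
by field; rewrite !gt_eqF.
Qed.

Section real_integrable.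
Context (R : realType) (d : measure_display) (T : measurableType d)
  (mu : {measure set T -> \bar R}) (D : set T) (mD : measurable D).
Implicit Types u v : T -> R.

Lemma Rintegrable_add u v :
  mu.-integrable D (EFin \o u) -> mu.-integrable D (EFin \o v) ->
  mu.-integrable D (EFin \o (fun x => u x + v x)).
Proof. by move=> iu iv; exact: (integrableD mD iu iv). Qed.

Lemma Rintegrable_scale (c : R) u : mu.-integrable D (EFin \o u) ->
  mu.-integrable D (EFin \o (fun x => c * u x)).
Proof. by move=> iu; exact: (integrableZl mD c iu). Qed.

Lemma Rintegrable_scaler (c : R) u : mu.-integrable D (EFin \o u) ->
  mu.-integrable D (EFin \o (fun x => u x * c)).
Proof.
move=> /(Rintegrable_scale c); apply: (eq_integrable mD) => x _.
by rewrite /= mulrC.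
Qed.

Lemma Rintegrable_abs u : mu.-integrable D (EFin \o u) ->
  mu.-integrable D (EFin \o (fun x => `|u x|)).
Proof. move=> iu; apply: (le_integrable mD _ _ iu) => [|x _].
  case/integrableP : iu => /measurable_EFinP mu_ _.
  by apply/measurable_EFinP; exact: measurableT_comp.
by rewrite /= normr_id. Qed.

Lemma Rintegrable_sum I (s : seq I) (u : I -> T -> R) :
  (forall i, mu.-integrable D (EFin \o u i)) ->
  mu.-integrable D (EFin \o (fun x => \sum_(i <- s) u i x)).
Proof.
move=> iu; elim: s => [|i s IH].
  by under eq_fun do rewrite /= big_nil; exact: integrable0.
by under eq_fun do rewrite /= big_cons; exact: (Rintegrable_add (iu i) IH).
Qed.

Lemma Rintegral_sum I (s : seq I) (u : I -> T -> R) :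
  (forall i, mu.-integrable D (EFin \o u i)) ->
  \int[mu]_(x in D) (\sum_(i <- s) u i x) = \sum_(i <- s) \int[mu]_(x in D) u i x.
Proof.
move=> iu; elim: s => [|i s IH].
  rewrite big_nil (@eq_Rintegral _ _ _ mu D (cst 0)); last by move=> x _; rewrite big_nil.
  by rewrite /Rintegral integral0.
rewrite big_cons -IH -RintegralD//; last exact: Rintegrable_sum.
by apply: eq_Rintegral => x _; rewrite big_cons.
Qed.

End real_integrable.

Section real_L2.
Context (R : realType) (d : measure_display) (Omega : measurableType d)
  (P : probability Omega R).
Implicit Types u v : Omega -> R.

Definition L2r u : Prop :=
  measurable_fun setT u /\ (\int[P]_w (u w ^+ 2)%:E < +oo)%E.

Definition l2r u : R := Num.sqrt (fine (\int[P]_w (u w ^+ 2)%:E)).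

Lemma l2r_ge0 u : 0 <= l2r u. Proof. exact: sqrtr_ge0. Qed.

Lemma L2r_integrable_sq u : L2r u -> P.-integrable setT (EFin \o (fun w => u w ^+ 2)).
Proof.
move=> [mu iu]; apply/integrableP; split.
  by apply/measurable_EFinP; exact: measurable_funX.
by under eq_integral do rewrite /= ger0_norm ?sqr_ge0//.
Qed.

Lemma L2r_sqE u : L2r u -> (\int[P]_w (u w ^+ 2)%:E = (l2r u ^+ 2)%:E)%E.
Proof.
move=> [mu iu]; rewrite /l2r sqr_sqrtr ?fine_ge0 ?integral_ge0//; last first.
  by move=> w _; rewrite lee_fin sqr_ge0.
rewrite fineK// ge0_fin_numE ?integral_ge0// => w _.
by rewrite lee_fin sqr_ge0.
Qed.

Lemma l2r_sq u : L2r u -> l2r u ^+ 2 = \int[P]_w u w ^+ 2.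
Proof. by move=> Lu; rewrite /Rintegral L2r_sqE. Qed.

Lemma L2r_le u v : measurable_fun setT u -> L2r v ->
  (forall w, `|u w| <= `|v w|) -> L2r u.
Proof.
move=> mu [mv iv] uv; split=> //; apply: le_lt_trans iv.
apply: ge0_le_integral => //.
- by move=> w _; rewrite lee_fin sqr_ge0.
- by apply/measurable_EFinP; exact: measurable_funX.
- by apply/measurable_EFinP; exact: measurable_funX.
- by move=> w _; rewrite lee_fin -[leLHS]real_normK ?num_real// -[leRHS]real_normK ?num_real//;
  rewrite lerXn2r// nnegrE.
Qed.

Lemma l2r_le u v : L2r u -> L2r v -> {ae P, forall w, `|u w| <= `|v w|} ->
  l2r u <= l2r v.
Proof.
move=> Lu Lv uv; rewrite -(@ler_pXn2r _ 2) ?nnegrE ?l2r_ge0// -lee_fin.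
rewrite -!L2r_sqE//; case: Lu Lv => mu _ [mv _].
apply: ae_ge0_le_integral => //.
- by move=> w _; rewrite lee_fin sqr_ge0.
- by apply/measurable_EFinP; exact: measurable_funX.
- by move=> w _; rewrite lee_fin sqr_ge0.
- by apply/measurable_EFinP; exact: measurable_funX.
- apply: filterS uv => w uv _.
  rewrite lee_fin -[leLHS]real_normK ?num_real// -[leRHS]real_normK ?num_real//.
  by rewrite lerXn2r// nnegrE.
Qed.

Lemma L2r_cst (c : R) : L2r (cst c).
Proof.
split; first exact: measurable_cst.
rewrite (_ : (fun _ => _) = cst (c ^+ 2)%:E)// integral_cst//.
rewrite [X in (_ * X)%E](_ : _ = 1%E); last exact: probability_setT.
by rewrite mule1 ltry.
Qed.

Lemma l2r_cst (c : R) : l2r (cst c) = `|c|.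
Proof. rewrite /l2r (_ : (fun _ => _) = cst (c ^+ 2)%:E)// integral_cst//.
rewrite [X in (_ * X)%E](_ : _ = 1%E); last exact: probability_setT.
by rewrite mule1/= sqrtr_sqr. Qed.

Lemma L2rZ (c : R) u : L2r u -> L2r (fun w => c * u w).
Proof.
move=> Lu; split; first by apply: measurable_funM => //; case: Lu.
under eq_integral do rewrite exprMn EFinM.
rewrite integralZl//; last exact: L2r_integrable_sq.
by rewrite L2r_sqE// -EFinM ltry.
Qed.

Lemma l2rZ (c : R) u : L2r u -> l2r (fun w => c * u w) = `|c| * l2r u.
Proof.
move=> Lu; rewrite /l2r.
under eq_integral do rewrite exprMn EFinM.
rewrite integralZl//; last exact: L2r_integrable_sq.
by rewrite L2r_sqE//= -exprMn sqrtr_sqr normrM (ger0_norm (l2r_ge0 _))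
  sqrtr_sqr (ger0_norm (l2r_ge0 _)).
Qed.

Lemma L2rD u v : L2r u -> L2r v -> L2r (fun w => u w + v w).
Proof.
move=> Lu Lv; split; first by apply: measurable_funD; [case: Lu|case: Lv].
apply: (@le_lt_trans _ _
    (\int[P]_w ((2 * u w ^+ 2)%:E + (2 * v w ^+ 2)%:E)%E)%E).
  apply: ge0_le_integral => //.
  - by move=> w _; rewrite lee_fin sqr_ge0.
  - apply/measurable_EFinP/measurable_funX/measurable_funD; [by case: Lu|by case: Lv].
  - apply: emeasurable_funD; apply/measurable_EFinP; apply: measurable_funM => //;
      apply: measurable_funX; [by case: Lu|by case: Lv].
  - by move=> w _; rewrite -EFinD lee_fin; have := sqr_ge0 (u w - v w); nra.
have iZ w : L2r w -> P.-integrable setT (fun x => (2 * w x ^+ 2)%:E).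
  move=> Lw; under eq_fun do rewrite EFinM.
  by apply: integrableZl => //; exact: L2r_integrable_sq.
rewrite integralD//; [|exact: iZ|exact: iZ].
by apply: lte_add_pinfty; exact: integral_fune_lt_pinfty (iZ _ _).
Qed.

Lemma L2r_mul_integrable u v : L2r u -> L2r v ->
  P.-integrable setT (EFin \o (fun w => u w * v w)).
Proof.
move=> Lu Lv.
apply: (@le_integrable _ _ _ P setT measurableT _
    (EFin \o (fun w => u w ^+ 2 + v w ^+ 2))).
- by apply/measurable_EFinP/measurable_funM; [case: Lu|case: Lv].
- move=> w _; rewrite /= lee_fin normrM [leRHS]ger0_norm ?addr_ge0 ?sqr_ge0//.
  rewrite -(real_normK (num_real (u w))) -(real_normK (num_real (v w))).
  have := sqr_ge0 (`|u w| - `|v w|); have := normr_ge0 (u w); have := normr_ge0 (v w).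
  by nra.
- by apply: Rintegrable_add => //; exact: L2r_integrable_sq.
Qed.

Lemma l2r_abs u : l2r (fun w => `|u w|) = l2r u.
Proof.
rewrite /l2r; congr (Num.sqrt (fine _)); apply: eq_integral => w _.
by rewrite real_normK ?num_real.
Qed.

Lemma L2r_integrable u : L2r u -> P.-integrable setT (EFin \o u).
Proof.
move=> Lu; have := L2r_mul_integrable Lu (L2r_cst 1).
by under eq_fun do rewrite /= mulr1.
Qed.

(** The weight in [2 u v <= s u^2 + v^2 / s] is [s = (l2r v + c) / (l2r u + c)]:
    the slack [c > 0] replaces a discussion of the case [u = 0] a.e. *)
Lemma cauchy_schwarz u v : L2r u -> L2r v ->
  `|\int[P]_w (u w * v w)| <= l2r u * l2r v.
Proof.
move=> Lu Lv.
apply: le_trans (le_normr_Rintegral _ (L2r_mul_integrable Lu Lv)) _ => //.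
have step (c : R) : 0 < c -> \int[P]_w `|u w * v w| <= (l2r u + c) * (l2r v + c).
  move=> c0; set a := l2r u + c; set b := l2r v + c.
  have a0 : 0 < a by rewrite ltr_wpDl ?l2r_ge0.
  have b0 : 0 < b by rewrite ltr_wpDl ?l2r_ge0.
  have ab : 0 < b / a / 2 by rewrite !divr_gt0.
  have ba : 0 < a / b / 2 by rewrite !divr_gt0.
  have i1 := L2r_integrable_sq (L2rZ (Num.sqrt (b / a / 2)) Lu).
  have i2 := L2r_integrable_sq (L2rZ (Num.sqrt (a / b / 2)) Lv).
  have e1 : \int[P]_w (Num.sqrt (b / a / 2) * u w) ^+ 2 = b / a / 2 * l2r u ^+ 2.
    rewrite -l2r_sq; last exact: L2rZ.
    by rewrite l2rZ// exprMn real_normK ?num_real// sqr_sqrtr// !divr_ge0// ltW.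
  have e2 : \int[P]_w (Num.sqrt (a / b / 2) * v w) ^+ 2 = a / b / 2 * l2r v ^+ 2.
    rewrite -l2r_sq; last exact: L2rZ.
    by rewrite l2rZ// exprMn real_normK ?num_real// sqr_sqrtr// !divr_ge0// ltW.
  apply: (@le_trans _ _ (\int[P]_w ((Num.sqrt (b / a / 2) * u w) ^+ 2 +
     (Num.sqrt (a / b / 2) * v w) ^+ 2))).
    apply: le_Rintegral => //.
    - by apply: Rintegrable_abs => //; exact: L2r_mul_integrable.
    - exact: Rintegrable_add.
    - move=> w _; rewrite normrM !exprMn (sqr_sqrtr (ltW ab)) (sqr_sqrtr (ltW ba)).
      rewrite -[u w ^+ 2](real_normK (num_real _)) -[v w ^+ 2](real_normK (num_real _)).
      exact: weighted_amgm.
  rewrite RintegralD// e1 e2.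
  have h1 : l2r u ^+ 2 <= a ^+ 2 by apply: lerXn2r; rewrite ?nnegrE ?l2r_ge0 ?(ltW a0)// lerDl ltW.
  have h2 : l2r v ^+ 2 <= b ^+ 2 by apply: lerXn2r; rewrite ?nnegrE ?l2r_ge0 ?(ltW b0)// lerDl ltW.
  apply: le_trans (lerD (ler_wpM2l (ltW ab) h1) (ler_wpM2l (ltW ba) h2)) _.
  rewrite le_eqVlt; apply/orP; left; apply/eqP; field.
  by rewrite !gt_eqF.
(* [c] is let to zero: for [c <= 1] the bound exceeds [l2r u * l2r v] by at
   most [c * K], which is made at most half of the supposed excess [D] *)
rewrite leNgt; apply/negP => lt.
pose D := \int[P]_w `|u w * v w| - l2r u * l2r v.
have D0 : 0 < D by rewrite subr_gt0.
pose K := l2r u + l2r v + 1.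
have K0 : 0 < K by rewrite ltr_wpDl// addr_ge0 ?l2r_ge0.
pose c := Num.min 1 (D / K / 2).
have c0 : 0 < c by rewrite lt_min ltr01/= !divr_gt0.
have c1 : c <= 1 by rewrite ge_min lexx.
have cK : c * K <= D / 2.
  have : c <= D / K / 2 by rewrite ge_min lexx orbT.
  by rewrite -(ler_pM2r K0) => /le_trans; apply; rewrite le_eqVlt; apply/orP; left;
    apply/eqP; field; rewrite gt_eqF.
have := step c c0; rewrite -[X in X <= _](subrK (l2r u * l2r v)) -/D.
have := l2r_ge0 u; have := l2r_ge0 v; move: cK; rewrite /K.
by nra.
Qed.

Lemma l2rD u v : L2r u -> L2r v -> l2r (fun w => u w + v w) <= l2r u + l2r v.
Proof.
move=> Lu Lv.
rewrite -(@ler_pXn2r _ 2) ?nnegrE ?addr_ge0 ?l2r_ge0// l2r_sq; last exact: L2rD.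
rewrite (_ : \int[P]_w (u w + v w) ^+ 2 =
    \int[P]_w ((u w ^+ 2 + 2 * (u w * v w)) + v w ^+ 2)); last first.
  by apply: eq_Rintegral => w _; ring.
have iuv := L2r_mul_integrable Lu Lv.
have i2 : P.-integrable setT (EFin \o (fun w => 2 * (u w * v w))).
  exact: Rintegrable_scale.
have iu := L2r_integrable_sq Lu; have iv := L2r_integrable_sq Lv.
rewrite RintegralD//; last exact: Rintegrable_add.
rewrite RintegralD// RintegralZl// -!l2r_sq//.
have := cauchy_schwarz Lu Lv; rewrite ler_norml => /andP[_ +].
by nra.
Qed.

End real_L2.

(** * Real inner products *)

Section dot_product.
Context (R : realType) (H : completeNormedModType R) (dot : {dot H for idfun}).
Context (dot_norm : forall x : H, dot x x = `|x| ^+ 2).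

Lemma dotC x y : dot x y = dot y x.
Proof. by rewrite hermC/= expr0 mul1r. Qed.

Lemma dotDl x y z : dot (x + y) z = dot x z + dot y z.
Proof. exact: linearDl. Qed.

Lemma dotDr x y z : dot z (x + y) = dot z x + dot z y.
Proof. exact: linearDr. Qed.

Lemma dotZl a x y : dot (a *: x) y = a * dot x y.
Proof. by rewrite linearZl_LR. Qed.

Lemma dotZr a x y : dot x (a *: y) = a * dot x y.
Proof. by rewrite dotC dotZl dotC. Qed.

Lemma dotBl x y z : dot (x - y) z = dot x z - dot y z.
Proof. by rewrite -scaleN1r dotDl dotZl mulN1r. Qed.

Lemma dotBr x y z : dot z (x - y) = dot z x - dot z y.
Proof. by rewrite dotC dotBl !(dotC z). Qed.

Lemma dot0l x : dot 0 x = 0.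
Proof. by rewrite -[X in dot X](scale0r 0) dotZl mul0r. Qed.

Lemma dot_suml I (s : seq I) (p : pred I) (x : I -> H) y :
  dot (\sum_(i <- s | p i) x i) y = \sum_(i <- s | p i) dot (x i) y.
Proof.
elim/big_ind2 : _ => //; first exact: dot0l.
by move=> a b c d <- <-; rewrite dotDl.
Qed.

Lemma dot_sumr I (s : seq I) (p : pred I) (x : I -> H) y :
  dot y (\sum_(i <- s | p i) x i) = \sum_(i <- s | p i) dot y (x i).
Proof. by rewrite dotC dot_suml; apply: eq_bigr => i _; rewrite dotC. Qed.

Lemma dot_polarization x y : dot x y = (`|x + y| ^+ 2 - `|x - y| ^+ 2) / 4.
Proof.
rewrite -!dot_norm dotBl !dotBr dotDl !dotDr (dotC y x).
by field.
Qed.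

Lemma dot_le x y : `|dot x y| <= `|x| * `|y|.
Proof.
have [->|y0] := eqVneq y 0; first by rewrite dotC dot0l !normr0 mulr0.
have n0 : 0 < `|y| ^+ 2 by rewrite exprn_gt0// normr_gt0.
rewrite -(@ler_pXn2r _ 2) ?nnegrE ?mulr_ge0// real_normK ?num_real// exprMn.
have := sqr_ge0 `| (`|y| ^+ 2) *: x - dot x y *: y|.
rewrite -dot_norm dotBl !dotBr !dotZl !dotZr !dot_norm (dotC y x).
rewrite (_ : _ - _ = `|y| ^+ 2 * (`|x| ^+ 2 * `|y| ^+ 2 - dot x y ^+ 2)).
  by rewrite pmulr_rge0// subr_ge0.
by ring.
Qed.

Lemma dot_continuous y : continuous (dot^~ y).
Proof.
move=> x; apply/cvgrPdist_lt => eps eps0.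
near=> z.
rewrite -dotBl; apply: le_lt_trans (dot_le _ _) _.
apply: (@le_lt_trans _ _ (`|x - z| * (`|y| + 1))).
  by rewrite ler_wpM2l// lerDl.
rewrite -ltr_pdivlMr ?ltr_wpDl//; near: z.
by apply: cvgr_dist_lt => //; rewrite divr_gt0// ltr_wpDl.
Unshelve. all: by end_near. Qed.

Context (sH : separable H) (d : measure_display) (T : measurableType d).

(** By polarization the inner product is a combination of norms of sums, so
    that joint measurability comes down to that of addition. *)
Lemma measurable_dot (X Y : T -> borel H) : measurable_fun setT X ->
  measurable_fun setT Y -> measurable_fun setT (fun w => dot (X w) (Y w)).
Proof.
move=> mX mY; under eq_fun do rewrite dot_polarization.
apply: measurable_funM => //; apply: measurable_funB;
  apply: measurable_funX; apply: measurable_borel_norm.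
  exact: measurable_borelD.
exact: measurable_borelB.
Qed.

End dot_product.

(** * Square integrable random vectors *)

Section vector_L2.
Context (R : realType) (d : measure_display) (Omega : measurableType d)
  (P : probability Omega R) (V : normedModType R).
Implicit Types X Y : Omega -> V.

Definition l2 X : R := l2r P (fun w => `|X w|).

Lemma l2_ge0 X : 0 <= l2 X. Proof. exact: l2r_ge0. Qed.

Lemma L2_vector_norm X : L2_vector P X -> L2r P (fun w => `|X w|).
Proof. by move=> [mX iX]; split=> //; exact: measurable_borel_norm. Qed.

Lemma mean_squareE X : L2_vector P X -> mean_square P X = (l2 X ^+ 2)%:E.
Proof. by move=> LX; rewrite -L2r_sqE//; exact: L2_vector_norm. Qed.

Lemma L2_vector_le X (v : Omega -> R) :
  measurable_fun setT (X : Omega -> borel V) -> L2r P v ->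
  (forall w, `|X w| <= `|v w|) -> L2_vector P X.
Proof.
move=> mX Lv Xv; split=> //.
have [] // := @L2r_le _ _ _ P (fun w => `|X w|) v _ Lv _.
  exact: measurable_borel_norm.
by move=> w; rewrite normr_id.
Qed.

Lemma l2_le X (v : Omega -> R) : L2_vector P X -> L2r P v ->
  {ae P, forall w, `|X w| <= `|v w|} -> l2 X <= l2r P v.
Proof.
move=> LX Lv Xv; apply: l2r_le => //; first exact: L2_vector_norm.
by apply: filterS Xv => w; rewrite normr_id.
Qed.

Lemma L2_vector_cst (x : V) : L2_vector P (cst x).
Proof.
by apply: L2_vector_le (L2r_cst P `|x|) _ => [|w]; [exact: measurable_cst|rewrite normr_id].
Qed.

Lemma l2N X : l2 (fun w => - X w) = l2 X.
Proof. by rewrite /l2; under eq_fun do rewrite normrN. Qed.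

Lemma L2_vectorZ (c : R) X : L2_vector P X -> L2_vector P (fun w => c *: X w).
Proof.
move=> LX; apply: (L2_vector_le _ (L2rZ c (L2_vector_norm LX))).
  by apply: measurable_borelZ; case: LX.
by move=> w; rewrite normrZ normrM normr_id.
Qed.

Lemma l2Z (c : R) X : L2_vector P X -> l2 (fun w => c *: X w) = `|c| * l2 X.
Proof.
move=> LX; rewrite /l2 -l2rZ; last exact: L2_vector_norm.
rewrite -[RHS]l2r_abs; congr (l2r P _); apply/funext => w.
by rewrite normrZ normrM normr_id.
Qed.

Lemma ae_eq_l2 X Y : {ae P, forall w, X w = Y w} -> L2_vector P X ->
  L2_vector P Y -> l2 X = l2 Y.
Proof.
move=> XY LX LY; apply/eqP; rewrite eq_le; apply/andP; split;
  apply: l2_le => //; try exact: L2_vector_norm;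
  by apply: filterS XY => w ->; rewrite normr_id.
Qed.

Context (sV : separable V).

Lemma L2_vectorD X Y : L2_vector P X -> L2_vector P Y ->
  L2_vector P (fun w => X w + Y w).
Proof.
move=> LX LY; apply: (L2_vector_le _ (L2rD (L2_vector_norm LX) (L2_vector_norm LY))).
  by apply: measurable_borelD => //; [case: LX|case: LY].
by move=> w; rewrite [leRHS]ger0_norm ?addr_ge0// ler_normD.
Qed.

Lemma L2_vectorN X : L2_vector P X -> L2_vector P (fun w => - X w).
Proof.
by move=> /(L2_vectorZ (-1)); under eq_fun do rewrite scaleN1r.
Qed.

Lemma L2_vectorB X Y : L2_vector P X -> L2_vector P Y ->
  L2_vector P (fun w => X w - Y w).
Proof. by move=> LX LY; apply: L2_vectorD => //; exact: L2_vectorN. Qed.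

Lemma L2_vector_sum I (s : seq I) (X : I -> Omega -> V) :
  (forall i, L2_vector P (X i)) -> L2_vector P (fun w => \sum_(i <- s) X i w).
Proof.
move=> LX; elim: s => [|i s IH].
  by under eq_fun do rewrite big_nil; exact: L2_vector_cst.
by under eq_fun do rewrite big_cons; exact: L2_vectorD.
Qed.

Lemma l2D X Y : L2_vector P X -> L2_vector P Y ->
  l2 (fun w => X w + Y w) <= l2 X + l2 Y.
Proof.
move=> LX LY; have LX' := L2_vector_norm LX; have LY' := L2_vector_norm LY.
apply: le_trans (l2rD LX' LY'); apply: l2_le; first exact: L2_vectorD.
  exact: L2rD.
by apply: aeW => w; rewrite [leRHS]ger0_norm ?addr_ge0// ler_normD.
Qed.

Lemma l2B X Y : L2_vector P X -> L2_vector P Y ->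
  l2 (fun w => X w - Y w) <= l2 X + l2 Y.
Proof. by move=> LX LY; rewrite -(l2N Y); apply: l2D => //; exact: L2_vectorN. Qed.

Lemma mean_square_cvg0 (X : nat -> Omega -> V) :
  (forall n, L2_vector P (X n)) -> mean_square P (X n) @[n --> \oo] --> 0%E ->
  l2 (X n) @[n --> \oo] --> 0.
Proof.
move=> LX X0.
have fX : fine (mean_square P (X n)) @[n --> \oo] --> (0 : R) by exact: fine_cvg.
have c0 := @sqrt_continuous R 0; rewrite /continuous_at sqrtr0 in c0.
exact: (cvg_comp _ _ fX c0).
Qed.

(** Both integrals of the mild equation are [L_2] limits of integrals of simple
    processes; bounds on the latter pass to the limit in this form. *)
Lemma l2_limit (X : nat -> Omega -> V) Y (b : nat -> R) (B : R) :
  (forall n, L2_vector P (X n)) -> L2_vector P Y ->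
  l2 (fun w => X n w - Y w) @[n --> \oo] --> 0 ->
  (\forall n \near \oo, l2 (X n) <= b n) -> b n @[n --> \oo] --> B -> l2 Y <= B.
Proof.
move=> LX LY c0 Xb bB.
have cB : (b n + l2 (fun w => X n w - Y w)) @[n --> \oo] --> B + 0 by exact: cvgD.
rewrite -[B]addr0 -(cvg_lim _ cB)//; apply: limr_ge.
  by apply/cvg_ex; exists (B + 0).
apply: filterS Xb => n Xb; apply: le_trans (lerD Xb (lexx _)).
have -> : l2 Y = l2 (fun w => X n w - (X n w - Y w)).
  by congr l2; apply/funext => w; rewrite opprB addrC subrK.
exact: l2B (LX n) (L2_vectorB (LX n) LY).
Qed.

End vector_L2.

(** * Coupling bound for the metric on laws *)

Section expected_dot.
Context (R : realType) (d : measure_display) (Omega : measurableType d)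
  (P : probability Omega R).
Context (H : completeNormedModType R) (dot : {dot H for idfun})
  (dot_norm : forall x : H, dot x x = `|x| ^+ 2) (sH : separable H).
Implicit Types X Y : Omega -> H.

Definition Edot X Y : R := \int[P]_w dot (X w) (Y w).

Lemma Edot_integrable X Y : L2_vector P X -> L2_vector P Y ->
  P.-integrable setT (EFin \o (fun w => dot (X w) (Y w))).
Proof.
move=> LX LY.
apply: (@le_integrable _ _ _ P setT measurableT _ (EFin \o (fun w => `|X w| * `|Y w|))).
- by apply/measurable_EFinP; apply: measurable_dot => //; [case: LX|case: LY].
- by move=> w _; rewrite lee_fin [leRHS]ger0_norm ?mulr_ge0// dot_le.
- by apply: L2r_mul_integrable; exact: L2_vector_norm.
Qed.

Lemma Edot_le X Y : L2_vector P X -> L2_vector P Y ->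
  `|Edot X Y| <= l2 P X * l2 P Y.
Proof.
move=> LX LY; have iXY := Edot_integrable LX LY.
apply: le_trans (le_normr_Rintegral measurableT iXY) _.
have := cauchy_schwarz (L2_vector_norm LX) (L2_vector_norm LY).
apply: le_trans; apply: le_trans (ler_norm _); apply: le_Rintegral => //.
- exact: Rintegrable_abs.
- by apply: L2r_mul_integrable; exact: L2_vector_norm.
- by move=> w _; exact: dot_le.
Qed.

Lemma Edot_sq X : L2_vector P X -> Edot X X = l2 P X ^+ 2.
Proof.
move=> LX; rewrite /l2 l2r_sq; last exact: L2_vector_norm.
by apply: eq_Rintegral => w _; rewrite dot_norm.
Qed.

Lemma Edot_suml I (s : seq I) (a : I -> R) (X : I -> Omega -> H) Y :
  (forall i, L2_vector P (X i)) -> L2_vector P Y ->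
  Edot (fun w => \sum_(i <- s) a i *: X i w) Y = \sum_(i <- s) a i * Edot (X i) Y.
Proof.
move=> LX LY; rewrite /Edot.
transitivity (\int[P]_w \sum_(i <- s) a i * dot (X i w) (Y w)).
  by apply: eq_Rintegral => w _; rewrite dot_suml; apply: eq_bigr => i _; rewrite dotZl.
rewrite Rintegral_sum//.
  by apply: eq_bigr => i _; rewrite RintegralZl//; exact: Edot_integrable.
by move=> i; apply: Rintegrable_scale => //; exact: Edot_integrable.
Qed.

End expected_dot.

Section Wasserstein_bound.
Context (R : realType) (d : measure_display) (Omega : measurableType d)
  (P : probability Omega R) (H : normedModType R) (sH : separable H).

Lemma law_integral (X : Omega -> H) (mu : probability (borel H) R) (psi : H -> R) :
  measurable_fun setT (X : Omega -> borel H) -> has_law P X mu ->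
  measurable_fun setT (psi : borel H -> R) ->
  P.-integrable setT (EFin \o (fun w => psi (X w))) ->
  \int[mu]_x psi (x : H) = \int[P]_w psi (X w).
Proof.
move=> mX hX mpsi ipsi; rewrite /Rintegral; congr fine.
rewrite (eq_measure_integral (pushforward P (X : Omega -> borel H))); last first.
  by move=> A mA _; exact/esym/hX.
by rewrite integral_pushforward//; exact/measurable_EFinP.
Qed.

Lemma rho_test_lipschitz (psi : H -> R) : rho_test psi ->
  forall x y, `|psi x - psi y| <= `|x - y|.
Proof.
move=> [_ le1] x y.
have [->|xy] := eqVneq x y; first by rewrite !subrr !normr0.
have n0 : 0 < `|x - y| by rewrite normr_gt0 subr_eq0.
rewrite -[leRHS]mul1r -ler_pdivrMr// -lee_fin.
apply: le_trans le1; rewrite -[leLHS]add0e; apply: leeD.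
  apply: (@le_trans _ _ (`|psi x| / phi x ^+ 2)%:E).
    by rewrite lee_fin divr_ge0// exprn_ge0// addr_ge0.
  by apply: ereal_sup_ubound; exists x.
by apply: ereal_sup_ubound; exists (x, y).
Qed.

(** The test functions of [rho] are 1-Lipschitz, so that every coupling of the
    two laws bounds [rho] by the mean distance, hence by the [L_2] distance.
    This turns the dependence of the coefficients on the law into a dependence
    on the process itself. *)
Lemma rho_le_coupling (mu nu : Vphi2 H) (X Y : Omega -> H) :
  L2_vector P X -> L2_vector P Y -> has_law P X mu -> has_law P Y nu ->
  rho mu nu <= l2 P (fun w => X w - Y w).
Proof.
move=> LX LY hX hY.
have LXY := L2_vectorB sH LX LY.
set B := l2 P _.
have bnd psi : rho_test psi ->
    \int[mu]_x psi x - \int[nu]_x psi x <= B.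
  move=> tpsi; have [cpsi _] := tpsi; have lpsi := rho_test_lipschitz tpsi.
  have mpsi := continuous_borel_real cpsi.
  have ipsi (Z : Omega -> H) : L2_vector P Z ->
      P.-integrable setT (EFin \o (fun w => psi (Z w))).
    move=> LZ; have i1 := L2r_integrable (L2rD (L2r_cst P `|psi 0|) (L2_vector_norm LZ)).
    apply: (le_integrable measurableT _ _ i1).
      apply/measurable_EFinP; apply: (measurableT_comp mpsi).
      by case: LZ.
    move=> w _; rewrite /= lee_fin [leRHS]ger0_norm ?addr_ge0//.
    rewrite -[psi (Z w)](subrK (psi 0)) addrC.
    apply: le_trans (ler_normD _ _) _; rewrite lerD2l.
    by rewrite -[X in _ <= `|X|]subr0.
  have [mX mY] := (LX.1, LY.1).
  rewrite (law_integral mX hX mpsi (ipsi _ LX)) (law_integral mY hY mpsi (ipsi _ LY)).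
  have iX := ipsi _ LX; have iY := ipsi _ LY.
  rewrite -RintegralB//.
  have i2 := L2r_integrable (L2_vector_norm LXY).
  apply: (@le_trans _ _ (\int[P]_w `|X w - Y w|)).
    apply: le_Rintegral => //.
      by move: (Rintegrable_add measurableT iX (Rintegrable_scale measurableT (-1) iY));
        under eq_fun do rewrite /= mulN1r.
    by move=> w _; apply: le_trans (ler_norm _) (lpsi _ _).
  have := cauchy_schwarz (L2_vector_norm LXY) (L2r_cst P 1).
  rewrite l2r_cst normr1 mulr1 -/B.
  apply: le_trans; apply: le_trans (ler_norm _).
  by rewrite le_eqVlt; apply/orP; left; apply/eqP; apply: eq_Rintegral => w _; rewrite /= mulr1.
rewrite /rho; set E := (X in sup X).
have [->|/set0P E0] := eqVneq E set0; first by rewrite sup0 l2_ge0.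
by apply: ge_sup => // _ [psi tpsi <-]; exact: bnd.
Qed.

Lemma norm_phi_le (mu : Vphi2 H) (X : Omega -> H) :
  L2_vector P X -> has_law P X mu -> 0 <= norm_phi mu <= 1 + l2 P X.
Proof.
move=> LX hX; have iX := L2r_integrable (L2_vector_norm LX).
have i1 := L2r_integrable (L2r_cst P 1).
have mphi : measurable_fun setT ((@phi R H) : borel H -> R).
  apply: measurable_funD; first exact: measurable_cst.
  by apply: measurable_borel_norm; exact: measurable_id.
apply/andP; split.
  by apply: Rintegral_ge0 => x _; rewrite addr_ge0.
rewrite /norm_phi (law_integral LX.1 hX mphi (Rintegrable_add measurableT i1 iX)).
rewrite /phi.
have LS := L2rD (L2r_cst P 1) (L2_vector_norm LX).
have := cauchy_schwarz LS (L2r_cst P 1).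
rewrite l2r_cst normr1 mulr1 => h.
have h2 := l2rD (L2r_cst P 1) (L2_vector_norm LX); rewrite l2r_cst normr1 in h2.
apply: le_trans h2; apply: le_trans h; apply: le_trans (ler_norm _).
by rewrite le_eqVlt; apply/orP; left; apply/eqP; apply: eq_Rintegral => w _; rewrite /= mulr1.
Qed.

End Wasserstein_bound.

(** * Norm of a Bochner integral *)

(** Replacing a list by a list of elements of a subtype makes the property of
    the entries available for every summation index, where the lemmas on
    finite sums ask for it without a membership hypothesis. *)
Lemma Forall_sig (T : Type) (Q : T -> Prop) (s : seq T) : List.Forall Q s ->
  exists s' : seq {a : T | Q a}, s = map sval s'.
Proof.
elim=> [|a {}s Qa _ [s' ->]]; first by exists [::].
by exists (exist _ a Qa :: s').
Qed.

Lemma l2_poweR (R : realType) (d : measure_display) (Omega : measurableType d)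
  (P : probability Omega R) (V : normedModType R) (X : Omega -> V) :
  L2_vector P X -> (mean_square P X `^ 2^-1)%E = (l2 P X)%:E.
Proof.
move=> LX; rewrite mean_squareE// poweR_EFin powR12_sqrt ?sqr_ge0//.
by rewrite sqrtr_sqr ger0_norm ?l2_ge0.
Qed.

Section Bochner.
Context (R : realType) (d : measure_display) (Omega : measurableType d)
  (P : probability Omega R).
Context (H : completeNormedModType R) (dot : {dot H for idfun})
  (dot_norm : forall x : H, dot x x = `|x| ^+ 2) (sH : separable H).
Local Notation lambda := (@lebesgue_measure R).
Implicit Types s : seq (set R * (Omega -> H)).

Lemma lebesgue_sub_fin (t : R) (B : set R) : measurable B ->
  B `<=` `[0, t] -> (lambda B < +oo)%E.
Proof.
move=> mB Bt; apply: (@le_lt_trans _ _ (lambda `[0, t]%classic)).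
  by apply: le_measure => //; rewrite inE.
by rewrite lebesgue_measure_itv/=; case: ifP => _; rewrite ?ltry// -EFinB ltry.
Qed.

Lemma indic_integrable (t : R) (B : set R) : measurable B ->
  lambda.-integrable `[0, t] (EFin \o (\1_B : R -> R)).
Proof.
move=> mB; apply: measurable_bounded_integrable => //.
- exact: (@lebesgue_sub_fin t).
- exists 1; split=> // x x1 r _; apply: le_trans (ltW x1).
  by rewrite /= indicE; case: (_ \in _); rewrite ?normr1 ?normr0.
Qed.

Lemma Rintegral_indic_sub (t : R) (B : set R) : measurable B ->
  B `<=` `[0, t] -> \int[lambda]_(r in `[0, t]) (\1_B r : R) = fine (lambda B).
Proof.
move=> mB Bt; rewrite /Rintegral integral_indic//; congr (fine (lambda _)).
by apply/setIidl.
Qed.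

Lemma simple_value_L2 t s r : simple_L2 P t s -> L2_vector P (simple_value s r).
Proof.
move=> /Forall_sig[s' ->]; rewrite /simple_value.
under eq_fun do rewrite big_map.
by apply: L2_vector_sum => // -[a [ma at_ La]] /=; exact: L2_vectorZ.
Qed.

Lemma simple_integral_L2 t s : simple_L2 P t s -> L2_vector P (simple_integral s).
Proof.
move=> /Forall_sig[s' ->]; rewrite /simple_integral.
under eq_fun do rewrite big_map.
by apply: L2_vector_sum => // -[a [ma at_ La]] /=; exact: L2_vectorZ.
Qed.

(** Testing against the integral itself turns the vector inequality into a
    scalar one: [|I|^2 = \int E<s(r), I> dr <= |I| \int |s(r)| dr]. *)
Lemma simple_integral_le (t : R) s (G : R -> R) : simple_L2 P t s ->
  lambda.-integrable `[0, t] (EFin \o G) ->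
  (forall r, 0 <= r <= t -> l2 P (simple_value s r) <= G r) ->
  l2 P (simple_integral s) <= \int[lambda]_(r in `[0, t]) G r.
Proof.
move=> Ls iG sG.
have G0 : 0 <= \int[lambda]_(r in `[0, t]) G r.
  apply: Rintegral_ge0 => r /=; rewrite in_itv/= => rt.
  exact: le_trans (l2_ge0 _ _) (sG r rt).
have LI := simple_integral_L2 Ls.
set I := simple_integral s in LI *.
have [->//|I0] := eqVneq (l2 P I) 0.
have Ip : 0 < l2 P I by rewrite lt_neqAle eq_sym I0 l2_ge0.
rewrite -(ler_pM2l Ip) -expr2 -(Edot_sq dot_norm LI).
have Lv r := simple_value_L2 r Ls.
pose term := {a : set R * (Omega -> H) |
  [/\ measurable a.1, a.1 `<=` `[0, t] & L2_vector P a.2]}.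
have [s' s'E] : exists s' : seq term, s = map sval s' := Forall_sig Ls.
have LX (b : term) : L2_vector P (sval b).2 by case: b => a [].
have mB (b : term) : measurable (sval b).1 by case: b => a [].
have sB (b : term) : (sval b).1 `<=` `[0, t] by case: b => a [].
have -> : Edot P dot I I = \sum_(b <- s') fine (lambda (sval b).1) * Edot P dot (sval b).2 I.
  rewrite -Edot_suml//; congr Edot; apply/funext => w.
  by rewrite /I /simple_integral s'E big_map.
have vE r : Edot P dot (simple_value s r) I =
    \sum_(b <- s') \1_((sval b).1) r * Edot P dot (sval b).2 I.
  rewrite -Edot_suml//; congr Edot; apply/funext => w.
  by rewrite /simple_value s'E big_map.
have ib (b : term) : lambda.-integrable `[0, t]
    (EFin \o (fun r => \1_((sval b).1) r * Edot P dot (sval b).2 I)).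
  by apply: Rintegrable_scaler => //; exact: indic_integrable.
have -> : \sum_(b <- s') fine (lambda (sval b).1) * Edot P dot (sval b).2 I =
    \int[lambda]_(r in `[0, t]) Edot P dot (simple_value s r) I.
  under [in RHS]eq_Rintegral do rewrite vE.
  rewrite Rintegral_sum//; apply: eq_bigr => b _.
  by rewrite RintegralZr ?Rintegral_indic_sub//; exact: indic_integrable.
rewrite -RintegralZl//; apply: le_Rintegral => //.
- rewrite (_ : (fun r => Edot _ _ _ _) = fun r => \sum_(b <- s')
      \1_((sval b).1) r * Edot P dot (sval b).2 I); last by apply/funext.
  exact: Rintegrable_sum.
- exact: Rintegrable_scale.
- move=> r /=; rewrite in_itv/= => rt.
  apply: le_trans (ler_norm _) _; apply: le_trans (Edot_le dot_norm sH (Lv r) LI) _.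
  by rewrite mulrC ler_pM2l// sG.
Qed.

Definition simple_opp s := [seq (a.1, fun w => - a.2 w) | a <- s].

Lemma simple_opp_L2 t s : simple_L2 P t s -> simple_L2 P t (simple_opp s).
Proof.
elim=> [|a {}s [ma at_ La] _ IH]; first by constructor.
by constructor => //=; split=> //=; exact: L2_vectorN.
Qed.

Lemma simple_value_sub s s' r w :
  simple_value (s ++ simple_opp s') r w = simple_value s r w - simple_value s' r w.
Proof.
rewrite /simple_value big_cat/= big_map -sumrN; congr (_ + _).
by apply: eq_bigr => a _; rewrite scalerN.
Qed.

Lemma simple_integral_sub s s' w :
  simple_integral (s ++ simple_opp s') w = simple_integral s w - simple_integral s' w.
Proof.
rewrite /simple_integral big_cat/= big_map -sumrN; congr (_ + _).
by apply: eq_bigr => a _; rewrite scalerN.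
Qed.

(** The difference of two simple processes is again simple, so that the bound
    for simple integrals applies to the approximations of both integrals at
    once; the approximation errors are added to the majorant and integrate to
    zero in the limit. *)
Lemma bochner_integral_sub_le (t : R) (f f' : R -> Omega -> H) (Y Y' : Omega -> H)
  (G : R -> R) : bochner_integral P t f Y -> bochner_integral P t f' Y' ->
  lambda.-integrable `[0, t] (EFin \o G) ->
  (forall r, 0 <= r <= t -> l2 P (fun w => f r w - f' r w) <= G r) ->
  l2 P (fun w => Y w - Y' w) <= \int[lambda]_(r in `[0, t]) G r.
Proof.
move=> [Lf LY [s [Ls ms s0 sY]]] [Lf' LY' [s' [Ls' ms' s0' sY']]] iG fG.
set err := fun n r => (mean_square P (fun w => simple_value (s n) r w - f r w)%R `^ 2^-1)%E.
set err' := fun n r => (mean_square P (fun w => simple_value (s' n) r w - f' r w)%R `^ 2^-1)%E.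
pose I n := (\int[lambda]_(r in `[0%R, t]) err n r)%E.
pose I' n := (\int[lambda]_(r in `[0%R, t]) err' n r)%E.
have /fine_cvgP[fin0 s0r] : I n @[n --> \oo] --> 0%E by exact: s0.
have /fine_cvgP[fin0' s0r'] : I' n @[n --> \oo] --> 0%E by exact: s0'.
pose b n := \int[lambda]_(r in `[0, t]) G r + fine (I n) + fine (I' n).
apply: (@l2_limit _ _ _ _ _ sH
  (fun n => simple_integral (s n ++ simple_opp (s' n))) _ b).
- move=> n; apply: simple_integral_L2; apply/List.Forall_app.
  by split; [exact: Ls|exact: simple_opp_L2].
- exact: L2_vectorB.
- have LI n := simple_integral_L2 (Ls n); have LI' n := simple_integral_L2 (Ls' n).
  have c1 := mean_square_cvg0 (fun n => L2_vectorB sH (LI n) LY) sY.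
  have c2 := mean_square_cvg0 (fun n => L2_vectorB sH (LI' n) LY') sY'.
  apply: (squeeze_cvgr _ (cvg_cst 0) _); last first.
    by rewrite -[X in _ --> X]addr0; exact: cvgD c1 c2.
  apply: nearW => n; rewrite l2_ge0/=.
  apply: le_trans (l2B sH (L2_vectorB sH (LI n) LY) (L2_vectorB sH (LI' n) LY')).
  rewrite le_eqVlt; apply/orP; left; apply/eqP; congr l2; apply/funext => w.
  rewrite simple_integral_sub !opprB addrACA [RHS]addrACA; congr (_ + _).
  exact: addrC.
- move: fin0 fin0'; apply: filterS2 => n finI finI'.
  have Lsn : simple_L2 P t (s n ++ simple_opp (s' n)).
    by apply/List.Forall_app; split; [exact: Ls|exact: simple_opp_L2].
  have errE r : 0 <= r <= t -> err n r =
      (l2 P (fun w => simple_value (s n) r w - f r w))%:E.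
    move=> rt; rewrite /err l2_poweR//; apply: L2_vectorB => //; last exact: Lf.
    exact: simple_value_L2 (Ls n).
  have errE' r : 0 <= r <= t -> err' n r =
      (l2 P (fun w => simple_value (s' n) r w - f' r w))%:E.
    move=> rt; rewrite /err' l2_poweR//; apply: L2_vectorB => //; last exact: Lf'.
    exact: simple_value_L2 (Ls' n).
  have ierr : lambda.-integrable `[0, t] (EFin \o (fun r => fine (err n r))).
    have : lambda.-integrable `[0, t] (err n).
      apply/integrableP; split; first exact: ms.
      under eq_integral => r _ do rewrite gee0_abs ?poweR_ge0//.
      by rewrite ltey_eq -/(I n) finI.
    apply: eq_integrable => // r; rewrite inE/= in_itv/= => rt.
    by rewrite errE.
  have ierr' : lambda.-integrable `[0, t] (EFin \o (fun r => fine (err' n r))).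
    have : lambda.-integrable `[0, t] (err' n).
      apply/integrableP; split; first exact: ms'.
      under eq_integral => r _ do rewrite gee0_abs ?poweR_ge0//.
      by rewrite ltey_eq -/(I' n) finI'.
    apply: eq_integrable => // r; rewrite inE/= in_itv/= => rt.
    by rewrite errE'.
  have eI : fine (I n) =
      \int[lambda]_(r in `[0, t]) fine (err n r).
    congr fine; apply: eq_integral => r; rewrite inE/= in_itv/= => rt.
    by rewrite errE.
  have eI' : fine (I' n) =
      \int[lambda]_(r in `[0, t]) fine (err' n r).
    congr fine; apply: eq_integral => r; rewrite inE/= in_itv/= => rt.
    by rewrite errE'.
  have iGe : lambda.-integrable `[0, t] (EFin \o (fun r => G r + fine (err n r))).
    exact: Rintegrable_add.
  rewrite /b eI eI' -RintegralD// -RintegralD//.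
  apply: simple_integral_le => //; first exact: Rintegrable_add.
  move=> r rt; rewrite errE// errE'//=.
  have LA := L2_vectorB sH (simple_value_L2 r (Ls n)) (Lf r rt).
  have LB := L2_vectorB sH (simple_value_L2 r (Ls' n)) (Lf' r rt).
  have LC := L2_vectorB sH (Lf r rt) (Lf' r rt).
  rewrite (_ : simple_value _ r = fun w => ((f r w - f' r w) + (simple_value (s n) r w - f r w))
      - (simple_value (s' n) r w - f' r w)).
    apply: le_trans (l2B sH (L2_vectorD sH LC LA) LB) _; rewrite lerD2r.
    by apply: le_trans (l2D sH LC LA) _; rewrite lerD2r fG.
  apply/funext => w; rewrite simple_value_sub !opprB.
  by rewrite [f r w - f' r w + _]addrC !subrKA.
- rewrite -[X in _ --> X]addr0 -[X in _ --> X + 0]addr0.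
  exact: (cvgD (cvgD (cvg_cst _) s0r) s0r').
Qed.

End Bochner.

(** * Independence and adaptedness *)

Section independence.
Context (R : realType) (d : measure_display) (Omega : measurableType d)
  (P : probability Omega R).

(** Independence says that the joint law of [(xi, Y)] is the product of the
    laws; the product formula is then Fubini's theorem. *)
Lemma independent_integral_mul (xi Y : Omega -> R) :
  measurable_fun setT xi -> measurable_fun setT Y ->
  (forall A B, measurable A -> measurable B ->
    P (xi @^-1` A `&` Y @^-1` B) = (P (xi @^-1` A) * P (Y @^-1` B))%E) ->
  P.-integrable setT (EFin \o xi) -> P.-integrable setT (EFin \o Y) ->
  P.-integrable setT (EFin \o (fun w => xi w * Y w)) ->
  \int[P]_w (xi w * Y w) = (\int[P]_w xi w) * (\int[P]_w Y w).
Proof.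
move=> mxi mY indep ixi iY ixiY.
have mZ : measurable_fun setT (fun w => (xi w, Y w)) by exact: measurable_fun_pair.
pose X1 : {mfun Omega >-> R} :=
  MeasurableFun.Pack (MeasurableFun.Class (isMeasurableFun.Build _ _ _ _ _ mxi)).
pose X2 : {mfun Omega >-> R} :=
  MeasurableFun.Pack (MeasurableFun.Class (isMeasurableFun.Build _ _ _ _ _ mY)).
pose X12 : {mfun Omega >-> (R * R)%type} :=
  MeasurableFun.Pack (MeasurableFun.Class (isMeasurableFun.Build _ _ _ _ _ mZ)).
pose m1 : probability R R := distribution P X1.
pose m2 : probability R R := distribution P X2.
pose m12 : probability (R * R)%type R := distribution P X12.
have mE : forall C, measurable C -> (m1 \x m2)%E C = m12 C.
  by apply: product_measure_unique => A B mA mB; rewrite -[RHS]indep.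
pose F (z : R * R) := (z.1 * z.2)%:E.
have mF : measurable_fun setT F.
  by apply/measurable_EFinP; apply: measurable_funM;
    [exact: measurable_fst|exact: measurable_snd].
have iF12 : m12.-integrable setT F.
  by apply: integrable_pushforward.
have iF : (m1 \x m2)%E.-integrable setT F.
  apply/integrableP; split => //; case/integrableP : iF12 => _ h.
  by rewrite (eq_measure_integral m12)// => C mC _; exact: mE.
have := integral12_prod_meas1 iF.
rewrite [RHS](eq_measure_integral m12); last by move=> C mC _; exact: mE.
rewrite [RHS]integral_distribution//.
have mEFin : measurable_fun setT (@EFin R) by exact: EFin_measurable.
have iid2 : m2.-integrable setT (@EFin R).
  exact: integrable_pushforward.
have iid1 : m1.-integrable setT (@EFin R).
  exact: integrable_pushforward.
have e2 : (\int[m2]_y y%:E = (\int[P]_w Y w)%:E)%E.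
  rewrite (integral_distribution (X := X2) (f := EFin))//.
  by rewrite /Rintegral fineK//; exact: integrable_fin_num.
have e1 : (\int[m1]_y y%:E = (\int[P]_w xi w)%:E)%E.
  rewrite (integral_distribution (X := X1) (f := EFin))//.
  by rewrite /Rintegral fineK//; exact: integrable_fin_num.
rewrite /fubini_F /F /=.
under eq_integral => x _.
  under eq_integral do rewrite EFinM.
  rewrite integralZl// e2.
  over.
rewrite integralZr// e1 -EFinM => h.
by rewrite [LHS]/Rintegral /= -h.
Qed.

End independence.

Section measurable_wrt.
Context (Omega : pointedType) (G : set (set Omega)) (sG : sigma_algebra setT G).

(** Adaptedness is stated through preimages; seeing it as measurability for the
    sigma-algebra generated by [G] makes the closure properties of measurable
    functions available for adapted ones. *)
Lemma measurable_wrtP (d' : measure_display) (E : measurableType d') (X : Omega -> E) :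
  measurable_wrt G X <-> measurable_fun setT (X : g_sigma_algebraType G -> E).
Proof.
split=> [GX _ B mB|mX B mB].
  by rewrite setTI; apply: sub_sigma_algebra; exact: GX.
have := mX measurableT B mB; rewrite setTI.
by rewrite /measurable/= sigma_algebra_id.
Qed.

End measurable_wrt.

(** * Correlations of Wiener increments *)

Section Wiener_increments.
Context (R : realType) (d : measure_display) (Omega : measurableType d)
  (P : probability Omega R).
Context (U : completeNormedModType R) (dot : {dot U for idfun})
  (dot_norm : forall x : U, dot x x = `|x| ^+ 2) (sU : separable U).
Context (F : R -> set (set Omega)) (hF : complete_filtration P F).
Context (Q : bounded_op U U) (W : R -> Omega -> U).
Context (Qsym : forall h k : U, dot (Q h) k = dot h (Q k)).
Context (W_adapted : forall t, 0 <= t ->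
    measurable_wrt (F t) (W t : Omega -> borel U))
  (W_L2 : forall t, 0 <= t -> L2_vector P (W t))
  (W_mean : forall t (h : U), 0 <= t -> (\int[P]_w (dot (W t w) h)%:E = 0)%E)
  (W_indep : forall u t, 0 <= u -> u <= t -> independent2 P (F u)
      [set (fun w => W t w - W u w) @^-1` B
      | B in (measurable : set (set (borel U)))])
  (W_cov : forall u t (h k : U), 0 <= u -> u <= t ->
    (\int[P]_w (dot (W t w - W u w) h * dot (W t w - W u w) k)%:E
     = ((t - u) * dot (Q h) k)%:E)%E).

Definition increment u t h w : R := dot (W t w - W u w) h.

Let incr_L2r u t h : 0 <= u -> 0 <= t -> L2r P (increment u t h).
Proof.
move=> u0 t0; have LW := L2_vectorB sU (W_L2 t0) (W_L2 u0).
apply: (L2r_le _ (L2rZ `|h| (L2_vector_norm LW))) => [|w].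
  by apply: measurable_dot => //; case: LW.
by rewrite [leRHS]ger0_norm ?mulr_ge0// mulrC dot_le.
Qed.

Let incr_split u v t h w : increment u t h w = increment u v h w + increment v t h w.
Proof. by rewrite /increment -dotDl [in RHS]addrC subrKA. Qed.

Let incr_adapted u v t h : 0 <= u -> u <= t -> 0 <= v -> v <= t ->
  measurable_wrt (F t) (increment u v h).
Proof.
move=> u0 ut v0 vt; have t0 := le_trans u0 ut.
apply/(measurable_wrtP (filtration_sigma hF t0)).
have mW s : 0 <= s -> s <= t ->
    measurable_fun setT ((fun w => dot (W s w) h) : g_sigma_algebraType (F t) -> R).
  move=> s0 st; apply: (measurableT_comp (f := (dot^~ h : borel U -> R))).
    by apply: continuous_borel_real; exact: (dot_continuous dot_norm).
  apply/(measurable_wrtP (filtration_sigma hF t0)) => B mB.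
  exact: (filtration_mono hF s0 st) (W_adapted s0 mB).
rewrite (_ : increment _ _ _ = fun w => dot (W v w) h - dot (W u w) h).
  by apply: measurable_funB; exact: mW.
by apply/funext => w; rewrite /increment dotBl.
Qed.

Let indic_adapted u t A : 0 <= u -> u <= t -> F u A ->
  measurable_wrt (F t) (\1_A : Omega -> R).
Proof.
move=> u0 ut FA; have t0 := le_trans u0 ut.
apply/(measurable_wrtP (filtration_sigma hF t0)).
apply: measurable_indic; apply: sub_sigma_algebra.
exact: (filtration_mono hF u0 ut).
Qed.

Let mul_adapted t (x y : Omega -> R) : 0 <= t -> measurable_wrt (F t) x ->
  measurable_wrt (F t) y -> measurable_wrt (F t) (fun w => x w * y w).
Proof.
move=> t0 /(measurable_wrtP (filtration_sigma hF t0)) mx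
  /(measurable_wrtP (filtration_sigma hF t0)) my.
by apply/(measurable_wrtP (filtration_sigma hF t0)); exact: measurable_funM.
Qed.

Let event_measurable u A : 0 <= u -> F u A -> measurable A.
Proof. by move=> u0; exact: (filtration_sub hF). Qed.

Let indic_L2r u A (x : Omega -> R) : 0 <= u -> F u A -> L2r P x ->
  L2r P (fun w => \1_A w * x w).
Proof.
move=> u0 FA Lx; apply: (L2r_le _ Lx) => [|w].
  apply: measurable_funM; last by case: Lx.
  exact/measurable_indic/event_measurable/FA.
by rewrite normrM indicE; case: (_ \in _); rewrite ?normr1 ?mul1r// normr0 mul0r.
Qed.

Let adapted_measurable u (x : Omega -> R) : 0 <= u -> measurable_wrt (F u) x ->
  measurable_fun setT x.
Proof.
move=> u0 Fx _ B mB; rewrite setTI; apply: (event_measurable u0); exact: Fx.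
Qed.

Let indep_mul u t (x : Omega -> R) (psi : U -> R) : 0 <= u -> u <= t ->
  measurable_wrt (F u) x -> P.-integrable setT (EFin \o x) ->
  continuous psi ->
  P.-integrable setT (EFin \o (fun w => psi (W t w - W u w))) ->
  P.-integrable setT (EFin \o (fun w => x w * psi (W t w - W u w))) ->
  \int[P]_w (x w * psi (W t w - W u w)) =
    (\int[P]_w x w) * (\int[P]_w psi (W t w - W u w)).
Proof.
move=> u0 ut Fx ix cpsi ipsi ixpsi; have t0 := le_trans u0 ut.
have mpsi := continuous_borel_real cpsi.
apply: independent_integral_mul => //.
- exact: adapted_measurable Fx.
- by apply: (measurableT_comp mpsi); have [] := L2_vectorB sU (W_L2 t0) (W_L2 u0).
- move=> A B mA mB; apply: (W_indep u0 ut); first exact: Fx.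
  exists (psi @^-1` B) => //.
  by have := mpsi measurableT _ mB; rewrite setTI.
Qed.

Let incr_mean u t h : 0 <= u -> 0 <= t -> \int[P]_w increment u t h w = 0.
Proof.
move=> u0 t0.
have iW s : 0 <= s -> P.-integrable setT (EFin \o (fun w => dot (W s w) h)).
  move=> s0; apply: (@L2r_integrable _ _ _ P).
  apply: (L2r_le _ (L2rZ `|h| (L2_vector_norm (W_L2 s0)))) => [|w].
    by apply: measurable_dot => //; case: (W_L2 s0).
  by rewrite [leRHS]ger0_norm ?mulr_ge0// mulrC dot_le.
transitivity (\int[P]_w (dot (W t w) h - dot (W u w) h)).
  by apply: eq_Rintegral => w _; rewrite /increment dotBl.
by rewrite RintegralB ?iW// /Rintegral !W_mean// subrr.
Qed.

(** An [F u]-measurable factor is independent of the increment after [u], whose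
    mean is zero. *)
Let martingale u t h (x : Omega -> R) : 0 <= u -> u <= t ->
  measurable_wrt (F u) x -> L2r P x -> \int[P]_w (x w * increment u t h w) = 0.
Proof.
move=> u0 ut Fx Lx; have t0 := le_trans u0 ut.
rewrite (indep_mul (psi := dot^~ h) u0 ut)//.
- by rewrite incr_mean ?mulr0.
- exact: L2r_integrable.
- exact: (dot_continuous dot_norm).
- exact: (L2r_integrable (incr_L2r h u0 t0)).
- exact: (L2r_mul_integrable Lx (incr_L2r h u0 t0)).
Qed.

(** An event of the past splits off by independence, here from a product of
    two coordinates of the same increment, whose mean is given by [Q]. *)
Let covariance u t h k A : 0 <= u -> u <= t -> F u A ->
  \int[P]_w (\1_A w * (increment u t h w * increment u t k w)) =
  dot (Q h) k * fine (P A) * (t - u).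
Proof.
move=> u0 ut FA; have t0 := le_trans u0 ut.
have mA := event_measurable u0 FA.
have Lh := incr_L2r h u0 t0; have Lk := incr_L2r k u0 t0.
rewrite (indep_mul (psi := fun x => dot x h * dot x k) u0 ut)//.
- have -> : \int[P]_w (dot (W t w - W u w) h * dot (W t w - W u w) k) = (t - u) * dot (Q h) k.
    by rewrite /Rintegral W_cov.
  rewrite [X in X * _](_ : _ = fine (P A)); first by ring.
  by rewrite /Rintegral integral_indic// setIT.
- exact: (indic_adapted u0 (lexx u)).
- by have := L2r_integrable (indic_L2r u0 FA (L2r_cst P 1));
   apply: eq_integrable => // w _; rewrite /= mulr1.
- move=> x; apply: cvgM; exact: (dot_continuous dot_norm).
- exact: (L2r_mul_integrable Lh Lk).
- have := L2r_mul_integrable (indic_L2r u0 FA Lh) Lk.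
  by apply: eq_integrable => // w _; rewrite /= mulrA.
Qed.

(** Increments over intervals that do not overlap: everything but the later
    increment is measurable at the time [u] where it starts. *)
Let zero_term u t h k A B a b : 0 <= a -> 0 <= b -> a <= u -> b <= u -> u <= t ->
  0 <= u -> (exists2 v, 0 <= v <= u & F v A) ->
  (exists2 v, 0 <= v <= u & F v B) ->
  \int[P]_w (\1_A w * increment a b h w * (\1_B w * increment u t k w)) = 0.
Proof.
move=> a0 b0 au bu ut u0 [v /andP[v0 vu] FA] [v' /andP[v'0 v'u] FB].
rewrite -[RHS](@martingale u t k (fun w => \1_B w * (\1_A w * increment a b h w)))//.
- by apply: eq_Rintegral => w _; ring.
- apply: mul_adapted => //; first exact: indic_adapted FB.
  apply: mul_adapted => //; first exact: indic_adapted FA.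
  exact: incr_adapted.
- apply: indic_L2r FB _ => //; apply: indic_L2r FA _ => //.
  exact: incr_L2r.
Qed.

Let term_integrable A B u v a b a' b' h k : 0 <= u -> F u A -> 0 <= v -> F v B ->
  0 <= a -> 0 <= b -> 0 <= a' -> 0 <= b' ->
  P.-integrable setT (EFin \o (fun w =>
    \1_A w * increment a b h w * (\1_B w * increment a' b' k w))).
Proof.
move=> u0 FA v0 FB a0 b0 a'0 b'0.
apply: (L2r_mul_integrable (u := fun w => _) (v := fun w => _)).
  by apply: indic_L2r FA _ => //; exact: incr_L2r.
by apply: indic_L2r FB _ => //; exact: incr_L2r.
Qed.

Let filtrationI u v A B : 0 <= u -> u <= v -> F u A -> F v B -> F v (A `&` B).
Proof.
move=> u0 uv FA FB; have v0 := le_trans u0 uv.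
have FA' := filtration_mono hF u0 uv FA.
have := filtration_sigma hF v0; move=> sF.
rewrite -(sigma_algebra_id sF) in FA' FB *.
exact: (@measurableI _ (g_sigma_algebraType (F v))).
Qed.

Let indic_mul (A B : set Omega) w : \1_A w * \1_B w = \1_(A `&` B) w :> R.
Proof. by rewrite indicI. Qed.

(** Cut both intervals at the end points of the other one. The pieces over
    disjoint intervals are uncorrelated by the martingale property, and the
    common piece, over [l'] to the smaller of [r] and [r'], contributes its
    covariance. *)
Let pair_ordered l r l' r' A B h k : 0 <= l -> l <= r -> l <= l' -> l' <= r' ->
  F l A -> F l' B ->
  \int[P]_w (\1_A w * increment l r h w * (\1_B w * increment l' r' k w)) =
  dot (Q h) k * fine (P (A `&` B)) * Num.max 0 (Num.min r r' - Num.max l l').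
Proof.
move=> l0 lr ll' l'r' FA FB.
have l'0 := le_trans l0 ll'; have r0 := le_trans l0 lr; have r'0 := le_trans l'0 l'r'.
have FAB := filtrationI l0 ll' FA FB.
rewrite (max_r ll').
(* disjoint intervals *)
have [rl'|l'r] := leP r l'.
  rewrite zero_term//; last 2 first.
  - by exists l => //; rewrite l0.
  - by exists l' => //; rewrite l'0 lexx.
  by rewrite (min_l (le_trans rl' l'r')) max_l ?mulr0// subr_le0.
have l'r2 := ltW l'r.
(* the part of the first interval before [l'] does not contribute *)
transitivity (\int[P]_w (\1_A w * increment l' r h w * (\1_B w * increment l' r' k w))).
  transitivity (\int[P]_w (\1_A w * increment l l' h w * (\1_B w * increment l' r' k w) +
      \1_A w * increment l' r h w * (\1_B w * increment l' r' k w))).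
    by apply: eq_Rintegral => w _; rewrite (incr_split l l' r); ring.
  rewrite RintegralD//; [|exact: (term_integrable _ _ l0 FA l'0 FB)..].
  rewrite zero_term// ?add0r//; first by exists l => //; rewrite l0.
  by exists l' => //; rewrite l'0 lexx.
(* nor does the part of the longer interval after the end of the shorter one *)
have [rr'|r'r] := leP r r'.
  rewrite max_r ?subr_ge0// -(covariance h k l'0 l'r2 FAB).
  transitivity (\int[P]_w (\1_A w * increment l' r h w * (\1_B w * increment l' r k w) +
      \1_A w * increment l' r h w * (\1_B w * increment r r' k w))).
    by apply: eq_Rintegral => w _; rewrite (incr_split l' r r'); ring.
  rewrite RintegralD//; [|exact: (term_integrable _ _ l0 FA l'0 FB)..].
  rewrite [X in _ + X]zero_term// ?addr0//; last 2 first.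
  - by exists l => //; rewrite l0.
  - by exists l' => //; rewrite l'0.
  by apply: eq_Rintegral => w _; rewrite -indic_mul; ring.
have r'r2 := ltW r'r.
rewrite max_r ?subr_ge0// -(covariance h k l'0 l'r' FAB).
transitivity (\int[P]_w (\1_A w * increment l' r' h w * (\1_B w * increment l' r' k w) +
    \1_B w * increment l' r' k w * (\1_A w * increment r' r h w))).
  by apply: eq_Rintegral => w _; rewrite (incr_split l' r' r); ring.
rewrite RintegralD//; last 2 first.
- exact: (term_integrable _ _ l0 FA l'0 FB).
- exact: (term_integrable _ _ l'0 FB l0 FA).
rewrite [X in _ + X]zero_term// ?addr0//; last 2 first.
- by exists l' => //; rewrite l'0.
- by exists l => //; rewrite l0 (le_trans ll').
by apply: eq_Rintegral => w _; rewrite -indic_mul; ring.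
Qed.

(** The last factor is the length of the intersection of the two intervals.
    Writing a sum of weighted increments as a double sum, this formula gives
    Ito's isometry without refining the partitions to a common one. *)
Lemma increment_pair l r l' r' A B h k : 0 <= l -> l <= r -> 0 <= l' -> l' <= r' ->
  F l A -> F l' B ->
  \int[P]_w (\1_A w * increment l r h w * (\1_B w * increment l' r' k w)) =
  dot (Q h) k * fine (P (A `&` B)) * Num.max 0 (Num.min r r' - Num.max l l').
Proof.
move=> l0 lr l'0 l'r' FA FB; have [ll'|l'l] := orP (le_total l l').
  exact: pair_ordered.
rewrite setIC (minC r) (maxC l) (Qsym h) (dotC dot h).
rewrite -(pair_ordered k h l'0 l'r' l'l lr FB FA).
by apply: eq_Rintegral => w _; rewrite mulrC.
Qed.

End Wiener_increments.

(** * Mean squares, orthonormal families and bounded operators *)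

Section Fatou_mean_square.
Context (R : realType) (d : measure_display) (Omega : measurableType d)
  (P : probability Omega R) (V : normedModType R).

Lemma limn_einf_le (u : nat -> \bar R) (B : \bar R) :
  (forall n, (u n <= B)%E) -> (limn_einf u <= B)%E.
Proof.
move=> uB; rewrite limn_einf_lim; apply: lime_le; first exact: is_cvg_einfs.
apply: nearW => n; apply: le_trans (uB n).
by apply: ereal_inf_lbound; exists n => /=.
Qed.

(** Almost sure convergence is enough for an upper bound on second moments:
    this makes the isometry inequality accessible from finitely many
    coordinates of the Wiener process, without any uniform integrability. *)
Lemma fatou_mean_square (X : nat -> Omega -> V) (Y : Omega -> V) (B : \bar R) :
  (forall m, measurable_fun setT (X m : Omega -> borel V)) ->
  measurable_fun setT (Y : Omega -> borel V) ->
  {ae P, forall w, X m w @[m --> \oo] --> Y w} ->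
  (forall m, (mean_square P (X m) <= B)%E) -> (mean_square P Y <= B)%E.
Proof.
move=> mX mY XY XB; rewrite /mean_square.
have msq (Z : Omega -> V) : measurable_fun setT (Z : Omega -> borel V) ->
    measurable_fun setT (fun w => (`|Z w| ^+ 2)%:E).
  move=> mZ; apply/measurable_EFinP; apply: measurable_funX.
  exact: measurable_borel_norm.
have sq0 (Z : Omega -> V) w : (0 <= (`|Z w| ^+ 2)%:E)%E by rewrite lee_fin sqr_ge0.
apply: le_trans (limn_einf_le XB).
apply: le_trans (fatou P measurableT (fun m => msq _ (mX m)) (fun m w _ => sq0 (X m) w)).
apply: ae_ge0_le_integral => //.
- exact: msq.
- move=> w _; rewrite limn_einf_lim; apply: lime_ge; first exact: is_cvg_einfs.
  by apply: nearW => n; apply: le_ereal_inf_tmp => _ [m _ <-].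
- apply: measurableT_comp; first exact: oppe_measurable.
  apply: measurable_fun_limn_esup => m.
  by apply: measurableT_comp; [exact: oppe_measurable|exact: msq].
- apply: filterS XY => w XYw _.
  have c2 : (`|X m w| ^+ 2)%:E @[m --> \oo] --> (`|Y w| ^+ 2)%:E.
    apply: cvg_EFin; first exact: nearW.
    have c1 : `|X m w| @[m --> \oo] --> `|Y w| by exact: cvg_norm.
    by rewrite expr2; under eq_fun do rewrite /= expr2; exact: cvgM.
  have [-> _] := cvg_limn_einf_sup c2.
  by [].
Qed.

End Fatou_mean_square.

Section Gram.
Context (R : realType) (d : measure_display) (Omega : measurableType d)
  (P : probability Omega R).
Context (H : completeNormedModType R) (dot : {dot H for idfun})
  (dot_norm : forall x : H, dot x x = `|x| ^+ 2) (sH : separable H).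

Lemma L2_vector_scaler (c : Omega -> R) (v : H) : L2r P c ->
  L2_vector P (fun w => c w *: v).
Proof.
move=> Lc; apply: (L2_vector_le _ (L2rZ `|v| Lc)) => [|w].
  by apply: measurable_borel_scaler; case: Lc.
by rewrite normrZ normrM normr_id mulrC.
Qed.

Lemma l2_sq_sum I (s : seq I) (c : I -> Omega -> R) (v : I -> H) :
  (forall i, L2r P (c i)) ->
  l2 P (fun w => \sum_(i <- s) c i w *: v i) ^+ 2 =
  \sum_(i <- s) \sum_(j <- s) (\int[P]_w (c i w * c j w)) * dot (v i) (v j).
Proof.
move=> Lc; rewrite -(Edot_sq dot_norm); last first.
  by apply: L2_vector_sum => // i; exact: L2_vector_scaler.
rewrite /Edot.
transitivity (\int[P]_w \sum_(i <- s) \sum_(j <- s) (c i w * c j w) * dot (v i) (v j)).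
  apply: eq_Rintegral => w _; rewrite dot_suml; apply: eq_bigr => i _.
  rewrite dot_sumr; apply: eq_bigr => j _.
  by rewrite dotZl dotZr mulrA.
have icc i j : P.-integrable setT (EFin \o (fun w => c i w * c j w * dot (v i) (v j))).
  by apply: Rintegrable_scaler => //; exact: L2r_mul_integrable.
rewrite Rintegral_sum//; last by move=> i; exact: Rintegrable_sum.
apply: eq_bigr => i _; rewrite Rintegral_sum//; apply: eq_bigr => j _.
by rewrite RintegralZr//; exact: L2r_mul_integrable.
Qed.

End Gram.

Section orthonormal.
Context (R : realType) (U : completeNormedModType R) (dot : {dot U for idfun})
  (dot_norm : forall x : U, dot x x = `|x| ^+ 2).
Context (N : set nat) (e : nat -> U) (eN : orthonormal_family dot N e).

(** The orthogonal projection on the span of the first [m] vectors of the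
    family. *)
Definition fourier m x : U := \sum_(0 <= n < m | n \in N) dot x (e n) *: e n.

Lemma dot_partial_sum (c : nat -> R) k m : N k -> (k < m)%N ->
  dot (\sum_(0 <= n < m | n \in N) c n *: e n) (e k) = c k.
Proof.
move=> Nk km; rewrite dot_suml big_mkcond.
rewrite (bigD1_seq k)/= ?mem_index_iota ?iota_uniq// mem_set//.
rewrite dotZl eN// eqxx mulr1 big1 ?addr0// => n nk.
by case: ifPn => // /set_mem nN; rewrite dotZl eN// (negbTE nk) mulr0.
Qed.

(** The coefficients of a convergent expansion along an orthonormal family are
    necessarily the inner products. For the Wiener process the given expansion
    is thereby replaced by one that is linear in the vector. *)
Lemma fourier_expansion (c : nat -> R) x :
  (\sum_(0 <= n < m | n \in N) c n *: e n) @[m --> \oo] --> x ->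
  fourier m x @[m --> \oo] --> x.
Proof.
move=> cx.
have cE k : N k -> dot x (e k) = c k.
  move=> Nk.
  have h : dot (\sum_(0 <= n < m | n \in N) c n *: e n) (e k) @[m --> \oo] --> dot x (e k).
    apply: (@cvg_comp _ _ _ (fun m => \sum_(0 <= n < m | n \in N) c n *: e n)
      (dot^~ (e k)) \oo (nbhs x)) => //.
    exact: (@dot_continuous _ _ _ dot_norm (e k) x).
  rewrite -(cvg_lim _ h)//; apply: lim_near_cst => //.
  by exists k.+1 => // m /= km; rewrite dot_partial_sum.
rewrite (_ : fourier^~ x = fun m => \sum_(0 <= n < m | n \in N) c n *: e n)//.
apply/funext => m; apply: eq_bigr => n nN; rewrite cE//; exact/set_mem.
Qed.

Lemma fourierB m x y : fourier m (x - y) = fourier m x - fourier m y.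
Proof.
rewrite /fourier -sumrB; apply: eq_bigr => n _.
by rewrite dotBl scalerBl.
Qed.

(** Bessel's inequality, from [0 <= |x - fourier m x|^2]. *)
Lemma bessel m x : \sum_(0 <= n < m | n \in N) dot x (e n) ^+ 2 <= `|x| ^+ 2.
Proof.
rewrite -subr_ge0 (_ : _ - _ = `|x - fourier m x| ^+ 2) ?sqr_ge0//.
rewrite -!dot_norm dotBl !dotBr (dotC dot (fourier m x) x).
have e1 : dot x (fourier m x) = \sum_(0 <= n < m | n \in N) dot x (e n) ^+ 2.
  by rewrite dot_sumr; apply: eq_bigr => n _; rewrite dotZr expr2.
have e2 : dot (fourier m x) (fourier m x) = dot x (fourier m x).
  rewrite {2}/fourier e1 dot_sumr big_nat_cond [RHS]big_nat_cond.
  apply: eq_bigr => n /andP[/andP[_ nm] nN].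
  by rewrite dotZr dot_partial_sum ?expr2//; exact/set_mem.
by rewrite e2 e1; ring.
Qed.

End orthonormal.

Section bounded_operators.
Context (R : realType) (U V : normedModType R).

Lemma bop_bounded (L : bounded_op U V) : has_ubound [set `|L x| | x in [set x : U | `|x| <= 1]].
Proof.
have /linear_bounded_continuous/linear_boundedP := @bop_continuous _ _ _ L.
move=> /pinfty_ex_gt0[r r0 rL]; exists r => _ [x /= x1 <-].
by apply: le_trans (rL x) _; rewrite -[leRHS]mulr1 ler_pM2l.
Qed.

Lemma opnorm_le1 (L : bounded_op U V) x : `|x| <= 1 -> `|L x| <= opnorm L.
Proof. by move=> x1; apply: ub_le_sup; [exact: bop_bounded|exists x]. Qed.

Lemma opnorm_ge0 (L : bounded_op U V) : 0 <= opnorm L.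
Proof. by apply: le_trans (opnorm_le1 L (x := 0) _); rewrite ?normr0 ?ler01. Qed.

Lemma opnorm_le (L : bounded_op U V) x : `|L x| <= opnorm L * `|x|.
Proof.
have [->|x0] := eqVneq x 0; first by rewrite linear0 !normr0 mulr0.
have n0 : 0 < `|x| by rewrite normr_gt0.
have -> : `|L x| = `|L (`|x|^-1 *: x)| * `|x|.
  by rewrite linearZ normrZ normfV normr_id mulrAC mulVf ?mul1r// gt_eqF.
rewrite ler_pM2r// opnorm_le1//.
by rewrite normrZ normfV normr_id mulVf// gt_eqF.
Qed.

Context (d : measure_display) (Omega : measurableType d) (P : probability Omega R).

Lemma L2_vector_bop (L : bounded_op U V) (X : Omega -> U) : L2_vector P X ->
  L2_vector P (fun w => L (X w)).
Proof.
move=> LX; apply: (L2_vector_le _ (L2rZ (opnorm L) (L2_vector_norm LX))) => [|w].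
  by apply: measurable_borel_comp; [exact: bop_continuous|case: LX].
by rewrite [leRHS]ger0_norm ?mulr_ge0 ?opnorm_ge0// opnorm_le.
Qed.

Lemma L2_vector_indic (A : set Omega) (X : Omega -> U) : measurable A ->
  L2_vector P X -> L2_vector P (fun w => (\1_A w : R) *: X w).
Proof.
move=> mA LX; apply: (L2_vector_le _ (L2_vector_norm LX)) => [|w].
  rewrite (_ : (fun w => _) = fun w => if w \in A then X w else 0); last first.
    by apply/funext => w; rewrite indicE; case: (_ \in _); rewrite ?scale1r ?scale0r.
  apply: measurable_fun_ifT; last exact: measurable_cst.
    apply: (measurable_fun_bool true); rewrite setTI.
    rewrite (_ : _ @^-1` _ = A)//; apply/seteqP; split=> w /=; first by move/set_mem.
    by move/mem_set.
  by case: LX.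
rewrite normrZ normr_id indicE.
by case: (_ \in _); rewrite ?normr1 ?mul1r// normr0 mul0r.
Qed.

End bounded_operators.

(** * Integrals of elementary processes *)

Section elementary_Ito.
Context (R : realType) (d : measure_display) (Omega : measurableType d)
  (P : probability Omega R).
Context (U V : completeNormedModType R)
  (dotU : {dot U for idfun}) (dotV : {dot V for idfun})
  (dotU_norm : forall x : U, dotU x x = `|x| ^+ 2) (sU : separable U)
  (dotV_norm : forall x : V, dotV x x = `|x| ^+ 2) (sV : separable V).
Context (F : R -> set (set Omega)) (hF : complete_filtration P F).
Context (Q : bounded_op U U) (hQ : covariance_operator dotU Q).
Context (N : set nat) (e : nat -> U) (kappa : nat -> R)
  (beta : nat -> R -> Omega -> R) (W : R -> Omega -> U)
  (hW : Q_wiener P dotU F Q N e kappa beta W).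
Local Notation lambda := (@lebesgue_measure R).

Lemma eigenvalue_ge0 n : N n -> 0 <= kappa n.
Proof.
move=> Nn; have := cov_nonneg hQ (e n).
by rewrite (qw_eigen hW)// dotZl (qw_orthonormal hW)// eqxx mulr1.
Qed.

Lemma trace_norm2_measurable (L : Omega -> U -> V) :
  (forall h, measurable_fun setT ((fun w => L w h) : Omega -> borel V)) ->
  measurable_fun setT (fun w => trace_norm2 N e kappa (L w)).
Proof.
move=> mL; apply: ge0_emeasurable_sum => [n w _ /set_mem Nn|n _].
  by rewrite lee_fin mulr_ge0 ?sqr_ge0// eigenvalue_ge0.
apply/measurable_EFinP; apply: measurable_funM => //.
by apply: measurable_funX; exact: measurable_borel_norm.
Qed.

Lemma trace_norm2_ge0 (L : U -> V) : (0 <= trace_norm2 N e kappa L)%E.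
Proof.
apply: nneseries_ge0 => n _ /set_mem Nn.
by rewrite lee_fin mulr_ge0 ?sqr_ge0// eigenvalue_ge0.
Qed.

(** The eigenvalues are the variances of the coordinates of [W 1 - W 0], so
    their sum is at most the second moment of that increment. *)
Lemma eigenvalue_sum m : \sum_(0 <= n < m | n \in N) kappa n <=
  l2 P (fun w => W 1 w - W 0 w) ^+ 2.
Proof.
have LW := L2_vectorB sU (qw_L2 hW ler01) (qw_L2 hW (lexx 0)).
have Lc n : L2r P (fun w => dotU (W 1 w - W 0 w) (e n)).
  apply: (L2r_le _ (L2rZ `|e n| (L2_vector_norm LW))) => [|w].
    by apply: measurable_dot => //; case: LW.
  by rewrite [leRHS]ger0_norm ?mulr_ge0// mulrC dot_le.
rewrite /l2 l2r_sq; last exact: L2_vector_norm.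
have kE n : N n -> kappa n = \int[P]_w (dotU (W 1 w - W 0 w) (e n) ^+ 2).
  move=> Nn; have := qw_covariance hW (e n) (e n) (lexx 0) ler01.
  rewrite (qw_eigen hW)// dotZl (qw_orthonormal hW)// eqxx mulr1 subr0 mul1r.
  by move=> kE; rewrite -[LHS]/(fine (kappa n)%:E) -kE.
rewrite -big_filter (eq_big_seq (fun n => \int[P]_w (dotU (W 1 w - W 0 w) (e n) ^+ 2))).
  rewrite -Rintegral_sum//; last by move=> n; exact: L2r_integrable_sq.
  apply: le_Rintegral => //.
  - by apply: Rintegrable_sum => // n; exact: L2r_integrable_sq.
  - by apply: L2r_integrable_sq; exact: L2_vector_norm.
  - by move=> w _; rewrite big_filter; exact: (bessel dotU_norm (qw_orthonormal hW)).
by move=> n; rewrite mem_filter => /andP[/set_mem nN _]; exact: kE.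
Qed.

Section fixed_time.
Context (t : R) (t0 : 0 <= t).

Let valid (a : elementary_term Omega U V) := [/\ 0 <= et_left a, et_left a <= et_right a &
    F (et_left a) (et_event a)].
Let term := {a : elementary_term Omega U V | valid a}.

Let delta (a : term) w := W (Num.min (et_right (sval a)) t) w -
  W (Num.min (et_left (sval a)) t) w.

Let coef (a : term) (h : U) w : R := \1_(et_event (sval a)) w * dotU (delta a w) h.

Let min0 (x : R) : 0 <= x -> 0 <= Num.min x t.
Proof. by move=> x0; rewrite le_min x0. Qed.

Let left0 (a : term) : 0 <= et_left (sval a). Proof. by case: a => a []. Qed.
Let left_right (a : term) : et_left (sval a) <= et_right (sval a).
Proof. by case: a => a []. Qed.
Let right0 (a : term) : 0 <= et_right (sval a).
Proof. exact: le_trans (left0 a) (left_right a). Qed.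
Let event_meas (a : term) : measurable (et_event (sval a)).
Proof. by have [l0 _ Fa] := svalP a; exact: (filtration_sub hF l0 Fa). Qed.

Let delta_L2 (a : term) : L2_vector P (delta a).
Proof. by apply: L2_vectorB => //; apply: (qw_L2 hW); exact: min0. Qed.

Let coef_L2 (a : term) h : L2r P (coef a h).
Proof.
apply: (L2r_le _ (L2rZ `|h| (L2_vector_norm (delta_L2 a)))) => [|w].
  apply: measurable_funM; first exact/measurable_indic/event_meas.
  by apply: measurable_dot => //; case: (delta_L2 a).
rewrite normrM normrM normr_id; apply: (@le_trans _ _ `|dotU (delta a w) h|).
  by rewrite indicE; case: (_ \in _); rewrite ?normr1 ?mul1r// normr0 mul0r.
by rewrite normr_id mulrC dot_le.
Qed.

Let itv (a : term) : set R := `]et_left (sval a), et_right (sval a)].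

(** The length of the overlap of two intervals, cut at [t], in the form in
    which it occurs in the correlation of the increments: this is where the
    time integral of the isometry comes from. *)
Lemma Rintegral_indic_mul (a b : term) :
  \int[lambda]_(r in `[0, t]) (\1_(itv a) r * \1_(itv b) r : R) =
  Num.max 0 (Num.min (Num.min (et_right (sval a)) t) (Num.min (et_right (sval b)) t) -
    Num.max (Num.min (et_left (sval a)) t) (Num.min (et_left (sval b)) t)).
Proof.
have := left0 a; have := left0 b; rewrite /itv.
move: (et_left (sval a)) (et_right (sval a)) (et_left (sval b)) (et_right (sval b)).
move=> la ra lb rb b0 a0.
pose u := Num.max (Num.min la t) (Num.min lb t).
pose v := Num.min (Num.min ra t) (Num.min rb t); rewrite -/u -/v.
rewrite (_ : (fun r => _) = \1_(`]la, ra] `&` `]lb, rb])); last by rewrite indicI.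
rewrite /Rintegral integral_indic//; last exact: measurableI.
rewrite (_ : _ `&` _ `&` _ = `]u, v]%classic).
  transitivity (fine (@lebesgue_measure R `]u, v]%classic)); first by [].
  rewrite lebesgue_measure_itv/= lte_fin.
  by case: ltP => uv; [rewrite -EFinD/= max_r// subr_ge0 ltW|rewrite max_l// subr_le0].
apply/seteqP; split=> x /=; rewrite /u /v !in_itv/= gt_max !le_min !gt_min.
  by move=> [[/andP[-> ->] /andP[-> ->]] /andP[_ ->]].
move=> /andP[/andP[h1 h2] /andP[/andP[-> xt] /andP[-> _]]].
have la_ : la < x by case/orP : h1 => //; rewrite ltNge xt.
have lb_ : lb < x by case/orP : h2 => //; rewrite ltNge xt.
by rewrite la_ lb_ xt (le_trans a0 (ltW la_)).
Qed.

Let min_le (a : term) : Num.min (et_left (sval a)) t <= Num.min (et_right (sval a)) t.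
Proof. by rewrite le_min !ge_min left_right lexx orbT. Qed.

(** A term whose interval starts after [t] has a vanishing increment. It is
    treated apart, since its event is known at its left end point but not
    necessarily at time [t], where the cut interval starts. *)
Let late_zero (a : term) : t <= et_left (sval a) ->
  Num.min (et_left (sval a)) t = t /\ Num.min (et_right (sval a)) t = t.
Proof. by move=> tl; split; apply: min_r => //; exact: le_trans (left_right a). Qed.

Let event_min (a : term) : et_left (sval a) <= t ->
  F (Num.min (et_left (sval a)) t) (et_event (sval a)).
Proof. by move=> lt; rewrite min_l//; case: a {lt} => a []. Qed.

(** The correlation of the coefficients of two terms, with the overlap of their
    intervals written as an integral over time. *)
Let coef_pair (a b : term) h k :
  \int[P]_w (coef a h w * coef b k w) =
  dotU (Q h) k * fine (P (et_event (sval a) `&` et_event (sval b))) *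
  \int[lambda]_(r in `[0, t]) (\1_(itv a) r * \1_(itv b) r : R).
Proof.
rewrite Rintegral_indic_mul.
have zero (c : term) x w : t <= et_left (sval c) -> coef c x w = 0.
  by move=> /late_zero[e1 e2]; rewrite /coef /delta e1 e2 subrr dot0l mulr0.
have RI0 (u : Omega -> R) : (forall w, u w = 0) -> \int[P]_w u w = 0.
  by move=> u0; rewrite /Rintegral integral0_eq// => w _; rewrite u0.
have [la|tl] := orP (le_total (et_left (sval a)) t); last first.
  rewrite RI0 => [|w]; last by rewrite zero// mul0r.
  have [-> ->] := late_zero tl; rewrite max_l ?mulr0// subr_le0.
  by rewrite ge_min !le_max lexx.
have [lb|tl] := orP (le_total (et_left (sval b)) t); last first.
  rewrite RI0 => [|w]; last by rewrite (zero b)// mulr0.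
  have [-> ->] := late_zero tl; rewrite max_l ?mulr0// subr_le0.
  by rewrite ge_min !le_max lexx !orbT.
exact: (increment_pair dotU_norm sU hF (cov_selfadjoint hQ) (qw_adapted hW)
  (qw_L2 hW) (qw_mean hW) (qw_indep hW) (qw_covariance hW) h k
  (min0 (left0 a)) (min_le a) (min0 (left0 b)) (min_le b) (event_min la) (event_min lb)).
Qed.

Let value (s : seq term) r w h : V := elementary_value (map sval s) r w h.

Let indic_L2 (a : term) (c : R) : L2r P (fun w => c * \1_(et_event (sval a)) w).
Proof.
apply: L2rZ; apply: (L2r_le _ (L2r_cst P 1)) => [|w]; first exact/measurable_indic/event_meas.
by rewrite indicE; case: (_ \in _); rewrite ?normr1// normr0.
Qed.

Let valueE s r h : value s r ^~ h = fun w => \sum_(a <- s)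
  ((\1_(itv a) r * \1_(et_event (sval a)) w : R) *: et_op (sval a) h).
Proof. by apply/funext => w; rewrite /value /elementary_value big_map. Qed.

Let value_L2 s r h : L2_vector P (value s r ^~ h).
Proof.
rewrite valueE; apply: L2_vector_sum => // a.
by apply: L2_vector_scaler; exact: indic_L2.
Qed.

Let value_sq s r h : l2 P (value s r ^~ h) ^+ 2 =
  \sum_(a <- s) \sum_(b <- s) (\1_(itv a) r * \1_(itv b) r) *
    (fine (P (et_event (sval a) `&` et_event (sval b))) *
     dotV (et_op (sval a) h) (et_op (sval b) h)).
Proof.
rewrite valueE (l2_sq_sum dotV_norm sV) => [|a]; last exact: indic_L2.
apply: eq_bigr => a _; apply: eq_bigr => b _; rewrite mulrA; congr (_ * _).
transitivity (\int[P]_w ((\1_(itv a) r * \1_(itv b) r) *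
   \1_(et_event (sval a) `&` et_event (sval b)) w)).
  by apply: eq_Rintegral => w _; rewrite indicI/=; ring.
have mAB := measurableI _ _ (event_meas a) (event_meas b).
rewrite RintegralZl//; last exact: integrable_indic.
by rewrite /Rintegral integral_indic// setIT.
Qed.

(** The elementary integral with [W] replaced by its first [m] coordinates along
    the eigenvectors of [Q]. *)
Let trunc (s : seq term) m w : V := \sum_(a <- s)
  (\1_(et_event (sval a)) w : R) *: et_op (sval a) (fourier dotU N e m (delta a w)).

Let ns m := [seq n <- index_iota 0 m | n \in N].

Let truncE s m : trunc s m = fun w => \sum_(i <- [seq (a, n) | a <- s, n <- ns m])
  coef i.1 (e i.2) w *: et_op (sval i.1) (e i.2).
Proof.
apply/funext => w; rewrite big_allpairs; apply: eq_bigr => a _.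
rewrite /ns big_filter /fourier linear_sum scaler_sumr; apply: eq_bigr => n _.
by rewrite linearZ scalerA.
Qed.

(** The isometry, exact for the truncated Wiener process: since the [e n] are
    orthonormal eigenvectors, the correlation of the coefficients along [e n]
    and [e k] vanishes for [n <> k], and the double sum over pairs of a term
    and a coordinate collapses to a single sum over coordinates. *)
Let trunc_sq s m : l2 P (trunc s m) ^+ 2 =
  \int[lambda]_(r in `[0, t]) \sum_(n <- ns m) kappa n * l2 P (value s r ^~ (e n)) ^+ 2.
Proof.
rewrite truncE (l2_sq_sum dotV_norm sV) => [|i]; last exact: coef_L2.
pose T a b n : R -> R := fun r => (\1_(itv a) r * \1_(itv b) r) * (kappa n *
    (fine (P (et_event (sval a) `&` et_event (sval b))) *
     dotV (et_op (sval a) (e n)) (et_op (sval b) (e n)))).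
have i2 a b : lambda.-integrable `[0, t] (EFin \o (fun r => \1_(itv a) r * \1_(itv b) r)).
  rewrite (_ : (fun r => _) = \1_(itv a `&` itv b)); last by rewrite indicI.
  by apply: indic_integrable; apply: measurableI; exact: measurable_itv.
have iT a b n : lambda.-integrable `[0, t] (EFin \o T a b n).
  by apply: Rintegrable_scaler => //; exact: i2.
transitivity (\int[lambda]_(r in `[0, t])
    \sum_(n <- ns m) \sum_(a <- s) \sum_(b <- s) T a b n r); last first.
  apply: eq_Rintegral => r _; apply: eq_bigr => n _.
  rewrite value_sq mulr_sumr; apply: eq_bigr => a _.
  by rewrite mulr_sumr; apply: eq_bigr => b _; rewrite /T mulrCA.
rewrite Rintegral_sum//; last first.
  by move=> n; apply: Rintegrable_sum => // a; exact: Rintegrable_sum.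
rewrite big_allpairs exchange_big; apply: eq_big_seq => n nn /=.
have Nn : N n by move: nn; rewrite mem_filter => /andP[/set_mem].
rewrite Rintegral_sum//; last by move=> a; exact: Rintegrable_sum.
apply: eq_bigr => a _; rewrite Rintegral_sum// big_allpairs/=.
apply: eq_bigr => b _.
rewrite (bigD1_seq n)//=; last by rewrite filter_uniq// iota_uniq.
rewrite big_seq_cond big1 ?addr0 => [|k /andP[kn nk]]; last first.
  have Nk : N k by move: kn; rewrite mem_filter => /andP[/set_mem].
  rewrite coef_pair (qw_eigen hW)// dotZl (qw_orthonormal hW)// eq_sym (negbTE nk).
  by rewrite mulr0 !mul0r.
rewrite coef_pair (qw_eigen hW)// dotZl (qw_orthonormal hW)// eqxx mulr1.
by rewrite RintegralZr//; ring.
Qed.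

Let integral_L2 (s : seq term) : L2_vector P (elementary_integral W t (map sval s)).
Proof.
rewrite (_ : elementary_integral _ _ _ = fun w => \sum_(a <- s)
    (\1_(et_event (sval a)) w : R) *: et_op (sval a) (delta a w)); last first.
  by apply/funext => w; rewrite /elementary_integral big_map.
apply: L2_vector_sum => // a; apply: L2_vector_indic; first exact: event_meas.
exact: L2_vector_bop.
Qed.

(** Only almost surely, since the expansion of [W] at a given time holds outside
    a null set; finitely many times occur. *)
Let trunc_cvg (s : seq term) : {ae P, forall w, trunc s m w @[m --> \oo] -->
  elementary_integral W t (map sval s) w}.
Proof.
have exp u : 0 <= u -> {ae P, forall w, fourier dotU N e m (W u w) @[m --> \oo] --> W u w}.
  move=> u0; apply: filterS (qw_expansion hW u0) => w.
  exact: (fourier_expansion dotU_norm (qw_orthonormal hW)).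
rewrite /trunc /elementary_integral; elim: s => [|a s IH].
  apply: aeW => w; rewrite /= big_nil; under eq_fun do rewrite big_nil.
  exact: cvg_cst.
have h1 := exp _ (min0 (right0 a)); have h2 := exp _ (min0 (left0 a)).
move: h1 h2 IH; apply: filterS3 => w c1 c2 cs.
rewrite /= big_cons; under eq_fun do rewrite big_cons.
apply: cvgD => //; apply: cvgZr.
have cd : fourier dotU N e m (delta a w) @[m --> \oo] --> delta a w.
  rewrite (_ : (fun m => _) = fun m => fourier dotU N e m (W (Num.min (et_right (sval a)) t) w)
     - fourier dotU N e m (W (Num.min (et_left (sval a)) t) w)).
    exact: (cvgB c1 c2).
  by apply/funext => m; rewrite fourierB.
apply: (@cvg_comp _ _ _ (fun m => fourier dotU N e m (delta a w)) (et_op (sval a)) \oo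
  (nbhs (delta a w))) => //.
exact: (@bop_continuous _ _ _ (et_op (sval a)) (delta a w)).
Qed.

Lemma elementary_integral_L2 (s : seq (elementary_term Omega U V)) :
  elementary F s -> L2_vector P (elementary_integral W t s).
Proof. by move=> /Forall_sig[s' ->]; exact: integral_L2. Qed.

Lemma elementary_value_measurable (s : seq (elementary_term Omega U V)) r h :
  elementary F s ->
  measurable_fun setT ((fun w => elementary_value s r w h) : Omega -> borel V).
Proof. by move=> /Forall_sig[s' ->]; case: (value_L2 s' r h). Qed.

(** Ito's isometry, as an upper bound: the coordinates of [W] along [e] give
    the equality for truncated integrands, and Fatou's lemma removes the
    truncation. *)
Lemma elementary_integral_le (s : seq (elementary_term Omega U V)) (G : R -> \bar R) :
  elementary F s -> measurable_fun `[0, t] G ->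
  (forall r, 0 <= r <= t ->
    (\int[P]_w trace_norm2 N e kappa (elementary_value s r w) <= G r)%E) ->
  ((l2 P (elementary_integral W t s) ^+ 2)%:E <= \int[lambda]_(r in `[0%R, t]) G r)%E.
Proof.
move=> /Forall_sig[s' ->] mG sG; have LI := integral_L2 s'.
have Lt m : L2_vector P (trunc s' m).
  rewrite truncE; apply: L2_vector_sum => // i.
  by apply: L2_vector_scaler; exact: coef_L2.
rewrite -mean_squareE//.
apply: (fatou_mean_square (X := trunc s')).
- by move=> m; case: (Lt m).
- by case: LI.
- exact: trunc_cvg.
move=> m; rewrite mean_squareE// trunc_sq.
have ivn n : lambda.-integrable `[0, t]
    (EFin \o (fun r => kappa n * l2 P (value s' r ^~ (e n)) ^+ 2)).
  apply: Rintegrable_scale => //.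
  rewrite (_ : (fun r => _) = fun r => \sum_(a <- s') \sum_(b <- s') (\1_(itv a) r * \1_(itv b) r) *
    (fine (P (et_event (sval a) `&` et_event (sval b))) *
     dotV (et_op (sval a) (e n)) (et_op (sval b) (e n)))); last first.
    by apply/funext => r; exact: value_sq.
  apply: Rintegrable_sum => // a; apply: Rintegrable_sum => // b.
  apply: Rintegrable_scaler => //.
  rewrite (_ : (fun r => _) = \1_(itv a `&` itv b)); last by rewrite indicI.
  by apply: indic_integrable; apply: measurableI; exact: measurable_itv.
have is_ : lambda.-integrable `[0, t] (EFin \o (fun r =>
    \sum_(n <- ns m) kappa n * l2 P (value s' r ^~ (e n)) ^+ 2)).
  exact: Rintegrable_sum.
rewrite {1}/Rintegral fineK; last exact: integrable_fin_num.
apply: ge0_le_integral => //.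
- move=> r _; rewrite lee_fin big_seq sumr_ge0// => n.
  rewrite mem_filter => /andP[/set_mem Nn _].
  by rewrite mulr_ge0 ?sqr_ge0// eigenvalue_ge0.
- by case/integrableP : is_.
move=> r; rewrite /= in_itv/= => rt; apply: le_trans (sG r rt).
have isq n : P.-integrable setT (EFin \o (fun w => `|value s' r w (e n)| ^+ 2)).
  by apply: L2r_integrable_sq; exact: (L2_vector_norm (value_L2 s' r (e n))).
have -> : \sum_(n <- ns m) kappa n * l2 P (value s' r ^~ (e n)) ^+ 2 =
    \int[P]_w \sum_(n <- ns m) kappa n * `|value s' r w (e n)| ^+ 2.
  rewrite Rintegral_sum// => [|n]; last exact: Rintegrable_scale.
  apply: eq_bigr => n _; rewrite RintegralZl//; congr (_ * _).
  by rewrite /l2 l2r_sq//; exact: (L2_vector_norm (value_L2 s' r (e n))).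
have iS : P.-integrable setT (EFin \o (fun w =>
    \sum_(n <- ns m) kappa n * `|value s' r w (e n)| ^+ 2)).
  by apply: Rintegrable_sum => // n; exact: Rintegrable_scale.
rewrite /Rintegral fineK; last exact: integrable_fin_num.
have S0 w : 0 <= \sum_(n <- ns m) kappa n * `|value s' r w (e n)| ^+ 2.
  rewrite big_seq sumr_ge0// => n; rewrite mem_filter => /andP[/set_mem Nn _].
  by rewrite mulr_ge0 ?sqr_ge0// eigenvalue_ge0.
apply: ge0_le_integral => //.
- by move=> w _; rewrite lee_fin.
- by case/integrableP : iS.
- by apply: trace_norm2_measurable => h; case: (value_L2 s' r h).
- move=> w _; rewrite /ns big_filter -sumEFin; apply: nneseries_lim_ge => n _ /set_mem Nn.
  by rewrite lee_fin mulr_ge0 ?sqr_ge0// eigenvalue_ge0.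
Qed.

End fixed_time.
End elementary_Ito.

(** * Second moment of an Ito integral *)

Section Ito_bound.
Context (R : realType) (d : measure_display) (Omega : measurableType d)
  (P : probability Omega R).
Context (U V : completeNormedModType R)
  (dotU : {dot U for idfun}) (dotV : {dot V for idfun})
  (dotU_norm : forall x : U, dotU x x = `|x| ^+ 2) (sU : separable U)
  (dotV_norm : forall x : V, dotV x x = `|x| ^+ 2) (sV : separable V).
Context (F : R -> set (set Omega)) (hF : complete_filtration P F).
Context (Q : bounded_op U U) (hQ : covariance_operator dotU Q).
Context (N : set nat) (e : nat -> U) (kappa : nat -> R)
  (beta : nat -> R -> Omega -> R) (W : R -> Omega -> U)
  (hW : Q_wiener P dotU F Q N e kappa beta W).
Local Notation lambda := (@lebesgue_measure R).
Local Notation tr2 := (trace_norm2 N e kappa).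

(** The crude triangle inequality [|a|^2 <= 2 |a - b|^2 + 2 |b|^2], summed over
    the eigenvectors; the factor 2 only affects constants. *)
Lemma trace_norm2_add (L L' : U -> V) :
  (tr2 L <= 2%:E * (tr2 (fun h => (L h - L' h)%R) + tr2 L'))%E.
Proof.
have kappa0 n : n \in N -> 0 <= kappa n by move=> /set_mem; exact: (eigenvalue_ge0 hQ hW).
rewrite /trace_norm2 -nneseriesD; last 2 first.
- by move=> n _ nN; rewrite lee_fin mulr_ge0 ?sqr_ge0 ?kappa0.
- by move=> n _ nN; rewrite lee_fin mulr_ge0 ?sqr_ge0 ?kappa0.
rewrite -nneseriesZl; last first.
  by move=> n nN; rewrite adde_ge0// lee_fin mulr_ge0 ?sqr_ge0 ?kappa0.
apply: lee_nneseries => [n _ nN|n nN].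
  by rewrite lee_fin mulr_ge0 ?sqr_ge0 ?kappa0.
rewrite -EFinD -EFinM lee_fin.
rewrite -mulrDr [leRHS]mulrCA ler_wpM2l ?kappa0//.
have : `|L (e n)| <= `|L (e n) - L' (e n)| + `|L' (e n)|.
  by apply: le_trans (ler_normD _ _); rewrite subrK.
have := normr_ge0 (L (e n)).
move: `|L (e n)| `|L (e n) - L' (e n)| `|L' (e n)| => a b c a0 abc.
have : a ^+ 2 <= (b + c) ^+ 2 by rewrite lerXn2r// nnegrE// (le_trans a0).
by have := sqr_ge0 (b - c); nra.
Qed.

(** The trace of [Q] is dominated by the second moment of [W 1 - W 0], which
    gives a bound for the Hilbert-Schmidt norm by the operator norm. *)
Lemma trace_norm2_opnorm (L : U -> V) (c : R) : (forall h, `|L h| <= c * `|h|) ->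
  (tr2 L <= (l2 P (fun w => W 1 w - W 0 w) ^+ 2 * c ^+ 2)%:E)%E.
Proof.
move=> Lc; have kappa0 n : n \in N -> 0 <= kappa n.
  by move=> /set_mem; exact: (eigenvalue_ge0 hQ hW).
apply: lime_le.
  by apply: is_cvg_nneseries => n _ nN; rewrite lee_fin mulr_ge0 ?sqr_ge0 ?kappa0.
apply: nearW => m; rewrite sumEFin lee_fin.
apply: le_trans (ler_wpM2r (sqr_ge0 c) (eigenvalue_sum dotU_norm sU hW m)).
rewrite mulr_suml; apply: ler_sum => n nN.
rewrite ler_wpM2l ?kappa0// lerXn2r ?nnegrE//.
  have := Lc (e n); have -> : `|e n| = 1.
    apply/eqP; rewrite -sqrp_eq1// -dotU_norm.
    by rewrite (qw_orthonormal hW) ?eqxx//; exact/set_mem.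
  by rewrite mulr1; exact: le_trans.
by have := Lc (e n); rewrite (_ : `|e n| = 1) ?mulr1//;
  apply/eqP; rewrite -sqrp_eq1// -dotU_norm (qw_orthonormal hW) ?eqxx//; exact/set_mem.
Qed.

(** The isometry inequality for the approximating elementary processes, whose
    squared norm is at most twice the squared error plus twice that of [Phi];
    the error integrates to zero in the limit. *)
Lemma ito_integral_le (t : R) (Phi : R -> Omega -> U -> V) (Y : Omega -> V)
  (G : R -> R) : 0 <= t -> ito_integral P F N e kappa W t Phi Y ->
  lambda.-integrable `[0, t] (EFin \o G) ->
  (forall r, 0 <= r <= t -> (\int[P]_w tr2 (Phi r w) <= (G r)%:E)%E) ->
  l2 P Y ^+ 2 <= 2 * \int[lambda]_(r in `[0, t]) G r.
Proof.
move=> t0 [mPhi LY [s [Es ms s0 sY]]] iG PG.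
set err := fun n r => (\int[P]_w tr2 (fun h => (elementary_value (s n) r w h - Phi r w h)%R))%E.
pose I n := (\int[lambda]_(r in `[0%R, t]) err n r)%E.
have /fine_cvgP[finI I0] : I n @[n --> \oo] --> 0%E by exact: s0.
have err0 n r : (0 <= err n r)%E.
  by apply: integral_ge0 => w _; exact: (trace_norm2_ge0 hQ hW).
have G0 r : 0 <= r <= t -> 0 <= G r.
  move=> rt; rewrite -lee_fin; apply: le_trans (PG r rt).
  by apply: integral_ge0 => w _; exact: (trace_norm2_ge0 hQ hW).
have IG0 : 0 <= \int[lambda]_(r in `[0, t]) G r.
  by apply: Rintegral_ge0 => r /=; rewrite in_itv/=; exact: G0.
have LI n : L2_vector P (elementary_integral W t (s n)).
  by apply: elementary_integral_L2; try eassumption; exact: Es.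
have mG : measurable_fun `[0, t] (fun r => (G r)%:E) by case/integrableP : iG.
have key n : I n \is a fin_num ->
    l2 P (elementary_integral W t (s n)) ^+ 2 <=
      2 * (fine (I n) + \int[lambda]_(r in `[0, t]) G r).
  move=> finIn; rewrite -lee_fin.
  have -> : (2 * (fine (I n) + \int[lambda]_(r in `[0, t]) G r))%:E =
      (2%:E * (I n + (\int[lambda]_(r in `[0, t]) G r)%:E))%E.
    by rewrite -{2}(fineK finIn).
  have -> : ((\int[lambda]_(r in `[0, t]) G r)%:E = \int[lambda]_(r in `[0%R, t]) (G r)%:E)%E.
    by rewrite /Rintegral fineK//; exact: integrable_fin_num.
  have G0' r : `[0, t]%classic r -> (0%R <= (G r)%:E)%E.
    by rewrite /= in_itv/= lee_fin; exact: G0.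
  rewrite /I -ge0_integralD//; last exact: ms.
  rewrite -ge0_integralZl//; last 2 first.
  - by apply: emeasurable_funD => //; exact: ms.
  - by move=> r rt; rewrite adde_ge0// G0'.
  apply: elementary_integral_le; try eassumption; first exact: Es.
    by apply: emeasurable_funM => //; apply: emeasurable_funD => //; exact: ms.
  move=> r rt.
  have mE h : measurable_fun setT ((fun w => elementary_value (s n) r w h) : Omega -> borel V).
    by apply: elementary_value_measurable; try eassumption; exact: Es.
  have mP h : measurable_fun setT ((fun w => Phi r w h) : Omega -> borel V).
    move=> _ B mB; rewrite setTI.
    have /andP[r0 _] := rt; exact: (filtration_sub hF r0 (mPhi r h rt B mB)).
  have mtr (L : Omega -> U -> V) :
      (forall h, measurable_fun setT ((fun w => L w h) : Omega -> borel V)) ->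
      measurable_fun setT (fun w => tr2 (L w)).
    exact: (trace_norm2_measurable hQ hW).
  have mD : measurable_fun setT (fun w => tr2 (fun h => elementary_value (s n) r w h - Phi r w h)).
    by apply: mtr => h; exact: measurable_borelB.
  apply: (@le_trans _ _ (\int[P]_w (2%:E *
      (tr2 (fun h => (elementary_value (s n) r w h - Phi r w h)%R) + tr2 (Phi r w))))%E).
    apply: ge0_le_integral => //.
    - by move=> w _; exact: (trace_norm2_ge0 hQ hW).
    - exact: mtr.
    - by apply: emeasurable_funM => //; apply: emeasurable_funD => //; exact: mtr.
    - by move=> w _; exact: trace_norm2_add.
  rewrite ge0_integralZl//; last 2 first.
  - by apply: emeasurable_funD => //; exact: mtr.
  - by move=> w _; rewrite adde_ge0// (trace_norm2_ge0 hQ hW).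
  rewrite lee_pmul2l//; rewrite ge0_integralD//; last 3 first.
  - by move=> w _; exact: (trace_norm2_ge0 hQ hW).
  - by move=> w _; exact: (trace_norm2_ge0 hQ hW).
  - exact: mtr.
  by apply: leeD => //; exact: PG.
have J0 : 0 <= 2 * \int[lambda]_(r in `[0, t]) G r by rewrite mulr_ge0.
rewrite -[leRHS]sqr_sqrtr// lerXn2r ?nnegrE ?l2_ge0 ?sqrtr_ge0//.
apply: (@l2_limit _ _ _ _ _ sV (fun n => elementary_integral W t (s n)) Y
  (fun n => Num.sqrt (2 * (fine (I n) + \int[lambda]_(r in `[0, t]) G r)))) => //.
- by apply: mean_square_cvg0 => // n; exact: L2_vectorB.
- move: finI; apply: filterS => n finIn.
  rewrite -[leLHS]ger0_norm ?l2_ge0// -sqrtr_sqr ler_wsqrtr// key//.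
- have c1 : 2 * (fine (I n) + \int[lambda]_(r in `[0, t]) G r) @[n --> \oo] -->
      2 * (0 + \int[lambda]_(r in `[0, t]) G r).
    exact: (cvgM (cvg_cst _) (cvgD I0 (cvg_cst _))).
  rewrite add0r in c1.
  exact: (cvg_comp _ _ c1 (@sqrt_continuous R _)).
Qed.

End Ito_bound.

(** * Uniform convergence of the semigroups *)

Section semigroup_gap.
Context (R : realType) (H : normedModType R).
Implicit Types S : R -> bounded_op H H.

(** The convergence of the semigroups enters only through this quantity, a
    seminorm in [x] that tends to 0 when [S1] tends to [S2] uniformly on
    [0, T]. It is Lipschitz in [x], hence Borel, by the bounds on the operator
    norms alone; so it can be evaluated at random vectors. *)
Definition semigroup_gap S1 S2 (T : R) (x : H) : R :=
  sup [set `|S1 t x - S2 t x| | t in `[0, T]].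

Context (S1 S2 : R -> bounded_op H H) (T B : R) (T0 : 0 <= T).
Context (B1 : forall t, 0 <= t <= T -> opnorm (S1 t) <= B)
  (B2 : forall t, 0 <= t <= T -> opnorm (S2 t) <= B).
Local Notation gap := (semigroup_gap S1 S2 T).

Let term_le t x : 0 <= t <= T -> `|S1 t x - S2 t x| <= 2 * B * `|x|.
Proof.
move=> tT; apply: le_trans (ler_normB _ _) _.
rewrite -mulrA mulr_natl mulr2n; apply: lerD.
  by apply: le_trans (opnorm_le _ _) _; rewrite ler_wpM2r// B1.
by apply: le_trans (opnorm_le _ _) _; rewrite ler_wpM2r// B2.
Qed.

Let values0 x : [set `|S1 t x - S2 t x| | t in `[0, T]] !=set0.
Proof. by exists `|S1 0 x - S2 0 x|, 0 => //=; rewrite in_itv/= lexx. Qed.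

Lemma gap_ub t x : 0 <= t <= T -> `|S1 t x - S2 t x| <= gap x.
Proof.
move=> tT; apply: ub_le_sup; last by exists t => //=; rewrite in_itv.
by exists (2 * B * `|x|) => _ [s /= sT <-]; apply: term_le; rewrite in_itv in sT.
Qed.

Lemma gap_le x (c : R) : (forall t, 0 <= t <= T -> `|S1 t x - S2 t x| <= c) ->
  gap x <= c.
Proof.
move=> xc; apply: ge_sup; first exact: values0.
by move=> _ [s /= sT <-]; apply: xc; rewrite in_itv in sT.
Qed.

Lemma gap_ge0 x : 0 <= gap x.
Proof. by apply: le_trans (gap_ub (t := 0) x _); rewrite ?normr_ge0 ?lexx. Qed.

Lemma gap_bound x : gap x <= 2 * B * `|x|.
Proof. by apply: gap_le => t; exact: term_le. Qed.

Lemma gap_triangle x y : gap x <= gap y + 2 * B * `|x - y|.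
Proof.
apply: gap_le => t tT.
apply: le_trans (lerD (gap_ub y tT) (term_le (x - y) tT)).
apply: le_trans (ler_normD _ _).
have -> : S1 t (x - y) = S1 t x - S1 t y := linearB (S1 t) x y.
have -> : S2 t (x - y) = S2 t x - S2 t y := linearB (S2 t) x y.
by rewrite opprB addrCA !subrKA.
Qed.

Let B0 : 0 <= B.
Proof. by apply: le_trans (opnorm_ge0 _) (B1 (t := 0) _); rewrite lexx. Qed.

Lemma gap_continuous : continuous gap.
Proof.
move=> x; apply/cvgrPdist_le => eps eps0.
have c0 : 0 < 2 * B + 1 by rewrite ltr_wpDl// mulr_ge0.
near=> y.
have h : `|x - y| <= eps / (2 * B + 1).
  near: y; apply: cvgr_dist_le => //; exact: divr_gt0.
have h2 : 2 * B * `|x - y| <= eps.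
  apply: (@le_trans _ _ ((2 * B + 1) * `|x - y|)).
    by rewrite ler_wpM2r// lerDl.
  by rewrite mulrC -ler_pdivlMr.
rewrite ler_norml; apply/andP; split.
  have := gap_triangle y x; rewrite distrC => h1.
  by rewrite lerNl opprB lerBlDl (le_trans h1)// lerD2l.
by rewrite lerBlDl (le_trans (gap_triangle x y))// lerD2l.
Unshelve. all: by end_near. Qed.

Context (d : measure_display) (Omega : measurableType d) (P : probability Omega R).

Lemma gap_L2 (X : Omega -> H) : L2_vector P X -> L2r P (fun w => gap (X w)).
Proof.
move=> LX; apply: (L2r_le _ (L2rZ (2 * B) (L2_vector_norm LX))) => [|w].
  by apply: (measurableT_comp (continuous_borel_real gap_continuous)); case: LX.
by rewrite !ger0_norm ?gap_ge0 ?mulr_ge0 ?gap_bound.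
Qed.

Lemma l2_gap_bound (X : Omega -> H) : L2_vector P X ->
  l2r P (fun w => gap (X w)) <= 2 * B * l2 P X.
Proof.
move=> LX; have LX' := L2_vector_norm LX.
rewrite -[2 * B]ger0_norm ?mulr_ge0// -l2rZ//; apply: l2r_le.
- exact: gap_L2.
- exact: L2rZ.
by apply: aeW => w; rewrite !ger0_norm ?gap_ge0 ?mulr_ge0 ?gap_bound.
Qed.

Lemma l2_gap_triangle (X Y : Omega -> H) : separable H -> L2_vector P X ->
  L2_vector P Y -> l2r P (fun w => gap (X w)) <=
  l2r P (fun w => gap (Y w)) + 2 * B * l2 P (fun w => X w - Y w).
Proof.
move=> sH LX LY; have LXY := L2_vector_norm (L2_vectorB sH LX LY).
rewrite -[2 * B]ger0_norm ?mulr_ge0// -l2rZ//.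
apply: le_trans (l2rD (gap_L2 LY) (L2rZ _ LXY)); apply: l2r_le.
- exact: gap_L2.
- by apply: L2rD; [exact: gap_L2|exact: L2rZ].
apply: aeW => w; rewrite !ger0_norm ?addr_ge0 ?gap_ge0 ?mulr_ge0//.
exact: gap_triangle.
Qed.

End semigroup_gap.

Section uniform_convergence.
Context (R : realType) (H : normedModType R) (sH : separable H).
Context (S : R -> bounded_op H H) (Seps : R -> R -> bounded_op H H) (T B : R)
  (T0 : 0 <= T).
Context (BS : forall t, 0 <= t <= T -> opnorm (S t) <= B)
  (BSeps : forall eps t, 0 < eps -> 0 <= t <= T -> opnorm (Seps eps t) <= B).
Context (hS : forall (x : H) (delta : R), 0 < delta -> \forall eps \near 0^'+,
  forall t, 0 <= t <= T -> `|Seps eps t x - S t x| < delta).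
Context (d : measure_display) (Omega : measurableType d) (P : probability Omega R).
Local Notation gap eps := (semigroup_gap (Seps eps) S T).

Let B0 : 0 <= B.
Proof. by apply: le_trans (opnorm_ge0 _) (BS (t := 0) _); rewrite lexx. Qed.

Lemma gap_cvg x : gap eps x @[eps --> 0^'+] --> 0.
Proof.
apply/cvgrPdist_le => delta delta0.
near=> eps.
have eps0 : 0 < eps by near: eps; exact: nbhs_right_gt.
rewrite sub0r normrN ger0_norm; last first.
  by apply: (@gap_ge0 _ _ (Seps eps) S T B) => // t; exact: BSeps.
apply: gap_le => // t tT; apply: ltW; move: t tT; near: eps.
exact: hS.
Unshelve. all: by end_near. Qed.

(** Dominated convergence, the dominating function being [2 B |X|]. *)
Lemma l2_gap_cvg (X : Omega -> H) : L2_vector P X ->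
  l2r P (fun w => gap eps (X w)) @[eps --> 0^'+] --> 0.
Proof.
move=> LX; apply/cvg_at_rightP => u [u0 u_cvg].
have Lg n : L2r P (fun w => gap (u n) (X w)).
  by apply: (@gap_L2 _ _ (Seps (u n)) S T B) => // t; exact: BSeps.
have LX2 := L2rZ (2 * B) (L2_vector_norm LX).
have [] // := @dominated_convergence _ _ _ P setT measurableT
  (fun n w => (gap (u n) (X w) ^+ 2)%:E) (cst 0%E)
  (fun w => ((2 * B * `|X w|) ^+ 2)%:E).
- by move=> n; have /integrableP[] := L2r_integrable_sq (Lg n).
- apply: aeW => w _; apply: cvg_EFin; first exact: nearW.
  have c1 : gap (u n) (X w) @[n --> \oo] --> 0.
    by have /cvg_at_rightP := gap_cvg (X w); apply.
  rewrite -[X in _ --> X](mulr0 0).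
  by under eq_fun do rewrite /= expr2; exact: cvgM.
- exact: L2r_integrable_sq.
- apply: aeW => w n _; rewrite /= ger0_norm ?sqr_ge0// lee_fin.
  have g0 : 0 <= gap (u n) (X w).
    by apply: (@gap_ge0 _ _ (Seps (u n)) S T B) => // t; exact: BSeps.
  rewrite lerXn2r ?nnegrE ?mulr_ge0//.
  by apply: gap_bound => // t; exact: BSeps.
move=> _ _; rewrite integral0 => /= c.
have c1 : fine (\int[P]_w (gap (u n) (X w) ^+ 2)%:E)%E @[n --> \oo] --> (0 : R).
  exact: fine_cvg.
have s0 := @sqrt_continuous R 0; rewrite /continuous_at sqrtr0 in s0.
exact: (cvg_comp _ _ c1 s0).
Qed.

(** The seminorms [X |-> l2r P (gap eps X)] are Lipschitz with the common
    constant [2 B], so that their pointwise convergence is uniform along the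
    compact curve [s |-> Y s] of [L_2]. *)
Lemma l2_gap_uniform (Y : R -> Omega -> H) :
  (forall s, 0 <= s <= T -> L2_vector P (Y s)) ->
  (forall s delta, 0 <= s <= T -> 0 < delta ->
    \forall r \near s, 0 <= r <= T -> l2 P (fun w => Y r w - Y s w) < delta) ->
  forall delta, 0 < delta -> \forall eps \near 0^'+,
    forall s, 0 <= s <= T -> l2r P (fun w => gap eps (Y s w)) < delta.
Proof.
move=> LY cY delta delta0.
have /compact_near_coveringP/near_covering_withinP := @segment_compact R 0 T.
move=> /(_ R 0^'+ (fun eps s => l2r P (fun w => gap eps (Y s w)) < delta) _).
have step s : `[0, T]%classic s -> \forall s' \near s & eps \near 0^'+,
    `[0, T]%classic s' -> l2r P (fun w => gap eps (Y s' w)) < delta.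
  rewrite /= in_itv/= => sT.
  have d2 : 0 < delta / 2 by rewrite divr_gt0.
  have d3 : 0 < delta / 2 / (2 * B + 1).
    by rewrite divr_gt0// ltr_wpDl// mulr_ge0.
  (* half of [delta] for the convergence at [s], half for moving from [s] to
     nearby times *)
  have h1 : \forall eps \near 0^'+, 0 < eps /\ l2r P (fun w => gap eps (Y s w)) < delta / 2.
    have /cvgrPdist_lt/(_ _ d2) := l2_gap_cvg (LY s sT).
    move: (nbhs_right_gt (0 : R)); apply: filterS2 => eps e0.
    by rewrite sub0r normrN ger0_norm ?l2r_ge0.
  exists ([set r | 0 <= r <= T -> l2 P (fun w => Y r w - Y s w) < delta / 2 / (2 * B + 1)],
    [set eps | 0 < eps /\ l2r P (fun w => gap eps (Y s w)) < delta / 2]).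
    by split => //=; exact: cY.
  move=> [r eps] [/= rs [eps0 es]]; rewrite in_itv/= => rT.
  apply: le_lt_trans (@l2_gap_triangle _ _ (Seps eps) S T B _ _ _ _ _ P (Y r) (Y s) _ _ _) _ => //.
  - by move=> t; exact: BSeps.
  - exact: LY.
  - exact: LY.
  rewrite [ltRHS]splitr ltrD//.
  apply: (@le_lt_trans _ _ ((2 * B + 1) * l2 P (fun w => Y r w - Y s w))).
    by rewrite ler_wpM2r ?l2_ge0// lerDl.
  by rewrite mulrC -ltr_pdivlMr ?rs// ltr_wpDl// mulr_ge0.
move=> /(_ step); apply: filterS => eps h s sT; apply: h.
by rewrite /= in_itv.
Qed.

(** Compactness again: a bound holds near each time, and finitely many of these
    neighbourhoods cover [0, T]. *)
Lemma l2_curve_bounded (Y : R -> Omega -> H) :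
  (forall s, 0 <= s <= T -> L2_vector P (Y s)) ->
  (forall s delta, 0 <= s <= T -> 0 < delta ->
    \forall r \near s, 0 <= r <= T -> l2 P (fun w => Y r w - Y s w) < delta) ->
  exists2 C, 0 <= C & forall s, 0 <= s <= T -> l2 P (Y s) <= C.
Proof.
move=> LY cY.
have /compact_near_coveringP/near_covering_withinP := @segment_compact R 0 T.
move=> /(_ R +oo (fun C s => l2 P (Y s) <= C) _).
have step s : `[0, T]%classic s -> \forall s' \near s & C \near +oo,
    `[0, T]%classic s' -> l2 P (Y s') <= C.
  rewrite /= in_itv/= => sT.
  exists ([set r | 0 <= r <= T -> l2 P (fun w => Y r w - Y s w) < 1],
    [set C | l2 P (Y s) + 1 <= C]).
    split => /=; first exact: cY.
    by apply: nbhs_pinfty_ge; exact: num_real.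
  move=> [r C] [/= rs sC]; rewrite in_itv/= => rT; apply: le_trans sC.
  have LB := L2_vectorB sH (LY r rT) (LY s sT).
  have -> : l2 P (Y r) = l2 P (fun w => Y s w + (Y r w - Y s w)).
    by congr l2; apply/funext => w; rewrite addrC subrK.
  by apply: le_trans (l2D sH (LY s sT) LB) _; rewrite lerD2l ltW// rs.
move=> /(_ step) h.
have [M [_ hM]] := h.
exists (`|M| + 1); first by rewrite addr_ge0.
move=> s sT; apply: hM; last by rewrite /= in_itv.
by rewrite (le_lt_trans (ler_norm M))// ltrDl.
Qed.

End uniform_convergence.

(** * Gronwall estimate and monotone moduli *)

Section real_analysis.
Context (R : realType).
Local Notation lambda := (@lebesgue_measure R).

Lemma continuous_integrable (t : R) (f : R -> R) : continuous f ->
  lambda.-integrable `[0, t] (EFin \o f).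
Proof.
move=> cf; apply: continuous_compact_integrable; first exact: segment_compact.
exact: continuous_subspaceT.
Qed.

Lemma expR_scale_continuous (l : R) : continuous (fun r => expR (l * r)).
Proof.
move=> r; apply: continuous_comp; last exact: continuous_expR.
exact: mulrl_continuous.
Qed.

Lemma is_derive_expR_scale (l x : R) : 0 < l ->
  is_derive x 1 (fun r => expR (l * r) / l) (expR (l * x)).
Proof.
move=> l0.
have dg : is_derive x 1 (fun r : R => l * r) l.
  have := @is_deriveZ R R R id l x 1 1 _.
  by rewrite /GRing.scale /= mulr1; apply; exact: is_derive_id.
have dc := @is_derive1_comp R expR (fun r => l * r) x _ _ (is_derive_expR _) dg.
have := @is_deriveZ R R R _ l^-1 x 1 _ dc.
rewrite /GRing.scale/= mulrCA mulVf ?mulr1 ?gt_eqF// => h.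
rewrite (_ : (fun r => _) = l^-1 \*: (expR \o (fun r => l * r)))//.
by apply/funext => r; exact: mulrC.
Qed.

(** Integration divides the exponential weight by [l]: this is what makes the
    integral operators of the mild equations contract for a large rate. *)
Lemma Rintegral_expR_le (t l : R) : 0 <= t -> 0 < l ->
  \int[lambda]_(r in `[0, t]) expR (l * r) <= expR (l * t) / l.
Proof.
move=> t0 l0; have := t0; rewrite le_eqVlt => /predU1P[<-|tp].
  by rewrite set_itv1 Rintegral_set1 divr_ge0 ?expR_ge0// ltW.
pose Fl r := expR (l * r) / l.
have dF (x : R) : is_derive x 1 Fl (expR (l * x)) by exact: is_derive_expR_scale.
have cF : continuous Fl.
  by move=> x; apply: cvgMl; exact: expR_scale_continuous.
rewrite /Rintegral (@continuous_FTC2 R (fun r => expR (l * r)) Fl 0 t tp)/=.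
- by rewrite /Fl mulr0 expR0 lerBlDr lerDl divr_ge0// ltW.
- exact/continuous_subspaceT/expR_scale_continuous.
- split; first by move=> x _; have [] := dF x.
    exact/cvg_at_right_filter/cF.
  exact/cvg_at_left_filter/cF.
- by move=> x _; rewrite derive1E; have [] := dF x.
Qed.

Lemma Rintegral_cst_itv (t c : R) : 0 <= t ->
  \int[lambda]_(r in `[0, t]) cst c r = c * t.
Proof.
move=> t0; rewrite Rintegral_cst//; congr (_ * _).
transitivity (fine (@lebesgue_measure R `[0, t]%classic)); first by [].
rewrite lebesgue_measure_itv/= lte_fin; case: ltP => [_|t0'].
  by rewrite /= subr0.
by apply/eqP; rewrite eq_le t0 t0'.
Qed.

(** Gronwall's lemma in terms of the weighted supremum of [D]. That supremum is
    the least admissible [m]; applied to it, the hypothesis reads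
    [m <= A + m / 2], which bounds [m] because it is finite, [D] being bounded.
    No regularity of [D] is involved. *)
Lemma weighted_gronwall (D : R -> R) (T l A C : R) : 0 <= T -> 0 <= l ->
  (forall t, 0 <= t <= T -> 0 <= D t <= C) ->
  (forall m, 0 <= m -> (forall t, 0 <= t <= T -> D t <= m * expR (l * t)) ->
    forall t, 0 <= t <= T -> D t <= (A + m / 2) * expR (l * t)) ->
  forall t, 0 <= t <= T -> D t <= 2 * A * expR (l * t).
Proof.
move=> T0 l0 DC step t tT.
pose E := [set D s / expR (l * s) | s in `[0, T]].
have E0 : E !=set0 by exists (D 0 / expR (l * 0)), 0 => //=; rewrite in_itv/= lexx.
have Eb : has_ubound E.
  exists C => x [s /=]; rewrite in_itv/= => sT <-; have /andP[Ds DsC] := DC s sT.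
  apply: le_trans DsC; rewrite ler_pdivrMr ?expR_gt0// -[leLHS]mulr1 ler_wpM2l//.
  have /andP[s0 _] := sT.
  by rewrite -expR0 ler_expR mulr_ge0.
pose m := sup E.
have Dm s : 0 <= s <= T -> D s <= m * expR (l * s).
  move=> sT; rewrite -ler_pdivrMr ?expR_gt0//; apply: ub_le_sup => //.
  by exists s => //=; rewrite in_itv.
have m0 : 0 <= m.
  have T00 : 0 <= (0 : R) <= T by rewrite lexx.
  by have /andP[D0 _] := DC 0 T00; have := le_trans D0 (Dm 0 T00); rewrite mulr0 expR0 mulr1.
have mA : m <= A + m / 2.
  apply: ge_sup => // x [s /=]; rewrite in_itv/= => sT <-.
  by rewrite ler_pdivrMr ?expR_gt0//; exact: step.
apply: le_trans (Dm t tT) _; rewrite ler_wpM2r ?expR_ge0//.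
by move: mA; lra.
Qed.

(** The running supremum of [a] over ]0, eps]. *)
Lemma monotone_envelope (a : R -> R) (K : R) :
  (forall eps, 0 < eps -> 0 <= a eps <= K) -> a eps @[eps --> 0^'+] --> 0 ->
  exists b : R -> R,
    [/\ forall eps, 0 < eps -> a eps <= b eps,
        forall eps, 0 < eps -> 0 <= b eps,
        forall e1 e2, 0 < e1 -> e1 <= e2 -> b e1 <= b e2 &
        b eps @[eps --> 0^'+] --> 0].
Proof.
move=> aK a0; pose E e := [set a e' | e' in `]0, e]].
pose b e := sup (E e).
have Eb e : has_ubound (E e).
  by exists K => x [e' /=]; rewrite in_itv/= => /andP[e'0 _] <-; case/andP : (aK e' e'0).
have ab e e' : 0 < e' -> e' <= e -> a e' <= b e.
  by move=> e'0 e'e; apply: ub_le_sup => //; exists e' => //=; rewrite in_itv/= e'0.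
have b_ge0 e : 0 < e -> 0 <= b e.
  by move=> e0; apply: le_trans (ab e e e0 (lexx e)); case/andP : (aK e e0).
exists b; split => //.
- by move=> e e0; exact: ab.
- move=> e1 e2 e10 e12; apply: ge_sup.
    by exists (a e1), e1 => //=; rewrite in_itv/= e10 lexx.
  move=> x [e' /=]; rewrite in_itv/= => /andP[e'0 e'e] <-.
  by apply: ab => //; exact: le_trans e12.
- apply/cvgrPdist_le => delta delta0.
  have /cvgrPdist_le/(_ _ delta0) [r /= r0 hr] := a0.
  near=> e.
  have e0 : 0 < e by near: e; exact: nbhs_right_gt.
  have er : e < r by near: e; exact: nbhs_right_lt.
  rewrite sub0r normrN ger0_norm ?b_ge0//; apply: ge_sup.
    by exists (a e), e => //=; rewrite in_itv/= e0 lexx.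
  move=> x [e' /=]; rewrite in_itv/= => /andP[e'0 e'e] <-.
  have := hr e'; rewrite /= !sub0r !normrN => h.
  apply: le_trans (ler_norm _) _; apply: h => //.
  by rewrite gtr0_norm// (le_lt_trans e'e).
Unshelve. all: by end_near. Qed.

(** The error estimate of the theorem need not be monotone in [eps], as nothing
    is known on how the semigroups depend on it. It is replaced by its monotone
    envelope; adding [eps] makes the result strictly increasing and positive. *)
Lemma modulus_exists (a : R -> R) (K c l T : R) : 0 <= c -> 0 <= l -> 0 <= T ->
  (forall eps, 0 < eps -> 0 <= a eps <= K) -> a eps @[eps --> 0^'+] --> 0 ->
  exists tau : R -> R,
    [/\ forall eps, 0 < eps -> 0 < tau eps,
        forall e1 e2, 0 < e1 -> e1 < e2 -> tau e1 < tau e2,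
        tau eps @[eps --> 0^'+] --> 0 &
        forall eps, 0 < eps ->
          (2 * (a eps + eps * c) * expR (l * (1 + eps ^+ 2) * T)) ^+ 2 <= tau eps].
Proof.
move=> c0 l0 T0 aK a0; have [b [ab b0 bm bc]] := monotone_envelope aK a0.
pose p eps := 2 * (b eps + eps * c) * expR (l * (1 + eps ^+ 2) * T).
have p0 eps : 0 < eps -> 0 <= p eps.
  move=> e0; rewrite /p mulr_ge0 ?expR_ge0// mulr_ge0// addr_ge0 ?b0//.
  by rewrite mulr_ge0// ltW.
exists (fun eps => eps + p eps ^+ 2); split.
- by move=> eps e0; rewrite ltr_wpDr ?sqr_ge0.
- move=> e1 e2 e10 e12; have e20 := lt_trans e10 e12; have le12 := ltW e12.
  rewrite ltr_leD// lerXn2r ?nnegrE ?p0// /p.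
  apply: ler_pM.
  + by rewrite mulr_ge0// addr_ge0 ?b0// mulr_ge0// ltW.
  + exact: expR_ge0.
  + by rewrite ler_wpM2l// lerD ?bm// ler_wpM2r.
  + rewrite ler_expR ler_wpM2r// ler_wpM2l// lerD2l.
    by rewrite lerXn2r// nnegrE ltW.
- have ce : (eps : R) @[eps --> 0^'+] --> (0 : R) by apply: cvg_at_right_filter; exact: cvg_id.
  have cp : p eps @[eps --> 0^'+] --> 2 * (0 + 0 * c) * expR (l * (1 + 0 ^+ 2) * T).
    apply: cvgM.
      by apply: cvgMr; apply: cvgD => //; exact: cvgMl.
    apply: (@cvg_comp _ _ _ (fun eps => l * (1 + eps ^+ 2) * T) expR); last exact: continuous_expR.
    apply: cvgMl; apply: cvgMr; apply: cvgD; first exact: cvg_cst.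
    by rewrite expr2; under eq_fun do rewrite expr2; exact: cvgM.
  rewrite !mul0r add0r mulr0 mul0r in cp.
  have : eps + p eps * p eps @[eps --> 0^'+] --> (0 : R) + 0 * 0.
    by apply: cvgD => //; exact: cvgM.
  by rewrite mul0r addr0.
- move=> eps e0; apply: (@le_trans _ _ (p eps ^+ 2)); last by rewrite lerDr ltW.
  have /andP[ae0 _] := aK eps e0.
  rewrite lerXn2r ?nnegrE ?p0//.
    by rewrite mulr_ge0 ?expR_ge0// mulr_ge0// addr_ge0// mulr_ge0// ltW.
  by rewrite ler_wpM2r ?expR_ge0// ler_wpM2l// lerD2r ab.
Qed.

End real_analysis.

(** * Distance between the mild solutions *)

Section mild_solutions.
Context (R : realType) (H1 H2 : completeNormedModType R)
  (dot1 : {dot H1 for idfun}) (dot2 : {dot H2 for idfun})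
  (dot1_norm : forall x : H1, dot1 x x = `|x| ^+ 2) (sH1 : separable H1)
  (dot2_norm : forall x : H2, dot2 x x = `|x| ^+ 2) (sH2 : separable H2)
  (d : measure_display) (Omega : measurableType d) (P : probability Omega R)
  (F : R -> set (set Omega)) (hF : complete_filtration P F)
  (Q : bounded_op H2 H2) (hQ : covariance_operator dot2 Q)
  (N : set nat) (e : nat -> H2) (kappa : nat -> R)
  (beta : nat -> R -> Omega -> R) (W : R -> Omega -> H2)
  (hW : Q_wiener P dot2 F Q N e kappa beta W)
  (f : H1 -> Vphi2 H1 -> H1) (g : H1 -> Vphi2 H1 -> bounded_op H2 H1)
  (K1 K4 : R) (hK1 : 0 < K1) (hK4 : 0 < K4)
  (hf_lip : forall x y mu nu,
    `|f x mu - f y nu| <= K1 * (`|x - y| + rho mu nu))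
  (hg_growth : forall x mu,
    opnorm (g x mu) ^+ 2 <= K4 * (1 + `|x| ^+ 2 + norm_phi mu ^+ 2))
  (T B : R) (hT : 0 < T) (B0 : 0 <= B).
Local Notation lambda := (@lebesgue_measure R).
Local Notation tr2 := (trace_norm2 N e kappa).

(** Continuity in mean square along [0, T], in the epsilon form in which the
    compactness arguments use it. *)
Lemma adapted_L2_continuous_dist (x : R -> Omega -> H1) :
  adapted_L2_continuous P F T x ->
  forall s delta, 0 <= s <= T -> 0 < delta ->
    \forall r \near s, 0 <= r <= T -> l2 P (fun w => x r w - x s w) < delta.
Proof.
move=> hx s delta sT delta0.
have LD r : 0 <= r <= T -> L2_vector P (fun w => x r w - x s w).
  by move=> rT; apply: L2_vectorB => //; exact: (alc_L2 hx).
have d2 : (0 < (delta ^+ 2)%:E)%E by rewrite lte_fin exprn_gt0.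
have := alc_continuous hx sT.
move=> /(_ [set y | (y < (delta ^+ 2)%:E)%E]) /= h.
have : nbhs 0%E [set y | (y < (delta ^+ 2)%:E)%E] by exact: open_ereal_lt_ereal.
move=> /h hh.
have {}hh : \forall r \near s, `[0, T]%classic r ->
    (mean_square P (fun w => x r w - x s w)%R < (delta ^+ 2)%:E)%E by exact: hh.
apply: filterS hh => r hr rT.
have : `[0, T]%classic r by rewrite /= in_itv.
move=> /hr/=; rewrite (mean_squareE (LD r rT)) lte_fin.
by rewrite (@ltr_pXn2r _ 2) ?nnegrE ?l2_ge0 ?(ltW delta0).
Qed.

Section drift.
Context (S Se : R -> bounded_op H1 H1)
  (BS : forall t, 0 <= t <= T -> opnorm (S t) <= B)
  (BSe : forall t, 0 <= t <= T -> opnorm (Se t) <= B)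
  (x x' : R -> Omega -> H1) (mu mu' : R -> Vphi2 H1).
Context (hx : adapted_L2_continuous P F T x) (hx' : adapted_L2_continuous P F T x')
  (hmu : forall t, 0 <= t <= T -> has_law P (x t) (mu t))
  (hmu' : forall t, 0 <= t <= T -> has_law P (x' t) (mu' t)).

(** The two arguments of [f] contribute equally, the distance of the laws being
    at most the [L_2] distance of the processes: hence the factor 2. *)
Lemma drift_lipschitz r s : 0 <= r <= T -> 0 <= s <= T ->
  L2_vector P (fun w => f (x r w) (mu r)) ->
  L2_vector P (fun w => f (x' s w) (mu' s)) ->
  l2 P (fun w => f (x r w) (mu r) - f (x' s w) (mu' s)) <=
  2 * K1 * l2 P (fun w => x r w - x' s w).
Proof.
move=> rT sT Lf Lf'.
have LD := L2_vector_norm (L2_vectorB sH1 (alc_L2 hx rT) (alc_L2 hx' sT)).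
set D := l2 P (fun w => x r w - x' s w).
have hrho : rho (mu r) (mu' s) <= D.
  by apply: (rho_le_coupling sH1 _ _ (hmu rT) (hmu' sT));
    [exact: (alc_L2 hx)|exact: (alc_L2 hx')].
have L1 := L2rZ K1 LD; have L2 := L2r_cst P (K1 * D).
have K0 := ltW hK1.
apply: (@le_trans _ _ (l2r P (fun w => K1 * `|x r w - x' s w| + cst (K1 * D) w))).
  apply: l2_le; [exact: L2_vectorB|exact: L2rD|apply: aeW => w /=].
  rewrite [leRHS]ger0_norm ?addr_ge0 ?mulr_ge0 ?l2_ge0//.
  by apply: le_trans (hf_lip _ _ _ _) _; rewrite mulrDr lerD2l ler_wpM2l.
apply: le_trans (l2rD L1 L2) _.
rewrite l2rZ// l2r_cst (ger0_norm K0) ger0_norm ?mulr_ge0 ?l2_ge0//.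
by rewrite -/(l2 P (fun w => x r w - x' s w)) -/D -mulrA mulr_natl mulr2n.
Qed.

(** Split [Se u y - S u y'] as [Se u (y - y') + (Se u y' - S u y')]: the
    semigroups are compared only at the drift of the limit equation, which does
    not depend on the perturbation parameter. *)
Lemma drift_difference r t gamma : 0 <= r <= t -> t <= T ->
  L2_vector P (fun w => f (x r w) (mu r)) ->
  L2_vector P (fun w => f (x' r w) (mu' r)) ->
  l2r P (fun w => semigroup_gap Se S T (f (x' r w) (mu' r))) <= gamma ->
  l2 P (fun w => Se (t - r) (f (x r w) (mu r)) - S (t - r) (f (x' r w) (mu' r))) <=
  2 * B * K1 * l2 P (fun w => x r w - x' r w) + gamma.
Proof.
move=> /andP[r0 rt] tT Lf Lf' hgamma.
have rT : 0 <= r <= T by rewrite r0 (le_trans rt).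
have uT : 0 <= t - r <= T by rewrite subr_ge0 rt lerBlDr (le_trans tT)// lerDl.
have LA := L2rZ B (L2_vector_norm (L2_vectorB sH1 Lf Lf')).
have LG := gap_L2 (ltW hT) BSe BS Lf'.
apply: (@le_trans _ _ (l2r P (fun w => B * `|f (x r w) (mu r) - f (x' r w) (mu' r)| +
    semigroup_gap Se S T (f (x' r w) (mu' r))))).
  apply: l2_le; [|exact: L2rD|apply: aeW => w].
    by apply: L2_vectorB => //; exact: L2_vector_bop.
  have G0 := gap_ge0 (ltW hT) BSe BS (f (x' r w) (mu' r)).
  rewrite [leRHS]ger0_norm ?addr_ge0 ?mulr_ge0//.
  have -> : Se (t - r) (f (x r w) (mu r)) - S (t - r) (f (x' r w) (mu' r)) =
      Se (t - r) (f (x r w) (mu r) - f (x' r w) (mu' r)) +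
      (Se (t - r) (f (x' r w) (mu' r)) - S (t - r) (f (x' r w) (mu' r))).
    have -> : Se (t - r) (f (x r w) (mu r) - f (x' r w) (mu' r)) =
      Se (t - r) (f (x r w) (mu r)) - Se (t - r) (f (x' r w) (mu' r)) := linearB _ _ _.
    by rewrite subrKA.
  apply: le_trans (ler_normD _ _) _; apply: lerD.
    by apply: le_trans (opnorm_le _ _) _; rewrite ler_wpM2r// BSe.
  exact: (gap_ub BSe BS).
apply: le_trans (l2rD LA LG) _; apply: lerD => //.
rewrite l2rZ; last exact: (L2_vector_norm (L2_vectorB sH1 Lf Lf')).
rewrite ger0_norm//; apply: le_trans (ler_wpM2l B0 (drift_lipschitz rT rT Lf Lf')) _.
by rewrite le_eqVlt; apply/orP; left; apply/eqP; ring.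
Qed.

End drift.

(** The constant of the noise estimate: a bound for the trace of [Q], times the
    squared bound of the semigroups, times the growth constant of [g]. *)
Definition noise_energy : R := l2 P (fun w => W 1 w - W 0 w) ^+ 2 * (B ^+ 2 * K4).

Lemma noise_energy_ge0 : 0 <= noise_energy.
Proof. by rewrite /noise_energy mulr_ge0 ?sqr_ge0// mulr_ge0 ?sqr_ge0// ltW. Qed.

(** Linear growth of [g] bounds the squared Hilbert-Schmidt norm by a multiple
    of [1 + (1 + y)^2 + |X|^2], where [y = l2 P X] and [1 + y] bounds the first
    moment of the law; its mean is at most [3 + 3 y^2]. *)
Lemma noise_bound (L : bounded_op H1 H1) (X : Omega -> H1) (mu : Vphi2 H1) :
  opnorm L <= B -> L2_vector P X -> has_law P X mu ->
  (forall h, measurable_fun setT ((fun w => L (g (X w) mu h)) : Omega -> borel H1)) ->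
  (\int[P]_w tr2 (fun h => L (g (X w) mu h)) <=
    (noise_energy * (3 + 3 * l2 P X ^+ 2))%:E)%E.
Proof.
move=> LB LX hX mL.
have [phi0 phi1] := andP (norm_phi_le LX hX).
have LX2 := L2r_integrable_sq (L2_vector_norm LX).
pose c := noise_energy.
have c0 : 0 <= c by exact: noise_energy_ge0.
have ic : P.-integrable setT (EFin \o (fun w => c * (1 + norm_phi mu ^+ 2 + `|X w| ^+ 2))).
  apply: Rintegrable_scale => //; apply: Rintegrable_add => //.
  exact: (L2r_integrable (L2r_cst P (1 + norm_phi mu ^+ 2))).
apply: (@le_trans _ _ (\int[P]_w (c * (1 + norm_phi mu ^+ 2 + `|X w| ^+ 2))%:E)%E).
  apply: ge0_le_integral => //.
  - by move=> w _; exact: (trace_norm2_ge0 hQ hW).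
  - exact: (trace_norm2_measurable hQ hW).
  - by case/integrableP : ic.
  - move=> w _.
    have Lg h : `|L (g (X w) mu h)| <= (B * opnorm (g (X w) mu)) * `|h|.
      apply: le_trans (opnorm_le _ _) _; rewrite -mulrA.
      by apply: ler_pM => //; [exact: opnorm_ge0|exact: opnorm_le].
    apply: le_trans (trace_norm2_opnorm dot2_norm sH2 hQ hW Lg) _.
    rewrite lee_fin /c /noise_energy -mulrA ler_wpM2l ?sqr_ge0// exprMn -mulrA.
    rewrite ler_wpM2l ?sqr_ge0//; apply: le_trans (hg_growth _ _) _.
    by rewrite ler_wpM2l ?(ltW hK4)// addrAC.
have -> : (\int[P]_w (c * (1 + norm_phi mu ^+ 2 + `|X w| ^+ 2))%:E =
    (c * (1 + norm_phi mu ^+ 2 + l2 P X ^+ 2))%:E)%E.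
  have iL : P.-integrable setT (EFin \o (cst (1 + norm_phi mu ^+ 2) : Omega -> R)).
    exact: (L2r_integrable (L2r_cst P (1 + norm_phi mu ^+ 2))).
  transitivity ((\int[P]_w (c * (1 + norm_phi mu ^+ 2 + `|X w| ^+ 2)))%:E)%E.
    by rewrite /Rintegral fineK//; exact: integrable_fin_num.
  congr EFin; rewrite RintegralZl//; last exact: Rintegrable_add.
  congr (_ * _); rewrite RintegralD//.
  rewrite -(l2r_sq (L2_vector_norm LX)) -/(l2 P X); congr (_ + _).
  rewrite [LHS](Rintegral_cst _ measurableT).
  rewrite [X in _ * X](_ : _ = 1) ?mulr1//.
  by rewrite -[RHS]/(fine 1%:E); congr fine; exact: probability_setT.
rewrite lee_fin ler_wpM2l//.
have : norm_phi mu ^+ 2 <= (1 + l2 P X) ^+ 2.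
  by rewrite lerXn2r// nnegrE ?addr_ge0 ?l2_ge0.
by have := l2_ge0 P X; have := sqr_ge0 (1 - l2 P X); nra.
Qed.

Lemma le_sqrt_add (y p q : R) : 0 <= p -> 0 <= q -> y ^+ 2 <= p + q ^+ 2 ->
  y <= Num.sqrt p + q.
Proof.
move=> p0 q0 h; apply: le_trans (ler_norm y) _.
rewrite -(@ler_pXn2r _ 2) ?nnegrE ?addr_ge0 ?sqrtr_ge0// real_normK ?num_real//.
apply: le_trans h _; rewrite sqrrD sqr_sqrtr// lerD2r lerDl.
by rewrite mulrn_wge0// mulr_ge0 ?sqrtr_ge0.
Qed.

Section difference.
Context (S Se : R -> bounded_op H1 H1)
  (S0 : forall x, S 0 x = x) (Se0 : forall x, Se 0 x = x)
  (BS : forall t, 0 <= t <= T -> opnorm (S t) <= B)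
  (BSe : forall t, 0 <= t <= T -> opnorm (Se t) <= B)
  (x0 : Omega -> H1) (Lx0 : L2_vector P x0)
  (x x' : R -> Omega -> H1) (mu mu' : R -> Vphi2 H1) (eps : R) (eps0 : 0 < eps).
Context (hx : mild_solution_noise P F N e kappa W T Se f g eps x0 x mu)
  (hx' : mild_solution P F T S f x0 x' mu').
Local Notation D t := (l2 P (fun w => x t w - x' t w)).
Context (gamma C l : R) (gamma0 : 0 <= gamma) (C0 : 0 <= C) (l0 : 0 < l)
  (hgamma : forall r, 0 <= r <= T ->
     l2r P (fun w => semigroup_gap Se S T (f (x' r w) (mu' r))) <= gamma)
  (hC : forall r, 0 <= r <= T -> l2 P (x' r) <= C).

(** Integrability of the drift is part of the mild equation: at [s = t] the
    semigroup in the integrand is the identity. *)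
Lemma drift_L2 r : 0 <= r <= T -> L2_vector P (fun w => f (x' r w) (mu' r)).
Proof.
move=> rT; have [I [[LI _ _] _]] := ms_equation hx' rT.
have r1 : 0 <= r <= r by rewrite lexx andbT; case/andP : rT.
have := LI r r1; rewrite subrr.
by rewrite (_ : (fun w => S 0 _) = fun w => f (x' r w) (mu' r))//; apply/funext => w.
Qed.

Lemma drift_L2_noise r : 0 <= r <= T -> L2_vector P (fun w => f (x r w) (mu r)).
Proof.
move=> rT; have [I [J [[LI _ _] _ _]]] := msn_equation hx rT.
have r1 : 0 <= r <= r by rewrite lexx andbT; case/andP : rT.
have := LI r r1; rewrite subrr.
by rewrite (_ : (fun w => Se 0 _) = fun w => f (x r w) (mu r))//; apply/funext => w.
Qed.

(** With [|x| <= C + m e^(l r)], the noise estimate at time [r] becomes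
    [noise_energy * (3 + 6 C^2) + noise_rate * m^2 e^(2 l r)]. The first part,
    integrated over [0, T] and doubled by the isometry inequality, is
    [noise_size^2]; the second integrates to [noise_rate / l] times the square
    of the exponential bound. *)
Definition noise_size : R := Num.sqrt (2 * (noise_energy * (3 + 6 * C ^+ 2) * T)).
Definition noise_rate : R := 6 * noise_energy.

Lemma expR_double (t : R) : expR (2 * l * t) = expR (l * t) ^+ 2.
Proof. by rewrite expr2 -expRD; congr expR; ring. Qed.

Let hx_alc := msn_class hx.
Let hx'_alc := ms_class hx'.

Let drift_integral (m t : R) (I I' : Omega -> H1) : 0 <= m -> 0 <= t <= T ->
  (forall r, 0 <= r <= T -> D r <= m * expR (l * r)) ->
  bochner_integral P t (fun s w => Se (t - s) (f (x s w) (mu s))) I ->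
  bochner_integral P t (fun s w => S (t - s) (f (x' s w) (mu' s))) I' ->
  l2 P (fun w => I w - I' w) <=
    2 * B * K1 / l * (m * expR (l * t)) + gamma * T.
Proof.
move=> m0 /andP[t0 tT] Dm hI hI'.
have K0 := ltW hK1; have Bm : 0 <= 2 * B * K1 * m by rewrite !mulr_ge0.
have i1 : lambda.-integrable `[0, t] (EFin \o (fun r => expR (l * r))).
  by apply: continuous_integrable; exact: expR_scale_continuous.
have i2 : lambda.-integrable `[0, t] (EFin \o (cst gamma : R -> R)).
  by apply: continuous_integrable => r; exact: cvg_cst.
have i3 : lambda.-integrable `[0, t] (EFin \o (fun r => 2 * B * K1 * m * expR (l * r))).
  exact: Rintegrable_scale.
have i4 : lambda.-integrable `[0, t]
    (EFin \o (fun r => 2 * B * K1 * m * expR (l * r) + cst gamma r)).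
  exact: Rintegrable_add.
apply: le_trans (bochner_integral_sub_le dot1_norm sH1 hI hI' i4 _) _.
  move=> r rt; have rT : 0 <= r <= T.
    by case/andP : rt => -> /= rt; exact: le_trans tT.
  apply: le_trans (drift_difference BS BSe hx_alc hx'_alc (msn_law hx) (ms_law hx') rt tT
    (drift_L2_noise rT) (drift_L2 rT) (hgamma rT)) _.
  have BK0 : 0 <= 2 * B * K1 by rewrite !mulr_ge0.
  by rewrite /= lerD2r; have := ler_wpM2l BK0 (Dm r rT); rewrite mulrA.
rewrite RintegralD// RintegralZl// Rintegral_cst_itv//; apply: lerD.
  apply: le_trans (ler_wpM2l Bm (Rintegral_expR_le t0 l0)) _.
  by rewrite le_eqVlt; apply/orP; left; apply/eqP; ring.
by rewrite ler_wpM2l.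
Qed.

Let noise_integral (m t : R) (J : Omega -> H1) : 0 <= m -> 0 <= t <= T ->
  (forall r, 0 <= r <= T -> D r <= m * expR (l * r)) ->
  ito_integral P F N e kappa W t (fun s w h => Se (t - s) (g (x s w) (mu s) h)) J ->
  l2 P J <= noise_size + Num.sqrt (noise_rate / l) * (m * expR (l * t)).
Proof.
move=> m0 /andP[t0 tT] Dm hJ; have n0 := noise_energy_ge0.
have i1 : lambda.-integrable `[0, t] (EFin \o (fun r => expR (2 * l * r))).
  by apply: continuous_integrable; exact: expR_scale_continuous.
have i2 : lambda.-integrable `[0, t]
    (EFin \o (cst (noise_energy * (3 + 6 * C ^+ 2)) : R -> R)).
  by apply: continuous_integrable => r; exact: cvg_cst.
have i3 : lambda.-integrable `[0, t]
    (EFin \o (fun r => noise_rate * m ^+ 2 * expR (2 * l * r))).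
  exact: Rintegrable_scale.
have i4 : lambda.-integrable `[0, t] (EFin \o (fun r =>
    cst (noise_energy * (3 + 6 * C ^+ 2)) r + noise_rate * m ^+ 2 * expR (2 * l * r))).
  exact: Rintegrable_add.
have rate0 : 0 <= noise_rate by rewrite /noise_rate mulr_ge0.
have l20 : 0 < 2 * l by rewrite mulr_gt0.
have sz0 : 0 <= noise_energy * (3 + 6 * C ^+ 2).
  by rewrite mulr_ge0// addr_ge0// mulr_ge0// sqr_ge0.
apply: le_sqrt_add.
- by rewrite mulr_ge0// mulr_ge0// ltW.
- by rewrite mulr_ge0 ?sqrtr_ge0// mulr_ge0// expR_ge0.
apply: le_trans (ito_integral_le dot2_norm sH2 dot1_norm sH1 hF hQ hW t0 hJ i4 _) _.
  move=> r rt; have rT : 0 <= r <= T.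
    by case/andP : rt => -> /= rt; exact: le_trans tT.
  have uT : 0 <= t - r <= T.
    by case/andP : rt => r0 rt; rewrite subr_ge0 rt lerBlDr (le_trans tT)// lerDl.
  have [mJ _ _] := hJ.
  have Lxr := alc_L2 hx_alc rT; have Lxr' := alc_L2 hx'_alc rT.
  apply: le_trans (noise_bound (BSe uT) Lxr (msn_law hx rT) _) _.
    move=> h _ Bs mBs; rewrite setTI; have /andP[r0 _] := rt.
    exact: (filtration_sub hF r0 (mJ r h rt Bs mBs)).
  rewrite lee_fin /noise_rate expR_double /=.
  rewrite [X in _ <= _ + X](_ : _ = 6 * noise_energy * (m * expR (l * r)) ^+ 2); last by ring.
  have hD := Dm r rT; have hCr := hC rT.
  have : l2 P (x r) <= C + m * expR (l * r).
    rewrite (_ : l2 P (x r) = l2 P (fun w => x' r w + (x r w - x' r w))).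
      apply: le_trans (l2D sH1 Lxr' (L2_vectorB sH1 Lxr Lxr')) _.
      exact: lerD.
    by congr l2; apply/funext => w; rewrite addrC subrK.
  have E0 : 0 <= m * expR (l * r) by rewrite mulr_ge0// expR_ge0.
  move: (m * _) E0 => E E0 h; have := l2_ge0 P (x r).
  move: (l2 _ _) h => X h X0.
  have : X ^+ 2 <= (C + E) ^+ 2 by rewrite lerXn2r// nnegrE ?addr_ge0.
  move=> hX2.
  rewrite -subr_ge0 (_ : _ - _ = noise_energy * (6 * C ^+ 2 + 6 * E ^+ 2 - 3 * X ^+ 2)).
    by rewrite mulr_ge0//; have := sqr_ge0 (C - E); move: hX2; nra.
  by ring.
rewrite RintegralD// RintegralZl// Rintegral_cst_itv// mulrDr; apply: lerD.
  by rewrite ler_wpM2l// ler_wpM2l.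
rewrite exprMn sqr_sqrtr ?divr_ge0 ?(ltW l0)//.
have c0 : 0 <= 2 * (noise_rate * m ^+ 2).
  by apply: mulr_ge0 => //; apply: mulr_ge0 => //; exact: sqr_ge0.
rewrite mulrA; apply: le_trans (ler_wpM2l c0 (Rintegral_expR_le t0 l20)) _.
rewrite expR_double exprMn le_eqVlt; apply/orP; left; apply/eqP; field.
by rewrite gt_eqF.
Qed.

(** Subtract the two mild equations. An exponential bound for the distance
    reproduces itself, with [m] multiplied by a quantity that is small when [l]
    is large, up to terms that vanish with the perturbation: the semigroup gap
    at the initial value and along the drift, and [eps] times the noise. *)
Lemma difference_bound (m : R) : 0 <= m ->
  (forall r, 0 <= r <= T -> D r <= m * expR (l * r)) ->
  forall t, 0 <= t <= T ->
  D t <= l2r P (fun w => semigroup_gap Se S T (x0 w)) + gamma * T + eps * noise_size +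
    (2 * B * K1 / l + eps * Num.sqrt (noise_rate / l)) * (m * expR (l * t)).
Proof.
move=> m0 Dm t tT.
have [I [J [hI hJ xE]]] := msn_equation hx tT.
have [I' [hI' xE']] := ms_equation hx' tT.
have hd := drift_integral m0 tT Dm hI hI'.
have hn := noise_integral m0 tT Dm hJ.
have [_ LI _] := hI; have [_ LI' _] := hI'; have [_ LJ _] := hJ.
have LS := L2_vectorB sH1 (L2_vector_bop (Se t) Lx0) (L2_vector_bop (S t) Lx0).
have LII := L2_vectorB sH1 LI LI'.
have LeJ := L2_vectorZ eps LJ.
have LSI := L2_vectorD sH1 LS LII.
have LD := L2_vectorB sH1 (alc_L2 hx_alc tT) (alc_L2 hx'_alc tT).
have -> : D t = l2 P (fun w => (Se t (x0 w) - S t (x0 w) + (I w - I' w)) + eps *: J w).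
  apply: ae_eq_l2 => //; last exact: L2_vectorD.
  move: xE xE'; apply: filterS2 => w -> ->.
  by rewrite addrAC opprD addrACA.
have hS0 : l2 P (fun w => Se t (x0 w) - S t (x0 w)) <=
    l2r P (fun w => semigroup_gap Se S T (x0 w)).
  apply: l2_le => //; first exact: (gap_L2 (ltW hT) BSe BS Lx0).
  apply: aeW => w; rewrite [leRHS]ger0_norm.
    exact: (gap_ub BSe BS).
  exact: (gap_ge0 (ltW hT) BSe BS).
apply: le_trans (l2D sH1 LSI LeJ) _.
apply: le_trans (lerD (l2D sH1 LS LII) (lexx _)) _.
rewrite l2Z// gtr0_norm//.
apply: le_trans (lerD (lerD hS0 hd) (ler_wpM2l (ltW eps0) hn)) _.
by rewrite le_eqVlt; apply/orP; left; apply/eqP; ring.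
Qed.

(** The rate [l] is chosen so that the factor in [difference_bound] is at most
    1/2, which [weighted_gronwall] requires: [l >= 8 B K1] makes the drift
    summand at most 1/4, and [l >= 16 noise_rate eps^2] the noise summand. The
    noise is thus absorbed for every [eps], at the price of a rate that grows
    like [1 + eps^2]. *)
Lemma mild_solution_distance (l0' CD : R) :
  1 + 8 * B * K1 + 16 * noise_rate <= l0' -> l = l0' * (1 + eps ^+ 2) ->
  (forall t, 0 <= t <= T -> D t <= CD) ->
  forall t, 0 <= t <= T ->
  D t <= 2 * (l2r P (fun w => semigroup_gap Se S T (x0 w)) + gamma * T +
    eps * noise_size) * expR (l * t).
Proof.
move=> hl0 lE DCD; have rate0 : 0 <= noise_rate.
  by rewrite /noise_rate mulr_ge0// noise_energy_ge0.
have BK0 : 0 <= B * K1 by rewrite mulr_ge0// ltW.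
have e20 : 0 <= eps ^+ 2 by exact: sqr_ge0.
have lp : 0 < l0' by lra.
have half : 2 * B * K1 / l + eps * Num.sqrt (noise_rate / l) <= 2^-1.
  have h1 : 2 * B * K1 / l <= 4^-1.
    rewrite ler_pdivrMr// lE; have : 0 <= l0' * eps ^+ 2 by rewrite mulr_ge0// ltW.
    by move: hl0 BK0 rate0; lra.
  have h2 : eps * Num.sqrt (noise_rate / l) <= 4^-1.
    rewrite -(@ler_pXn2r _ 2) ?nnegrE ?mulr_ge0 ?sqrtr_ge0 ?invr_ge0 ?(ltW eps0)//.
    rewrite exprMn sqr_sqrtr ?divr_ge0 ?(ltW l0)// mulrA ler_pdivrMr// lE.
    have : noise_rate * eps ^+ 2 <= (l0' / 16) * eps ^+ 2.
      by rewrite ler_wpM2r//; move: hl0 BK0 rate0; lra.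
    by rewrite exprVn; move: lp e20; lra.
  by move: h1 h2; lra.
apply: (@weighted_gronwall _ _ T l _ CD (ltW hT) (ltW l0)).
  by move=> t tT; rewrite l2_ge0 DCD.
move=> m m0 Dm t tT; apply: le_trans (difference_bound m0 Dm tT) _.
have E0 : 0 <= m * expR (l * t) by rewrite mulr_ge0// expR_ge0.
have := ler_wpM2r E0 half.
(* the terms without exponential weight are also at most that weight *)
have e1 : 1 <= expR (l * t).
  by rewrite -expR0 ler_expR mulr_ge0 ?(ltW l0)//; case/andP : tT.
set A := l2r _ _ + _ + _.
have A0 : 0 <= A.
  by rewrite !addr_ge0 ?l2r_ge0// mulr_ge0 ?sqrtr_ge0// ltW.
have := ler_wpM2l A0 e1.
by move: (2 * B * K1 / l + _) => u; move: E0; nra.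
Qed.

End difference.

Section drift_curve.
Context (S : R -> bounded_op H1 H1) (x' : R -> Omega -> H1) (mu' : R -> Vphi2 H1)
  (x0 : Omega -> H1) (S0 : forall x, S 0 x = x)
  (hx' : mild_solution P F T S f x0 x' mu').

(** The drift of the limit equation is a continuous curve in [L_2], since [f] is
    Lipschitz in the process and in its law: the semigroups converge uniformly
    along it. *)
Lemma drift_continuous s delta : 0 <= s <= T -> 0 < delta ->
  \forall r \near s, 0 <= r <= T ->
    l2 P (fun w => f (x' r w) (mu' r) - f (x' s w) (mu' s)) < delta.
Proof.
move=> sT delta0; have K0 : 0 < 2 * K1 by rewrite mulr_gt0.
have := adapted_L2_continuous_dist (ms_class hx') sT (divr_gt0 delta0 K0).
apply: filterS => r hr rT.
apply: le_lt_trans (drift_lipschitz (ms_class hx') (ms_class hx') (ms_law hx') (ms_law hx')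
  rT sT (drift_L2 S0 hx' rT) (drift_L2 S0 hx' sT)) _.
by rewrite mulrC -ltr_pdivlMr// hr.
Qed.

End drift_curve.
End mild_solutions.

Theorem theorem4p4 (R : realType)
  (H1 H2 : completeNormedModType R)
  (dot1 : {dot H1 for idfun}) (dot2 : {dot H2 for idfun})
  (hH1 : separable_hilbert dot1) (hH2 : separable_hilbert dot2)
  (d : measure_display) (Omega : measurableType d) (P : probability Omega R)
  (F : R -> set (set Omega))
  (hP : measure_is_complete P) (hF : complete_filtration P F)
  (Q : bounded_op H2 H2) (hQ : covariance_operator dot2 Q)
  (N : set nat) (e : nat -> H2) (kappa : nat -> R)
  (beta : nat -> R -> Omega -> R) (W : R -> Omega -> H2)
  (hW : Q_wiener P dot2 F Q N e kappa beta W)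
  (f : H1 -> Vphi2 H1 -> H1) (g : H1 -> Vphi2 H1 -> bounded_op H2 H1)
  (K1 K2 : R) (K3 K4 : R -> R)
  (hK1 : 0 < K1) (hK2 : 0 < K2)
  (hK3 : forall p, 2 <= p -> 0 < K3 p) (hK4 : forall p, 2 <= p -> 0 < K4 p)
  (hf_lip : forall x y mu nu,
    `|f x mu - f y nu| <= K1 * (`|x - y| + rho mu nu))
  (hg_lip : forall x y mu nu,
    opnorm (fun h => g x mu h - g y nu h) <= K2 * (`|x - y| + rho mu nu))
  (hf_growth : forall p, 2 <= p -> forall x mu,
    `|f x mu| `^ p <= K3 p * (1 + `|x| `^ p + norm_phi mu `^ p))
  (hg_growth : forall p, 2 <= p -> forall x mu,
    opnorm (g x mu) `^ p <= K4 p * (1 + `|x| `^ p + norm_phi mu `^ p))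
  (M alpha : R) (hM : 1 <= M) (halpha : 0 <= alpha)
  (DA : set H1) (A : H1 -> H1) (S : R -> bounded_op H1 H1)
  (DAeps : R -> set H1) (Aeps : R -> H1 -> H1)
  (Seps : R -> R -> bounded_op H1 H1)
  (hA : generates_in_G M alpha DA A S)
  (hAeps : forall eps, 0 < eps ->
    generates_in_G M alpha (DAeps eps) (Aeps eps) (Seps eps))
  (hD : forall eps, 0 < eps -> DAeps eps = DA)
  (hS : forall t1, 0 < t1 -> forall (x : H1) (delta : R), 0 < delta ->
    \forall eps \near 0^'+,
      forall t, 0 <= t <= t1 -> `|Seps eps t x - S t x| < delta)
  (T : R) (hT : 0 < T)
  (x0 : Omega -> H1) (hx0_L2 : L2_vector P x0)
  (hx0_F0 : measurable_wrt (F 0) (x0 : Omega -> borel H1))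
  (hx0_DA : forall w, DA (x0 w))
  (xeps : R -> R -> Omega -> H1) (mueps : R -> R -> Vphi2 H1)
  (hxeps : forall eps, 0 < eps ->
    mild_solution_noise P F N e kappa W T (Seps eps) f g eps x0
      (xeps eps) (mueps eps))
  (x' : R -> Omega -> H1) (mu' : R -> Vphi2 H1)
  (hx' : mild_solution P F T S f x0 x' mu') :
  exists (tau : R -> R) (c : R),
    [/\ (forall eps, 0 < eps -> 0 < tau eps),
        (forall eps1 eps2, 0 < eps1 -> eps1 < eps2 -> tau eps1 < tau eps2),
        tau eps @[eps --> 0^'+] --> 0,
        0 < c &
        forall eps t, 0 < eps -> 0 <= t <= T ->
          (mean_square P (fun w => xeps eps t w - x' t w)%R
             <= (tau eps * expR (c * t))%:E)%E].
Proof.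
have sH1 : separable H1 by exact: hilbert_separable hH1.
have sH2 : separable H2 by exact: hilbert_separable hH2.
have n1 := hilbert_norm hH1; have n2 := hilbert_norm hH2.
have T0 := ltW hT.
(* a common bound for all the semigroups on [0, T] *)
pose B := M * expR (alpha * T).
have M0 : 0 <= M by apply: le_trans hM.
have B0 : 0 <= B by rewrite mulr_ge0// expR_ge0.
have boundG D (A' : H1 -> H1) S' : generates_in_G M alpha D A' S' ->
    forall t, 0 <= t <= T -> opnorm (S' t) <= B.
  move=> [_ _ bS] t /andP[t0 tT]; apply: le_trans (bS t t0) _.
  by rewrite ler_wpM2l// ler_expR ler_wpM2l.
have S0 : forall x, S 0 x = x by case: hA => -[].
have Se0 eps : 0 < eps -> forall x, Seps eps 0 x = x by move=> /hAeps[[]].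
have BS := boundG _ _ _ hA.
have BSe eps t : 0 < eps -> 0 <= t <= T -> opnorm (Seps eps t) <= B.
  by move=> eps0; exact: (boundG _ _ _ (hAeps eps eps0)).
have le2 : 2 <= (2 : R) by [].
have hg2 x mu : opnorm (g x mu) ^+ 2 <= K4 2 * (1 + `|x| ^+ 2 + norm_phi mu ^+ 2).
  have phi0 : 0 <= norm_phi mu by apply: Rintegral_ge0 => y _; rewrite addr_ge0.
  by have := hg_growth 2 le2 x mu; rewrite !powR_mulrn ?opnorm_ge0.
have hK42 := hK4 2 le2.
(* the drift of the limit equation, along which the semigroups are compared *)
pose Y s w := f (x' s w) (mu' s).
have LY s : 0 <= s <= T -> L2_vector P (Y s) by exact: (drift_L2 S0 hx').
have cY s delta : 0 <= s <= T -> 0 < delta ->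
    \forall r \near s, 0 <= r <= T -> l2 P (fun w => Y r w - Y s w) < delta.
  exact: (drift_continuous sH1 hK1 hf_lip S0 hx').
have hST (x : H1) (delta : R) : 0 < delta -> \forall eps \near 0^'+,
    forall t, 0 <= t <= T -> `|Seps eps t x - S t x| < delta.
  by move=> delta0; exact: hS.
have gapY := l2_gap_uniform sH1 T0 BS BSe hST LY cY.
have [CY CY0 hCY] := l2_curve_bounded sH1 LY cY.
have [C C0 hC] := l2_curve_bounded sH1 (fun s => alc_L2 (ms_class hx') (t := s))
  (adapted_L2_continuous_dist sH1 (ms_class hx')).
pose gap eps (X : Omega -> H1) := l2r P (fun w => semigroup_gap (Seps eps) S T (X w)).
have gap_le eps X : 0 < eps -> L2_vector P X -> gap eps X <= 2 * B * l2 P X.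
  by move=> eps0; exact: (l2_gap_bound T0 (fun t => BSe eps t eps0) BS).
pose gaps eps := [set gap eps (Y s) | s in `[0, T]].
pose gamma eps := sup (gaps eps).
have B20 : 0 <= 2 * B by rewrite mulr_ge0.
have gaps_ub eps : 0 < eps -> ubound (gaps eps) (2 * B * CY).
  move=> eps0 y [s /=]; rewrite in_itv/= => sT <-.
  by apply: le_trans (gap_le _ _ eps0 (LY s sT)) _; rewrite ler_wpM2l// hCY.
have gaps0 eps : gaps eps !=set0.
  by exists (gap eps (Y 0)), 0 => //=; rewrite in_itv/= lexx.
have gap_gamma eps s : 0 < eps -> 0 <= s <= T -> gap eps (Y s) <= gamma eps.
  move=> eps0 sT; apply: ub_le_sup; last by exists s => //=; rewrite in_itv.
  by exists (2 * B * CY); exact: gaps_ub.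
have gamma0 eps : 0 < eps -> 0 <= gamma eps.
  move=> eps0; apply: le_trans (gap_gamma eps 0 eps0 _); first exact: l2r_ge0.
  by rewrite lexx.
have gamma_cvg : gamma eps @[eps --> 0^'+] --> 0.
  apply/cvgrPdist_le => delta delta0.
  move: (nbhs_right_gt (0 : R)) (gapY delta delta0); apply: filterS2 => eps eps0 h.
  rewrite sub0r normrN ger0_norm ?gamma0//; apply: ge_sup => // y [s /=].
  by rewrite in_itv/= => sT <-; exact/ltW/h.
(* the total contribution of the semigroups to the error *)
pose a eps := gap eps x0 + gamma eps * T.
have aK eps : 0 < eps -> 0 <= a eps <= 2 * B * l2 P x0 + 2 * B * CY * T.
  move=> eps0; rewrite /a addr_ge0 ?l2r_ge0 ?mulr_ge0 ?gamma0//=; apply: lerD.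
    exact: gap_le.
  by rewrite ler_wpM2r//; apply: ge_sup => //; exact: gaps_ub.
have a_cvg : a eps @[eps --> 0^'+] --> 0.
  rewrite -[X in _ --> X](addr0 0) -[X in _ --> _ + X](mul0r T).
  apply: cvgD; first exact: (l2_gap_cvg T0 BS BSe hST hx0_L2).
  exact: cvgMl.
pose rate := noise_rate P W (K4 2) B.
pose size := noise_size P W (K4 2) T B C.
have rate0 : 0 <= rate by rewrite /rate mulr_ge0// noise_energy_ge0.
pose l0 := 1 + 8 * B * K1 + 16 * rate.
have l00 : 0 < l0.
  have : 0 <= B * K1 by rewrite mulr_ge0// ltW.
  by rewrite /l0; move: rate0; lra.
have size0 : 0 <= size by exact: sqrtr_ge0.
have [tau [tau0 taum tau_cvg tauP]] := modulus_exists size0 (ltW l00) T0 aK a_cvg.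
(* [tau] already contains the exponential factor at time [T], so that any
   positive exponent will do *)
exists tau, 1; split => // eps t eps0 tT.
have hx := hxeps eps eps0.
have LD := L2_vectorB sH1 (alc_L2 (msn_class hx) tT) (alc_L2 (ms_class hx') tT).
rewrite mean_squareE// lee_fin mul1r.
have [Ce _ hCe] := l2_curve_bounded sH1 (fun s => alc_L2 (msn_class hx) (t := s))
  (adapted_L2_continuous_dist sH1 (msn_class hx)).
have DC s : 0 <= s <= T -> l2 P (fun w => xeps eps s w - x' s w) <= Ce + C.
  move=> sT; apply: le_trans (l2B sH1 (alc_L2 (msn_class hx) sT) (alc_L2 (ms_class hx') sT)) _.
  by apply: lerD; [exact: hCe|exact: hC].
have lp : 0 < l0 * (1 + eps ^+ 2).
  by rewrite mulr_gt0// ltr_pwDl// sqr_ge0.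
have dist := mild_solution_distance n1 sH1 n2 sH2 hF hQ hW hK1 hK42 hf_lip hg2 hT B0
  S0 (Se0 eps eps0) BS (fun t => BSe eps t eps0) hx0_L2 eps0 hx hx' (gamma0 eps eps0)
  C0 lp (fun r => gap_gamma eps r eps0) hC (lexx _) erefl DC tT.
have /andP[t0 tT'] := tT.
have tau_le := tauP eps eps0.
apply: (@le_trans _ _ (tau eps)); last first.
  by rewrite -[leLHS]mulr1 ler_wpM2l ?(ltW (tau0 eps eps0))// -expR0 ler_expR.
apply: le_trans tau_le.
have pos : 0 <= 2 * (a eps + eps * size).
  by rewrite mulr_ge0// addr_ge0// ?mulr_ge0 ?(ltW eps0)//; case/andP : (aK eps eps0).
rewrite lerXn2r ?nnegrE ?l2_ge0//; first by rewrite mulr_ge0// expR_ge0.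
apply: le_trans dist _; rewrite ler_wpM2l// ler_expR.
by rewrite ler_wpM2l// ltW.
Qed.
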